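(* Assume hypotheses (H1)--(H11) and (H14) listed in the context. Then for every $\omega\in\mathcal O$ the standing wave $e^{\mathrm i\omega t}\phi_\omega$ of (NLS) is not trapped by the energy: for every $\varepsilon>0$ there exists $u_\varepsilon$ with $\|\phi_\omega-u_\varepsilon\|_{H^1}<\varepsilon$, $\|u_\varepsilon\|_{L^2}=\|\phi_\omega\|_{L^2}$ and $E(u_\varepsilon)<E(\phi_\omega)$.
   Context: **Equation.** On $\mathbb R^2$ consider $$\text{(NLS)}\qquad \mathrm i u_t=-\Delta u+Vu+\beta(|u|^2)u .$$ $H^1=H^1(\mathbb R^2,\mathbb C)$. Energy $E(u)=\frac12\int_{\mathbb R^2}(|\nabla u|^2+V|u|^2+B(|u|^2))dx$ with $B(0)=0$, $B'=\beta$; mass $Q(u)=\frac12\int_{\mathbb R^2}|u|^2dx$; $q(\omega)=Q(\phi_\omega)$. For $k\ge1$, $\|u\|_{\Sigma_k}^2=\sum_{|\alpha|\le k}(\|x^\alpha u\|_{L^2}^2+\|\partial_x^\alpha u\|_{L^2}^2)$. **Hypotheses (H1)--(H5).** - (H1) $\beta(0)=0$, $\beta\in C^\infty(\mathbb R,\mathbb R)$. - (H2) There is $p\in\mathbb R$ such that for every $k\ge0$ there is $C_k$ with $|\frac{d^k}{dv^k}\beta(v^2)|\le C_k|v|^{p-k-1}$ if $|v|\ge1$. - (H3) $V$ is smooth, non zero, real valued, and for every multi-index $\alpha$ there are $C_\alpha,a_\alpha>0$ with $|\partial_x^\alpha V(x)|\le C_\alpha e^{-a_\alpha|x|}$. -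 (H4) There is an open interval $\mathcal O\subset(0,\infty)$ and a map $\omega\mapsto\phi_\omega$, in $C^2(\mathcal O,\Sigma_k(\mathbb R^2,\mathbb C))$ for every $k$, with $\Delta\phi_\omega-V\phi_\omega-\omega\phi_\omega-\beta(|\phi_\omega|^2)\phi_\omega=0$; moreover $\phi_\omega(x)=e^{\mathrm i m\arg(x)}\psi_\omega(|x|)$, $\psi_\omega$ real valued, $m\ge1$ an integer. - (H5) $q'(\omega)\ne0$ for all $\omega\in\mathcal O$. **Linearization.** Identify $\mathbb C=\mathbb R^2$; multiplication by $\mathrm i$ becomes $-J$, $J=\begin{pmatrix}0&1\\-1&0\end{pmatrix}$. Let $\langle f,g\rangle=\int_{\mathbb R^2}(f_1g_1+f_2g_2)dx$, extended as a $\mathbb C$-bilinear form to $L^2(\mathbb R^2,\mathbb C^2)=L^2(\mathbb R^2,\mathbb R^2)\otimes_{\mathbb R}\mathbb C$, and let $\overline{\,\cdot\,}$ be the complex conjugation on this complexification. Put $\Omega(X,Y)=\langle J^{-1}X,Y\rangle$ (bilinear). The linearized operator is $\mathcal L_\omega=J(\nabla^2E(\phi_\omega)+\omega)$, i.e. for real $v$ $$\mathcal L_\omega v=J\big[(-\Delta+\omega+V)v+\beta(|\phi_\omega|^2)v+2\beta'(|\phi_\omega|^2)(\phi_\omega\cdot v)\phi_\omega\big]$$ ($\cdot$ the scalar product of $\mathbb R^2$), extended $\mathbb C$-linearly to $L^2(\mathbb R^2,\mathbb C^2)$ with domain $H^2(\mathbb R^2,\mathbb C^2)$. Its essential spectrum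 is $\sigma_e(\mathcal L_\omega)=\mathrm i\big((-\infty,-\omega]\cup[\omega,\infty)\big)$; $\sigma_p$ is the set of eigenvalues; $N_g(L)=\bigcup_{j\ge1}\ker L^j$. **Hypotheses (H6)--(H11)** (for all $\omega\in\mathcal O$). - (H6) $\sigma(\mathcal L_\omega)\subset\mathrm i\mathbb R$. - (H7) $\ker\mathcal L_\omega=\mathrm{Span}\{J\phi_\omega\}$ and $N_g(\mathcal L_\omega)=\mathrm{Span}\{J\phi_\omega,\partial_\omega\phi_\omega\}$. - (H8) For every nonzero eigenvalue of $\mathcal L_\omega$ the algebraic and geometric dimensions coincide. - (H9) There are no eigenvalues of $\mathcal L_\omega$ in $\sigma_e(\mathcal L_\omega)$. - (H10) $\pm\mathrm i\omega$ are neither eigenvalues nor resonances: if $\mathcal L_\omega F=\pm\mathrm i\omega F$ in the distributional sense with $F\in L^\infty(\mathbb R^2)$, then $F=0$. - (H11) There are $\mathbf n\ge1$ and $0<\lambda_1\le\dots\le\lambda_{\mathbf n}$ (depending on $\omega$) such that $\sigma_p(\mathcal L_\omega)=\{0\}\cup\{\pm\mathrm i\lambda_j\}$. There are integers $\mathbf n_0=0<\mathbf n_1<\dots<\mathbf n_{l_0}=\mathbf n$ such that $\lambda_i=\lambda_j$ exactly when $i,j$ are both in $(\mathbf n_l,\mathbf n_{l+1}]$ for some $l$, and then $\dim\ker(\mathcal L_\omega-\mathrm i\lambda_j)=\mathbf n_{l+1}-\mathbf n_l$. **Hypothesis (H14).** For each $\omega\in\mathcal O$ there are functions $\xi_1,\dots,\xi_{\mathbf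 n}$, in $\Sigma_k$ for every $k$, with $\xi_j\in\ker(\mathcal L_\omega-\mathrm i\lambda_j)$, $\Omega(\xi_j,\xi_k)=0$ and $\Omega(\xi_j,\overline\xi_k)=\mathrm i s_j\delta_{jk}$ with $s_j\in\{1,-1\}$ (such a basis exists under the previous hypotheses). (H14) states that, for every $\omega\in\mathcal O$, there is at least one $j$ with $s_j=1$. *)

(* Defs.v *)
From mathcomp Require Import all_boot all_order all_algebra.
From mathcomp Require Import complex.
From mathcomp Require Import all_classical all_reals all_analysis.
Import Order.TTheory GRing.Theory Num.Theory.
Import numFieldNormedType.Exports.

Set Implicit Arguments.
Unset Strict Implicit.
Unset Printing Implicit Defensive.

Local Open Scope classical_set_scope.
Local Open Scope ring_scope.
Local Open Scope complex_scope.

(* Functions stand for their classes modulo equality almost everywhere.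
   C is identified with R^2: a C-valued function on the plane is a [field R].
   [cfield R] is the complexification of [field R]; its scalars R[i] are
   unrelated to the identification C = R^2. *)
Notation plane R := (R * R)%type.
Notation field R := (plane R -> 'cV[R]_2).
Notation cfield R := (plane R -> 'cV[R[i]]_2).

Section SobolevSpaces.
Context {R : realType}.
Implicit Types (f g eta : plane R -> R) (v : field R).

Definition area : {measure set (measurableTypeR R * measurableTypeR R) -> \bar R} :=
  (lebesgue_measure \x lebesgue_measure)%E.

Definition eqae (T : Type) (u v : plane R -> T) : Prop :=
  {ae area, forall x, u x = v x}.

Definition absx (x : plane R) : R := Num.sqrt (x.1 ^+ 2 + x.2 ^+ 2).

(** Classical partial derivatives *)

Definition d1 f : plane R -> R := fun x => 'D_(1, 0) f x.
Definition d2 f : plane R -> R := fun x => 'D_(0, 1) f x.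

Definition pderiv (a b : nat) f : plane R -> R := iter a d1 (iter b d2 f).

Fixpoint Cn (n : nat) f : Prop :=
  continuous f /\
  if n is k.+1 then
    [/\ forall x, derivable f x (1, 0) /\ derivable f x (0, 1),
        Cn k (d1 f) & Cn k (d2 f)]
  else True.

Definition smooth2 f : Prop := forall n, Cn n f.

Definition smooth1 (f : R -> R) : Prop :=
  forall n x, derivable (derive1n n f) x 1.

Definition test_fun eta : Prop :=
  smooth2 eta /\
  exists2 K : set (plane R), compact K & forall x, ~ K x -> eta x = 0.

(** Weak derivatives *)

Definition L1loc f : Prop :=
  measurable_fun setT f /\
  forall K : set (plane R), compact K -> area.-integrable K (EFin \o f).

Definition L2 f : Prop := f \in Lfun area 2%:E.

Definition L2n f : R := fine 'N[area]_2%:E[EFin \o f].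

Definition weak_deriv (a b : nat) f g : Prop :=
  forall eta, test_fun eta ->
    \int[area]_x (f x * pderiv a b eta x) =
    (-1) ^+ (a + b) * \int[area]_x (g x * eta x).

(* A version of the weak derivative of order (a, b) of f, meaningful only if
   f has a locally integrable one (it is then unique almost everywhere). *)
Definition wD (a b : nat) f : plane R -> R :=
  xget (cst 0) [set g | L1loc g /\ weak_deriv a b f g].

Definition Hs (k : nat) f : Prop :=
  L2 f /\
  forall a b, (a + b <= k)%N -> exists2 g, L2 g & weak_deriv a b f g.

Definition xpow (a b : nat) f : plane R -> R :=
  fun x => x.1 ^+ a * x.2 ^+ b * f x.

Definition Sigmas (k : nat) f : Prop :=
  Hs k f /\ forall a b, (a + b <= k)%N -> L2 (xpow a b f).

(** Spaces of vector fields, componentwise *)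

Definition vcomp v (i : 'I_2) : plane R -> R := fun x => v x i 0.

Definition inL2 v : Prop := forall i, L2 (vcomp v i).
Definition inLoo v : Prop := forall i, vcomp v i \in Lfun area +oo%E.
Definition inH (k : nat) v : Prop := forall i, Hs k (vcomp v i).
Definition inSigma (k : nat) v : Prop := forall i, Sigmas k (vcomp v i).

Definition L2norm v : R := Num.sqrt (\sum_i L2n (vcomp v i) ^+ 2).

Definition H1norm v : R :=
  Num.sqrt (\sum_i (L2n (vcomp v i) ^+ 2 + L2n (wD 1 0 (vcomp v i)) ^+ 2
                    + L2n (wD 0 1 (vcomp v i)) ^+ 2)).

Definition Sigma_norm (k : nat) v : R :=
  Num.sqrt (\sum_i \sum_(a < k.+1) \sum_(b < k.+1 | (a + b <= k)%N)
    (L2n (xpow a b (vcomp v i)) ^+ 2 + L2n (wD a b (vcomp v i)) ^+ 2)).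

Definition lap v : field R :=
  fun x => \col_i (wD 2 0 (vcomp v i) x + wD 0 2 (vcomp v i) x).

(* F is of class C^1 from the open set O to Sigma_k, with derivative dF. *)
Definition C1_Sigma (k : nat) (O : set R) (F dF : R -> field R) : Prop :=
  forall w, O w ->
  [/\ inSigma k (F w), inSigma k (dF w),
      Sigma_norm k (h^-1 *: (F (w + h) - F w) - dF w) @[h --> 0^'] --> (0 : R) &
      Sigma_norm k (dF w' - dF w) @[w' --> w] --> (0 : R)].

End SobolevSpaces.

Section Complexification.
Context {R : realType}.
Implicit Types (X Y : cfield R).

Definition reF X : field R := fun x => map_mx (@complex.Re R) (X x).
Definition imF X : field R := fun x => map_mx (@complex.Im R) (X x).

Definition cplx (u v : field R) : cfield R :=
  fun x => \col_i (u x i 0 +i* v x i 0).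

Definition realF (v : field R) : cfield R := cplx v 0.

Definition conjF X : cfield R := fun x => map_mx (@conjc R) (X x).

Definition cinL2 X : Prop := inL2 (reF X) /\ inL2 (imF X).
Definition cinLoo X : Prop := inLoo (reF X) /\ inLoo (imF X).
Definition cinH (k : nat) X : Prop := inH k (reF X) /\ inH k (imF X).
Definition cinSigma (k : nat) X : Prop :=
  inSigma k (reF X) /\ inSigma k (imF X).

Definition cL2norm X : R :=
  Num.sqrt (L2norm (reF X) ^+ 2 + L2norm (imF X) ^+ 2).

Definition cint (f : plane R -> R[i]) : R[i] :=
  (\int[area]_x complex.Re (f x)) +i* (\int[area]_x complex.Im (f x)).

Definition Jmx (K : nzRingType) : 'M[K]_2 :=
  \matrix_(i, j) (if i == j then 0 else if i == 0 then 1 else -1).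

(* C-bilinear, without conjugation *)
Definition bracket X Y : R[i] :=
  cint (fun x => \sum_i X x i 0 * Y x i 0).

Definition Omega X Y : R[i] :=
  bracket (fun x => invmx (Jmx (R[i] : comUnitRingType)) *m X x) Y.

End Complexification.

(** Spectral notions for an operator L on L^2(R^2, C^2) with domain H^2 *)
Section Spectrum.
Context {R : realType}.
Variable L : cfield R -> cfield R.
Implicit Types (X F G : cfield R) (z : R[i]).

(* the domain of (L - z)^j is the usual one of the powers of an unbounded
   operator *)
Fixpoint kerpow z (j : nat) X : Prop :=
  if j is k.+1 then cinH 2 X /\ kerpow z k (L X - z *: X) else eqae X 0.

Definition ker z : set (cfield R) := kerpow z 1.

Definition gker z : set (cfield R) :=
  [set X | exists2 j, (0 < j)%N & kerpow z j X].

Definition eigenvalue z : Prop := exists2 X, ker z X & ~ eqae X 0.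

Definition resolvent : set R[i] :=
  [set z | (forall G, cinL2 G ->
              exists2 F, cinH 2 F & eqae (L F - z *: F) G) /\
           (exists M : R, forall F, cinH 2 F ->
              cL2norm F <= M * cL2norm (L F - z *: F))].

Definition spectrum : set R[i] := ~` resolvent.

Definition spanned_by (P : set (cfield R)) (n : nat) (e : 'I_n -> cfield R) : Prop :=
  (forall j, P (e j)) /\
  (forall X, P X -> exists c : 'I_n -> R[i], eqae X (\sum_j c j *: e j)).

(* dimension modulo equality almost everywhere *)
Definition has_dim (P : set (cfield R)) (n : nat) : Prop :=
  exists2 e : 'I_n -> cfield R, spanned_by P e &
    forall c : 'I_n -> R[i], eqae (\sum_j c j *: e j) 0 -> forall j, c j = 0.

End Spectrum.

Section NLS.
Context {R : realType}.
Variables (V : plane R -> R) (beta : R -> R).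
Implicit Types (u v phi : field R) (w : R).

Definition dot (a b : 'cV[R]_2) : R := \sum_i a i 0 * b i 0.
Definition normsq (a : 'cV[R]_2) : R := dot a a.

Definition is_primitive0 (B : R -> R) : Prop :=
  B 0 = 0 /\ forall s : R, is_derive s (1 : R) B (beta s).

Definition energy (B : R -> R) u : R :=
  2^-1 * \int[area]_x
    (\sum_i (wD 1 0 (vcomp u i) x ^+ 2 + wD 0 1 (vcomp u i) x ^+ 2)
     + V x * normsq (u x) + B (normsq (u x))).

Definition mass u : R := 2^-1 * \int[area]_x normsq (u x).

(** The linearization at phi *)

Definition zeroth w phi v : field R := fun x =>
  (w + V x) *: v x + beta (normsq (phi x)) *: v x
  + (2 * derive1 beta (normsq (phi x)) * dot (phi x) (v x)) *: phi x.

Definition Lreal w phi v : field R :=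
  fun x => Jmx R *m (- lap v x + zeroth w phi v x).

Definition Lop w phi (X : cfield R) : cfield R :=
  cplx (Lreal w phi (reF X)) (Lreal w phi (imF X)).

(* The identity (L v = g) in the sense of distributions. *)
Definition Lreal_distr w phi v (g : field R) : Prop :=
  forall (i : 'I_2) eta, test_fun eta ->
    \int[area]_x (- (pderiv 2 0 eta x + pderiv 0 2 eta x) * (Jmx R *m v x) i 0
                  + eta x * (Jmx R *m zeroth w phi v x) i 0)
    = \int[area]_x (eta x * g x i 0).

Definition Lop_distr w phi (X Y : cfield R) : Prop :=
  Lreal_distr w phi (reF X) (reF Y) /\ Lreal_distr w phi (imF X) (imF Y).

(* explicit form of the essential spectrum of [Lop w phi], which by Weyl's
   theorem does not depend on the decaying V and phi *)
Definition ess_spectrum w : set R[i] :=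
  [set z | complex.Re z = 0 /\ (complex.Im z <= - w \/ w <= complex.Im z)].

(** Hypotheses on the nonlinearity and on the potential *)

Definition beta_smooth : Prop := beta 0 = 0 /\ smooth1 beta.

Definition beta_growth : Prop :=
  exists p : R, forall k : nat, exists C : R, forall s : R, 1 <= `|s| ->
    `|derive1n k (fun t => beta (t ^+ 2)) s| <= C * `|s| `^ (p - k%:R - 1).

Definition V_decay : Prop :=
  [/\ smooth2 V, exists x, V x != 0 &
      forall a b : nat, exists C : R, exists c : R, [/\ 0 < C, 0 < c &
        forall x, `|pderiv a b V x| <= C * expR (- c * absx x)]].

(** Hypotheses on the family of standing waves; dphi and d2phi are the first
    and second derivatives of phi in w *)

Definition open_interval (O : set R) : Prop :=
  [/\ open O, is_interval O & O `<=` [set w | 0 < w]].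

(* Delta phi - V phi - w phi - beta(|phi|^2) phi = 0 *)
Definition stationary w phi : Prop :=
  eqae (fun x => lap phi x - V x *: phi x - w *: phi x
                 - beta (normsq (phi x)) *: phi x) 0.

(* phi(x) = e^{i m arg x} psi(|x|), theta being any argument of x *)
Definition vortex (m : nat) phi : Prop :=
  exists psi : R -> R, {ae area, forall x : plane R, forall theta : R,
    x = (absx x * cos theta, absx x * sin theta) ->
    phi x = \col_i (psi (absx x) *
                    (if i == 0 then cos (m%:R * theta) else sin (m%:R * theta)))}.

Definition standing_waves (m : nat) (O : set R) (phi dphi d2phi : R -> field R) : Prop :=
  [/\ open_interval O, (0 < m)%N,
      (forall k, C1_Sigma k O phi dphi /\ C1_Sigma k O dphi d2phi) &
      forall w, O w -> stationary w (phi w) /\ vortex m (phi w)].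

Definition mass_nondegenerate (O : set R) (phi : R -> field R) : Prop :=
  forall w, O w -> derive1 (fun w' => mass (phi w')) w != 0.

(** Spectral hypotheses, for a fixed frequency w; phi and dphi are the values
    at w of the family of waves and of its derivative *)

Definition spectral_stability w phi : Prop :=
  forall z, spectrum (Lop w phi) z -> complex.Re z = 0.

Definition kernel_hyp w phi (dphi : field R) : Prop :=
  let Jphi := realF (fun x => Jmx R *m phi x) in
  spanned_by (ker (Lop w phi) 0) (fun _ : 'I_1 => Jphi) /\
  spanned_by (gker (Lop w phi) 0)
    (fun j : 'I_2 => if j == 0 then Jphi else realF dphi).

(* equality of the dimensions as elements of nat + {oo} *)
Definition semisimple w phi : Prop :=
  forall z, z != 0 -> eigenvalue (Lop w phi) z ->
  forall n, has_dim (gker (Lop w phi) z) n <-> has_dim (ker (Lop w phi) z) n.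

Definition no_embedded w phi : Prop :=
  forall z, eigenvalue (Lop w phi) z -> ~ ess_spectrum w z.

Definition no_resonance w phi : Prop :=
  forall z : R[i], z = 0 +i* w \/ z = 0 +i* (- w) ->
  forall F, cinLoo F -> Lop_distr w phi F (z *: F) -> eqae F 0.

Definition point_spectrum w phi (n : nat) (lam : 'I_n -> R) : Prop :=
  [/\ (0 < n)%N, forall j, 0 < lam j,
      (forall i j : 'I_n, (i <= j)%N -> lam i <= lam j),
      (forall z, eigenvalue (Lop w phi) z <->
         z = 0 \/ exists j, z = 0 +i* lam j \/ z = 0 +i* (- lam j)) &
      exists (l0 : nat) (N : nat -> nat),
      [/\ N 0%N = 0%N, N l0 = n, (forall l, (l < l0)%N -> (N l < N l.+1)%N),
          (forall i j : 'I_n, lam i = lam j <->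
             exists2 l, (l < l0)%N & (N l <= i < N l.+1)%N /\ (N l <= j < N l.+1)%N) &
          forall l (j : 'I_n), (l < l0)%N -> (N l <= j < N l.+1)%N ->
            has_dim (ker (Lop w phi) (0 +i* lam j)) (N l.+1 - N l)]].

Definition normalized_basis w phi (n : nat) (lam : 'I_n -> R)
    (xi : 'I_n -> cfield R) (s : 'I_n -> R) : Prop :=
  [/\ (forall j k, cinSigma k (xi j)),
      (forall j, ker (Lop w phi) (0 +i* lam j) (xi j)),
      (forall j, s j = 1 \/ s j = -1),
      (forall j k, Omega (xi j) (xi k) = 0) &
      (forall j k, Omega (xi j) (conjF (xi k)) = 0 +i* (s j *+ (j == k)))].

Definition krein_positive w phi (n : nat) (lam : 'I_n -> R) : Prop :=
  exists (xi : 'I_n -> cfield R) (s : 'I_n -> R),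
    normalized_basis w phi lam xi s /\ exists j, s j = 1.

End NLS.

(* Main.v *)
(* Let xi = f + i g be an eigenvector for i lam whose Krein sign s is 1, and let
   H be the Hessian of E + w Q at phi, so that L = J H. Then H f = - lam J^-1 g and
   H g = lam J^-1 f, and the normalization Omega(xi, conj xi) = i gives
   <H f, f> = - lam / 2 < 0. Testing the equation of H g with J phi, which
   lies in the kernel of H, gives <f, phi> = 0. Hence u = c (phi + t f), with
   c^2 = 1 / (1 + t^2 |f|^2 / |phi|^2), has the mass of phi; as phi is critical
   for E + w Q, 2 (E(u) - E(phi)) = - c^2 t^2 lam / 2 + O(t^3) < 0 for small t.
   The Taylor expansion of B under the integral uses that phi and f are bounded,
   and the symmetry of H uses integration by parts for weak derivatives
   tested against smooth functions only. Both follow from the increment formula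
   f(x + s e_1) - f(x) = int_0^s d_1 f (x + r e_1) dr for weak derivatives. *)
From HB Require Import structures.
Require Import Defs.
From mathcomp Require Import all_boot all_order all_algebra.
From mathcomp Require Import complex ring lra.
From mathcomp Require Import all_classical all_reals all_analysis measurable_realfun.
Import Order.TTheory GRing.Theory Num.Theory.
Import numFieldNormedType.Exports.

Set Implicit Arguments.
Unset Strict Implicit.
Unset Printing Implicit Defensive.

Local Open Scope classical_set_scope.
Local Open Scope ring_scope.

(** * Smooth bumps on the line *)

Section Smooth.
Context {R : realType}.
Implicit Types (a b : R -> R).

(** Weak derivatives are known only through their pairings with test functions, so the increment
    formula has to be tested, and the only tests ever used are products a(x_1) b(x_2). They suffice
    because smooth bumps converge to indicators of half-open intervals, and integrals over
    rectangles of such intervals determine a locally integrable function almost everywhere; no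
    mollification is involved. On a product, a translation in x_1 acts on a alone, and a - a(. - s)
    is the derivative of a test function; the increment formula is then Fubini for a pairing. It
    holds for each s outside a null set that depends on s, which is why null sets in the joint
    variable (x, s) recur. Averaging it over s in [0, 1], in each coordinate in turn, bounds |f| by
    integrals over unit squares of f, d_1 f, d_2 f and d_1 d_2 f: this is the boundedness of H^2
    functions. The second coordinate is reduced to the first by exchanging the two. In the energy, a
    remainder O(t^3) is not enough, since it is integrated over the whole plane: it is kept below C
    t^3 (|phi|^2 + |f|^2). *)

Fixpoint Dn (n : nat) a : Prop :=
  if n is k.+1 then (forall x, derivable a x 1) /\ Dn k (derive1 a) else True.

Definition Doo a : Prop := forall n, Dn n a.

Lemma Dn_le n a : Dn n.+1 a -> Dn n a.
Proof. by elim: n a => [//|n IH] a [da /IH]. Qed.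

Lemma derivable1_cont a x : derivable a x 1 -> {for x, continuous a}.
Proof. by move=> /derivable1_diffP /differentiable_continuous. Qed.

Lemma Doo_derivable a x : Doo a -> derivable a x 1.
Proof. by move=> /(_ 1%N) [+ _]; exact. Qed.

Lemma Doo_cont a : Doo a -> continuous a.
Proof. by move=> aD x; apply: derivable1_cont; exact: Doo_derivable. Qed.

Lemma Doo_derive a : Doo a -> Doo (derive1 a).
Proof. by move=> aD n; have [] := aD n.+1. Qed.

Lemma derive1D a b : (forall x, derivable a x 1) -> (forall x, derivable b x 1) ->
  derive1 (fun x => a x + b x) = (fun x => (derive1 a) x + (derive1 b) x).
Proof.
by move=> da db; apply/funext => x; rewrite !derive1E (@deriveD _ _ _ a b).
Qed.

Lemma derive1M a b : (forall x, derivable a x 1) -> (forall x, derivable b x 1) ->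
  derive1 (fun x => a x * b x) = (fun x => (derive1 a) x * b x + a x * (derive1 b) x).
Proof.
move=> da db; apply/funext => x; rewrite !derive1E (@deriveM _ _ a b)//.
by rewrite addrC mulrC.
Qed.

Lemma DnD n a b : Dn n a -> Dn n b -> Dn n (fun x => a x + b x).
Proof.
elim: n a b => [//|n IH] a b [da Da] [db Db]; split.
  by move=> x; exact: (@derivableD _ _ _ a b).
by rewrite derive1D//; exact: IH.
Qed.

Lemma DnM n a b : Dn n a -> Dn n b -> Dn n (fun x => a x * b x).
Proof.
elim: n a b => [//|n IH] a b Da Db; have [da Da'] := Da; have [db Db'] := Db.
split; first by move=> x; exact: (@derivableM _ _ a b).
by rewrite derive1M//; apply: DnD; apply: IH => //; exact: Dn_le.
Qed.

Lemma Dn_cst n c : Dn n (fun=> c).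
Proof.
elim: n c => [//|n IH] c; split; first by move=> x; exact: derivable_cst.
have -> : derive1 (fun=> c) = (fun=> 0) :> (R -> R).
  by apply/funext => x; exact: derive1_cst.
exact: IH.
Qed.

Lemma is_derive_aff a (c d x df : R) : is_derive (c * x + d) 1 a df ->
  is_derive x 1 (fun x => a (c * x + d)) (df * c).
Proof.
move=> da; apply: is_derive1_comp.
have h : is_derive x 1 (fun x => c * x) (c *: 1).
  exact: (@is_deriveZ _ _ _ id c x 1 1).
have -> : (fun x0 => c * x0 + d) = (fun x => c * x) + cst d by [].
have := is_deriveD h (is_derive_cst (d : R) (x : R) (1 : R)).
by rewrite addr0 /GRing.scale /= mulr1.
Qed.

Lemma derive1_aff a (c d : R) : (forall x, derivable a x 1) ->
  derive1 (fun x => a (c * x + d)) = (fun x => c * (derive1 a) (c * x + d)).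
Proof.
move=> da; apply/funext => x.
have h := is_derive_aff (derivableP (da (c * x + d))).
by rewrite !derive1E (derive_val) mulrC.
Qed.

Lemma Dn_aff n a (c d : R) : Dn n a -> Dn n (fun x => a (c * x + d)).
Proof.
elim: n a => [//|n IH] a [da Da]; split.
  by move=> x; case: (is_derive_aff (derivableP (da (c * x + d)))).
rewrite derive1_aff//; apply: DnM; [exact: Dn_cst | exact: IH].
Qed.

Lemma DooM a b : Doo a -> Doo b -> Doo (fun x => a x * b x).
Proof. by move=> aD bD n; exact: DnM. Qed.

Lemma Doo_aff a (c d : R) : Doo a -> Doo (fun x => a (c * x + d)).
Proof. by move=> aD n; exact: Dn_aff. Qed.

(* The functions t^-k e^(-1/t), which are stable under differentiation. *)
Definition flat (k : nat) (t : R) : R :=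
  if 0 < t then t^-1 ^+ k * expR (- t^-1) else 0.

Lemma flat_ge0 k t : 0 <= flat k t.
Proof.
rewrite /flat; case: ifPn => // t0.
by rewrite mulr_ge0// ?expR_ge0// exprn_ge0// invr_ge0 ltW.
Qed.

(** With y = 1/t, the exponential series gives e^y >= y^(k+1) / (k+1)!, that is y^k e^(-y) <= (k+1)!
    t. This linear bound is what makes [flat] differentiable at 0. *)
Lemma flat_le k t : flat k t <= (k.+1)`!%:R * `|t|.
Proof.
rewrite /flat; case: ifPn => t0; last by rewrite mulr_ge0.
have y0 : 0 < t^-1 by rewrite invr_gt0.
rewrite expRN ler_pdivrMr ?expR_gt0//.
have := @expR_ge1Dxn R t^-1 k (ltW y0).
rewrite gtr0_norm// => h.
have h2 : t^-1 ^+ k.+1 / (k.+1)`!%:R <= expR t^-1.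
  by apply: le_trans h; rewrite lerDr.
rewrite -mulrA -ler_pdivrMl ?ltr0n ?fact_gt0//.
have -> : (k.+1)`!%:R^-1 * t^-1 ^+ k = t * (t^-1 ^+ k.+1 / (k.+1)`!%:R).
  by rewrite exprS !mulrA mulfV ?gt_eqF// mul1r mulrC.
by rewrite ler_pM2l.
Qed.

Lemma is_derive_flat k (t : R) :
  is_derive t (1 : R) (flat k) (flat k.+2 t - k%:R * flat k.+1 t).
Proof.
have [t0|t0|->] := ltgtP t 0.
- rewrite /flat !ltNge (ltW t0)/= mulr0 subr0.
  apply: (@near_eq_is_derive _ _ _ (cst 0)).
  near=> s; rewrite /flat ltNge ltW//=.
  near: s; exact: lt_nbhsl.
- apply: (@near_eq_is_derive R R R (fun s : R => s^-1 ^+ k * expR (- s^-1))).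
    near=> s; rewrite /flat ifT//; near: s; exact: lt_nbhsr.
  rewrite /flat t0.
  have dV : is_derive t 1 (fun s : R => s^-1) (- t^-1 ^+ 2).
    apply: is_derive_eq; first by apply: is_deriveV; rewrite gt_eqF.
    by rewrite /GRing.scale/= mulr1 exprVn.
  have dE : is_derive t 1 (fun s : R => expR (- s^-1)) (expR (- t^-1) * t^-1 ^+ 2).
    apply: is_derive1_comp.
    have -> : (fun x : R => - x^-1) = - (fun x : R => x^-1) by [].
    by have := is_deriveN dV; rewrite opprK.
  have dX := @is_deriveX _ _ (fun s : R => s^-1) k t 1 _ dV.
  have := @is_deriveM _ _ ((fun s : R => s^-1) ^+ k) _ t 1 _ _ dX dE.
  have -> : (fun s : R => s^-1) ^+ k * (fun s : R => expR (- s^-1)) =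
     (fun s => s^-1 ^+ k * expR (- s^-1)).
    by apply/funext => s /=; rewrite fctE /= ; congr (_ * _); elim: (k) => [|j IH]; rewrite ?expr0// !exprS /= -IH.
  rewrite /GRing.scale /=.
  have -> : ((fun s : R => s^-1) ^+ k) t = t^-1 ^+ k.
    by elim: (k) => [|j IH]; rewrite ?expr0// !exprS /= -IH.
  move=> h; apply: (is_derive_eq h).
  by case: k {dX h} => [|k]; rewrite /= ?mul0r !exprS; ring.
- have -> : flat k.+2 0 - k%:R * flat k.+1 0 = 0.
    by rewrite /flat ltxx mulr0 subr0.
  suff h : h^-1 *: ((flat k \o shift 0) (h *: (1:R)) - flat k 0) @[h --> 0^'] --> (0:R).
    split; first by apply/cvg_ex; exists 0.
    by apply/cvg_lim.
  (* At 0 the difference quotient of [flat k] is [flat k.+1] itself, on both sides of 0, and the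
     linear bound sends it to 0. *)
  have e : (fun h : R => h^-1 *: ((flat k \o shift 0) (h *: (1:R)) - flat k 0)) = flat k.+1.
    apply/funext => s; rewrite /= /GRing.scale /= mulr1 addr0 /flat ltxx subr0.
    by case: ifPn => // s0; [rewrite exprS mulrA|rewrite mulr0].
  rewrite e; apply/cvgr0Pnorm_le => //= e0 e00.
  near=> s; rewrite (ger0_norm (flat_ge0 _ _)).
  apply: le_trans (flat_le _ _) _.
  rewrite -ler_pdivlMl ?ltr0n ?fact_gt0//.
  near: s; apply: dnbhs0_le; by rewrite mulr_gt0// invr_gt0 ltr0n fact_gt0.
Unshelve. all: by end_near. Qed.

Lemma Doo_flat k : Doo (flat k).
Proof.
move=> n; elim: n k => [//|n IH] k; split.
  by move=> x; case: (is_derive_flat k x).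
have -> : derive1 (flat k) = (fun t => flat k.+2 t + (- k%:R) * flat k.+1 t).
  apply/funext => t; rewrite derive1E.
  by have h := is_derive_flat k t; rewrite derive_val mulNr.
apply: DnD => //; apply: DnM => //; exact: Dn_cst.
Qed.

Lemma flat_gt0 t : (0 < t) -> flat 0 t = expR (- t^-1).
Proof. by rewrite /flat => ->; rewrite expr0 mul1r. Qed.

Lemma flat_le0 t : t <= 0 -> flat 0 t = 0.
Proof. by rewrite /flat ltNge => ->. Qed.

Lemma flat0_le1 t : flat 0 t <= 1.
Proof.
rewrite /flat; case: ifPn => // t0; rewrite expr0 mul1r expR_le1 oppr_le0.
by rewrite invr_ge0 ltW.
Qed.

Definition test1 a : Prop := Doo a /\ exists M : R, forall x, M < `|x| -> a x = 0.

Lemma test1_derive a : test1 a -> test1 (derive1 a).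
Proof.
move=> [aD [M aM]]; split; first exact: Doo_derive.
exists M => x Mx; rewrite derive1E (@near_eq_derive _ _ _ _ (cst 0)).
- exact: derive_cst.
- by near=> y; rewrite aM//; near: y; apply: (@cvgr_gt _ _ _ _ Num.norm (`|x|)) => //; exact: norm_continuous.
Unshelve. all: by end_near. Qed.

Lemma test1_cont a : test1 a -> continuous a.
Proof. by move=> [/Doo_cont]. Qed.

Lemma test1_bound a : test1 a -> exists C, forall x, `|a x| <= C.
Proof.
move=> ta; have [aD [M aM]] := ta.
have c : {within `[- `|M|, `|M|], continuous (Num.norm \o a)}.
  apply: continuous_subspaceT => x; apply: continuous_comp.
    exact: test1_cont. exact: norm_continuous.
have [|z zi hz] := EVT_max _ c; first by rewrite lerNl (le_trans _ (normr_ge0 _))// oppr_le0.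
exists (Num.max 0 `|a z|) => x; have [xM|xM] := leP `|x| `|M|.
  by rewrite le_max hz ?orbT// in_itv/= -ler_norml.
by rewrite aM ?normr0 ?le_max ?lexx// (le_lt_trans (ler_norm _)).
Qed.

(** Smooth approximations of the indicator of ]c, d]. The left factor vanishes up to c and tends to
    1 beyond it. The right factor vanishes from d + 1/m on; the square on m makes its argument equal
    to m at x = d, so that it tends to 1 at the closed endpoint too. *)
Definition bumpf (c d : R) (n : nat) (x : R) : R :=
  let m : R := n.+1%:R in
  flat 0 (m * (x - c)) * flat 0 (m ^+ 2 * (d + m^-1 - x)).

Lemma bumpf_test1 c d n : test1 (bumpf c d n).
Proof.
split.
  apply: DooM.
    have -> : (fun x => flat 0 (n.+1%:R * (x - c))) =
      (fun x => flat 0 (n.+1%:R * x + (- n.+1%:R * c))).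
      by apply/funext => x; congr flat; ring.
    by apply: Doo_aff; exact: Doo_flat.
  have -> : (fun x => flat 0 (n.+1%:R ^+ 2 * (d + n.+1%:R^-1 - x))) =
      (fun x => flat 0 (- n.+1%:R ^+ 2 * x + (n.+1%:R ^+ 2 * (d + n.+1%:R^-1)))).
    by apply/funext => x; congr flat; ring.
  by apply: Doo_aff; exact: Doo_flat.
exists (`|c| + (`|d| + n.+1%:R^-1)) => x.
have n0 : 0 < n.+1%:R^-1 :> R by rewrite invr_gt0.
rewrite lter_normr => /orP[h|h]; rewrite /bumpf.
  rewrite [X in _ * X]flat_le0 ?mulr0// pmulr_rle0 ?exprn_gt0//.
  by move: (n.+1%:R^-1) n0 h => e e0; have := normr_ge0 c; have := ler_norm d; lra.
rewrite flat_le0 ?mul0r// pmulr_rle0//.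
by move: (n.+1%:R^-1) n0 h => e e0; have := normr_ge0 d; have := ler_norm (- c); rewrite normrN; lra.
Qed.

Lemma bumpf_ge0 c d n x : 0 <= bumpf c d n x.
Proof. by rewrite mulr_ge0// flat_ge0. Qed.

Lemma bumpf_le1 c d n x : bumpf c d n x <= 1.
Proof. by rewrite -[leRHS]mulr1 ler_pM// ?flat_ge0// flat0_le1. Qed.

(** The bound on the support is uniform in n, as dominated convergence requires. *)
Lemma bumpf_supp (c d : R) n x : c - 1 < x <= d + 1 \/ bumpf c d n x = 0.
Proof.
have n0 : 0 < n.+1%:R^-1 :> R by rewrite invr_gt0.
have n1 : n.+1%:R^-1 <= 1 :> R by rewrite invf_le1// ler1n.
have [h|h] := leP x (c - 1).
  by right; rewrite /bumpf flat_le0 ?mul0r// pmulr_rle0//; lra.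
have [h2|h2] := leP x (d + 1); [by left|right].
rewrite /bumpf [X in _ * X]flat_le0 ?mulr0// pmulr_rle0 ?exprn_gt0//.
by move: (n.+1%:R^-1) n0 n1 => e; lra.
Qed.

Lemma cvg_expRNV (u : R ^nat) : (forall n, 0 < u n) -> ((u n)^-1 @[n --> \oo] --> (0 : R)) ->
  expR (- (u n)^-1) @[n --> \oo] --> (1 : R).
Proof.
move=> u0 uy; rewrite -[X in _ --> X](@expR0 R) -[X in _ --> expR X]oppr0.
by apply: continuous_cvg; [exact: continuous_expR|exact: cvgN].
Qed.

Lemma bumpf_cvg c d x :
  bumpf c d n x @[n --> \oo] --> (\1_(`]c, d]) x : R).
Proof.
have cV : (n.+1%:R : R)^-1 @[n --> \oo] --> (0 : R) by exact: cvg_harmonic.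
have n0 (n : nat) : 0 < n.+1%:R^-1 :> R by rewrite invr_gt0.
rewrite indicE; have [|] := boolP (x \in `]c, d]%classic).
  rewrite inE /= in_itv /= => /andP[cx xd].
  have -> : (true%:R : R) = 1 * 1 by rewrite mulr1.
  apply: cvgM.
    have -> : (fun n : nat => flat 0 (n.+1%:R * (x - c))) =
       (fun n : nat => expR (- (n.+1%:R * (x - c))^-1)).
      by apply/funext => n; rewrite flat_gt0// mulr_gt0// subr_gt0.
    apply: cvg_expRNV; first by move=> n; rewrite mulr_gt0// subr_gt0.
    have -> : (fun n : nat => (n.+1%:R * (x - c))^-1) =
       (fun n : nat => (n.+1%:R)^-1 * (x - c)^-1).
      by apply/funext => n; rewrite invfM.
    by rewrite -[X in _ --> X](mul0r (x - c)^-1); apply: cvgMl.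
  have p (n : nat) : 0 < n.+1%:R ^+ 2 * (d + n.+1%:R^-1 - x).
    by rewrite mulr_gt0// ?exprn_gt0//; move: (n.+1%:R^-1) (n0 n) => e; lra.
  have -> : (fun n : nat => flat 0 (n.+1%:R ^+ 2 * (d + n.+1%:R^-1 - x))) =
       (fun n : nat => expR (- (n.+1%:R ^+ 2 * (d + n.+1%:R^-1 - x))^-1)).
      by apply/funext => n; rewrite flat_gt0.
  apply: cvg_expRNV => //.
  apply: (@squeeze_cvgr _ _ _ _ (fun=> 0) (fun n : nat => n.+1%:R^-1)) => //; last exact: cvg_cst.
  apply: nearW => n; rewrite invr_ge0 (ltW (p n)) /=.
  rewrite lef_pV2 ?posrE//.
  have -> : n.+1%:R ^+ 2 * (d + n.+1%:R^-1 - x) = n.+1%:R ^+ 2 * (d - x) + n.+1%:R :> R.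
    have : n.+1%:R != 0 :> R by [].
    by move: (n.+1%:R : R) => e e0; field.
  by rewrite lerDr mulr_ge0// ?exprn_ge0// subr_ge0.
rewrite notin_setE /= in_itv /= => /negP; rewrite negb_and -!leNgt => /orP[xc|].
  apply: cvg_near_cst; apply: nearW => n.
  by rewrite /bumpf flat_le0 ?mul0r// pmulr_rle0// subr_le0.
rewrite -ltNge => dx; apply: cvg_near_cst; near=> n.
rewrite /bumpf [X in _ * X]flat_le0 ?mulr0// pmulr_rle0 ?exprn_gt0//.
suff : n.+1%:R^-1 <= x - d by move: (n.+1%:R^-1) => e; lra.
near: n; apply: (cvgr_le 0 cV); lra.
Unshelve. all: by end_near. Qed.

Lemma test1_integrable a D : measurable D -> test1 a ->
  lebesgue_measure.-integrable D (EFin \o a).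
Proof.
move=> mD ta; have [aD [M aM]] := ta.
suff : lebesgue_measure.-integrable setT (EFin \o a).
  by move=> h; apply: integrableS h.
have -> : EFin \o a = (EFin \o a) \_ `[- M, M].
  apply/funext => x; rewrite patchE; case: ifPn => //.
  rewrite notin_setE /= in_itv /= => /negP; rewrite -ler_norml -ltNge => h.
  by rewrite /= aM.
rewrite -integrable_mkcond//.
apply: continuous_compact_integrable; first exact: segment_compact.
by apply: continuous_subspaceT; exact: test1_cont.
Qed.

(** A primitive of a has compact support only if a has integral 0. The difference a - a(. - s)
    always has integral 0, and its primitive is the integral of a over a window of length s. In
    [wk1_shift] this turns a translation of a test function into a derivative. *)
Lemma test1_prim a (s : R) : test1 a -> 0 < s -> exists A, [/\ test1 A,
  derive1 A = (fun x => a x - a (x - s)) &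
  forall x, A x = \int[lebesgue_measure]_(t in `[0, s]) a (x - t)].
Proof.
move=> ta s0; have [aD [M aM]] := ta.
pose F x : R := \int[lebesgue_measure]_(t in `]-oo, x]) a t.
have dF (x : R) : is_derive x 1 F (a x).
  have [] := @continuous_FTC1 R a -oo%O x (x + 1) _ _ _ _.
  - by rewrite ltrDl.
  - exact: test1_integrable.
  - exact: ltNyr.
  - exact: test1_cont.
  by rewrite derive1E => d <-; exact: derivableP.
have dF1 (x c : R) : is_derive x 1 (fun x => F (x - c)) (a (x - c)).
  have := @is_derive_aff F 1 (- c) x (a (x - c)); rewrite mul1r mulr1.
  have -> : (fun x0 => F (1 * x0 - c)) = (fun x => F (x - c)).
    by apply/funext => y; rewrite mul1r.
  by apply; exact: dF.
pose A x := F x - F (x - s).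
have dA (x : R) : is_derive x 1 A (a x - a (x - s)).
  exact: (is_deriveB (dF x) (dF1 x s)).
have A' : derive1 A = (fun x => a x - a (x - s)).
  by apply/funext => x; rewrite derive1E; have [_] := dA x.
have AE x : A x = \int[lebesgue_measure]_(t in `[0, s]) a (x - t).
  pose G t := - F (x - t).
  have dG (t : R) : is_derive t 1 G (a (x - t)).
    have := @is_derive_aff F (-1) x t (a (x - t)).
    have -> : (fun x0 => F (-1 * x0 + x)) = (fun t => F (x - t)).
      by apply/funext => y; rewrite mulN1r addrC.
    rewrite mulN1r (addrC (- t)) mulrN1 => /(_ (dF _)) h.
    by have := is_deriveN h; rewrite opprK.
  rewrite /Rintegral (@continuous_FTC2 _ _ G) //.
  - by rewrite /= /G subr0 /A; ring.
  - apply: continuous_subspaceT => t; apply: continuous_comp; last exact: test1_cont.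
    by apply: cvgB; [exact: cvg_cst|exact: cvg_id].
  - have cG : continuous G by move=> t; apply: derivable1_cont; case: (dG t).
    split.
    + by move=> t _; case: (dG t).
    + by apply: cvg_at_right_filter; exact: cG.
    + by apply: cvg_at_left_filter; exact: cG.
  - by move=> t _; rewrite derive1E; case: (dG t).
exists A; split => //; split.
  case=> [//|n]; split; first by move=> x; case: (dA x).
  rewrite A'; apply: DnD; first exact: aD.
  have -> : (fun x => - a (x - s)) = (fun x => (-1) * a (1 * x - s)).
    by apply/funext => x; rewrite mulN1r mul1r.
  by apply: DnM; [exact: Dn_cst|apply: Dn_aff; exact: aD].
exists (M + s) => x Mx; rewrite AE /Rintegral integral0_eq// => t /=.
rewrite in_itv /= => /andP[t0 ts]; rewrite aM//.
have : `|x| <= `|x - t| + `|t| by rewrite -{1}(subrK t x) ler_normD.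
by rewrite (ger0_norm t0); lra.
Qed.

End Smooth.

(** * Real integrals and locally integrable functions on the plane *)

Section RealIntegral.
Context d (T : measurableType d) {R : realType} (mu : {measure set T -> \bar R}).
Implicit Types f g : T -> R.

Definition Int f := mu.-integrable setT (EFin \o f).

Lemma Int_meas f : Int f -> measurable_fun setT f.
Proof. by move=> /measurable_int /measurable_EFinP. Qed.

Lemma IntD f g : Int f -> Int g -> Int (fun x => f x + g x).
Proof. by move=> fi gi; exact: (integrableD measurableT fi gi). Qed.

Lemma IntB f g : Int f -> Int g -> Int (fun x => f x - g x).
Proof. by move=> fi gi; exact: (integrableB measurableT fi gi). Qed.

Lemma IntZ (c : R) f : Int f -> Int (fun x => c * f x).
Proof. by move=> fi; exact: (integrableZl measurableT c fi). Qed.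

Lemma Int_le f g : measurable_fun setT f -> Int g ->
  {ae mu, forall x, `|f x| <= g x} -> Int f.
Proof.
move=> mf gi fg; have /integrableP[mg gf] := gi.
apply/integrableP; split; first exact/measurable_EFinP.
apply: le_lt_trans gf; apply: ae_ge0_le_integral => //.
- by do 2 apply: measurableT_comp => //.
- exact: measurableT_comp.
apply: filterS fg => x /= h _; rewrite lee_fin.
by apply: le_trans h _; exact: ler_norm.
Qed.

Lemma Int_abs f : Int f -> Int (fun x => `|f x|).
Proof. exact: integrable_norm. Qed.

Lemma RiD f g : Int f -> Int g ->
  \int[mu]_x (f x + g x) = \int[mu]_x f x + \int[mu]_x g x.
Proof. by move=> fi gi; rewrite RintegralD. Qed.

Lemma RiB f g : Int f -> Int g ->
  \int[mu]_x (f x - g x) = \int[mu]_x f x - \int[mu]_x g x.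
Proof. by move=> fi gi; rewrite RintegralB. Qed.

Lemma RiZ (c : R) f : Int f -> \int[mu]_x (c * f x) = c * \int[mu]_x f x.
Proof. by move=> fi; rewrite RintegralZl. Qed.

Lemma Ri_ae f g : measurable_fun setT f -> measurable_fun setT g ->
  {ae mu, forall x, f x = g x} -> \int[mu]_x f x = \int[mu]_x g x.
Proof.
move=> mf mg fg; congr fine; apply: ae_eq_integral => //.
- exact/measurable_EFinP.
- exact/measurable_EFinP.
- by apply: filterS fg => x /= ->.
Qed.

Lemma Int_ae f g : measurable_fun setT g -> Int f ->
  {ae mu, forall x, f x = g x} -> Int g.
Proof.
move=> mg fi fg; apply: (Int_le mg (Int_abs fi)).
by apply: filterS fg => x /= ->.
Qed.

Lemma Ri_le f g : Int f -> Int g -> {ae mu, forall x, f x <= g x} ->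
  \int[mu]_x f x <= \int[mu]_x g x.
Proof.
move=> fi gi fg; rewrite -subr_ge0 -RiB//.
(* The difference is nonnegative only almost everywhere; its positive part is nonnegative everywhere
   and has the same integral. *)
have mm : measurable_fun setT (fun x => Num.max 0 (g x - f x)).
  by apply: measurable_maxr => //; apply: measurable_funB; exact: Int_meas.
rewrite (@Ri_ae _ (fun x => Num.max 0 (g x - f x)))//.
- by apply: Rintegral_ge0 => x _; rewrite le_max lexx.
- by apply: measurable_funB; exact: Int_meas.
- by apply: filterS fg => x /= h; rewrite max_r// subr_ge0.
Qed.

End RealIntegral.

(** * Sets over which a function has integral zero *)

Section Dynkin.
Local Open Scope ereal_scope.
Context d (T : measurableType d) {R : realType} (mu : {measure set T -> \bar R}).
Context d' (X : measurableType d') (p : T -> X).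

(** The sets A over whose preimage the integral vanishes form a lambda-system: complements use the
    vanishing on D, disjoint unions use countable additivity. The map p is one of the two
    projections when a rectangle is extended one side at a time, then the identity. *)
Lemma dynkin_integral (K : T -> \bar R) (D : set T) (G : set (set X)) :
  measurable_fun setT p -> mu.-integrable setT K -> measurable D ->
  @measurable _ X = <<s G >> -> setI_closed G ->
  \int[mu]_(x in D) K x = 0 ->
  (forall A, G A -> \int[mu]_(x in p @^-1` A `&` D) K x = 0) ->
  forall A, measurable A -> \int[mu]_(x in p @^-1` A `&` D) K x = 0.
Proof.
move=> mp Ki mD GE GI D0 G0 A.
have mpre S : measurable S -> measurable (p @^-1` S).
  by move=> mS; rewrite -[X in measurable X]setTI; exact: mp.
have KS S : measurable S -> mu.-integrable S K.
  by move=> mS; apply: integrableS Ki.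
rewrite {1}GE; move: A.
apply: (dynkin_induction GE GI) => //.
- by rewrite preimage_setT setTI.
- move=> S mS S0.
  have := D0.
  have {1}-> : D = (p @^-1` S `&` D) `|` (p @^-1` (~` S) `&` D).
    by rewrite -setIUl -preimage_setU setUCr preimage_setT setTI.
  rewrite integral_setU.
  + by rewrite S0 add0e.
  + by apply: measurableI => //; exact: mpre.
  + by apply: measurableI => //; apply: mpre; exact: measurableC.
  + by apply: measurable_funTS; exact: measurable_int Ki.
  + by apply/disj_setPS => x [[/= ? _] [/= ? _]].
- move=> F mF tF F0.
  rewrite preimage_bigcup setI_bigcupl integral_bigcup.
  + by rewrite eseries0// => i _ _; exact: F0.
  + apply/trivIsetP => i j _ _ ij; apply/seteqP; split=> [x [[/= Fi _] [/= Fj _]]|//].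
    by move/trivIsetP : tF => /(_ i j I I ij) /seteqP[+ _]; apply; split; [exact: Fi|exact: Fj].
  + by move=> k; apply: measurableI => //; exact: mpre.
  + apply: KS; apply: bigcup_measurable => k _.
    by apply: measurableI => //; exact: mpre.
Qed.

End Dynkin.

(** * Locally integrable functions tested against products *)

Section Plane.
Context {R : realType}.
Implicit Types (f g k : plane R -> R) (a b : R -> R).
Notation mu := (@area R).
Notation PT := ((measurableTypeR R * measurableTypeR R)%type).

Definition box (M : R) : set PT := `[- M, M]%classic `*` `[- M, M]%classic.

Lemma measurable_box M : measurable (box M).
Proof.
exact: (@measurableX _ _ (measurableTypeR R) (measurableTypeR R) _ _ (measurable_itv _) (measurable_itv _)).
Qed.

Lemma compact_box M : compact (box M : set (plane R)).
Proof. by apply: compact_setX; exact: segment_compact. Qed.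

Definition Lloc f := measurable_fun setT (f : PT -> R) /\
  forall M, mu.-integrable (box M) (EFin \o f).

#[global] Instance ae_area_filter : Filter (almost_everywhere mu).
Proof. exact: (ae_filter_ringOfSetsType mu). Qed.

Lemma L1loc_Lloc f : L1loc f -> Lloc f.
Proof. by move=> [mf fi]; split => // M; apply: fi; exact: (@compact_box M). Qed.

Lemma Lloc_B f g : Lloc f -> Lloc g -> Lloc (fun x => f x - g x).
Proof.
move=> [mf fi] [mg gi]; split; first exact: measurable_funB.
by move=> M; apply: (integrableB (measurable_box M) (fi M) (gi M)).
Qed.

(** The function is cut off to a half-open square, where it is integrable. The class of sets with
    zero integral is then enlarged from rectangles of intervals to Borel times interval, to Borel
    times Borel, and to all measurable sets. *)
Lemma null_plane_rect (k : plane R -> R) :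
  Lloc k ->
  (forall c d c' d', \int[mu]_(x in `]c, d]%classic `*` `]c', d']%classic) (k x)%:E = 0)%E ->
  {ae mu, forall x, k x = 0}.
Proof.
move=> [mk ki] k0.
pose I (n : nat) : set R := `]- n%:R, n%:R]%classic.
have mI n : measurable (I n) by exact: measurable_itv.
pose Q n : set PT := I n `*` I n.
have mQ n : measurable (Q n : set PT).
  exact: (@measurableX _ _ (measurableTypeR R) (measurableTypeR R) (I n) (I n) (mI n) (mI n)).
have kQ n : mu.-integrable (Q n) (EFin \o k).
  apply: (@integrableS _ _ _ mu (box n%:R)); last exact: ki.
  - exact: measurable_box.
  - exact: mQ.
  - by move=> x [x1 x2]; split; exact: subset_itv_oc_cc.
pose K n := (EFin \o k) \_ (Q n).
have Ki n : mu.-integrable setT (K n). exact: (proj1 (@integrable_mkcond _ _ _ mu (Q n) (EFin \o k) (mQ n)) (kQ n)).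
have KE n D : (\int[mu]_(x in D) K n x = \int[mu]_(x in D `&` Q n) (k x)%:E)%E.
  by rewrite /K -integral_mkcondr.
have mf : measurable_fun setT (@fst (measurableTypeR R) (measurableTypeR R)) by exact: measurable_fst.
have ms : measurable_fun setT (@snd (measurableTypeR R) (measurableTypeR R)) by exact: measurable_snd.
(* Half-open intervals are stable under intersection, so cutting with [I n] keeps the rectangles
   within reach of [k0]. *)
have Iitv n A : ocitv A -> ocitv (A `&` I n).
  by move=> oA; apply: ocitvI => //; exact: is_ocitv.
have rect A B : ocitv A -> ocitv B -> (\int[mu]_(x in A `*` B) (k x)%:E = 0)%E.
  by move=> [u _ <-] [v _ <-]; exact: k0.
have mpre1 A : measurable A -> measurable (fst @^-1` A : set PT).
  by move=> mA; rewrite -[X in measurable X]setTI; exact: mf.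
have mpre2 A : measurable A -> measurable (snd @^-1` A : set PT).
  by move=> mA; rewrite -[X in measurable X]setTI; exact: ms.
have mo (A : set (measurableTypeR R)) : ocitv A -> measurable A.
  by move=> oA; exact: sub_sigma_algebra.
have step1 n A B : measurable A -> ocitv B ->
    (\int[mu]_(x in fst @^-1` A `&` snd @^-1` B) K n x = 0)%E.
  move=> mA oB; apply: (@dynkin_integral _ _ _ mu _ (measurableTypeR R) fst (K n) (snd @^-1` B) (@ocitv R)) => //.
  - by apply: mpre2; exact: mo.
  - exact: ocitvI.
  - rewrite KE; rewrite (_ : _ `&` _ = I n `*` (B `&` I n)); last first.
      by apply/seteqP; split => -[x y] /=; rewrite /Q /=; tauto.
    by apply: rect; [exact: is_ocitv|exact: Iitv].
  - move=> A' oA'; rewrite KE (_ : _ `&` _ = (A' `&` I n) `*` (B `&` I n)); last first.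
      by apply/seteqP; split => -[x y] /=; rewrite /Q /=; tauto.
    by apply: rect; exact: Iitv.
have step2 n A B : measurable A -> measurable B ->
    (\int[mu]_(x in fst @^-1` A `&` snd @^-1` B) K n x = 0)%E.
  move=> mA mB; rewrite setIC.
  apply: (@dynkin_integral _ _ _ mu _ (measurableTypeR R) snd (K n) (fst @^-1` A) (@ocitv R)) => //.
  - exact: mpre1.
  - exact: ocitvI.
  - rewrite -[RHS](step1 n A (I n))//; last exact: is_ocitv.
    rewrite !KE; congr integral.
    by apply/seteqP; split => -[x y] /=; rewrite /Q /=; tauto.
  - by move=> B' oB'; rewrite setIC; exact: step1.
(* Here p is the identity and the generators are the measurable rectangles, treated in [step2]. *)
have step3 n (A : set PT) : measurable A -> (\int[mu]_(x in A) K n x = 0)%E.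
  move=> mA.
  have := @dynkin_integral _ _ _ mu _ _ id (K n) setT _ _ (Ki n) measurableT (measurable_prod_measurableType _ _) _ _ _ A mA.
  rewrite preimage_id setIT; apply.
  - exact: measurable_id.
  - move=> _ _ [X1 mX1 [X2 mX2 <-]] [Y1 mY1 [Y2 mY2 <-]].
    rewrite -setXI; exists (X1 `&` Y1); first exact: measurableI.
    by exists (X2 `&` Y2) => //; exact: measurableI.
  - rewrite -[RHS](step2 n setT setT)//; congr integral.
    by rewrite !preimage_setT setIT.
  - move=> _ [X1 mX1 [X2 mX2 <-]]; rewrite preimage_id setIT.
    by rewrite -[RHS](step2 n X1 X2)//; congr integral.
have ae0 n : {ae mu, forall x, K n x = 0%E}.
  have := @integral_ae_eq _ _ _ mu setT measurableT (cst 0%E) (K n) (Ki n) (measurable_cst _).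
  have H E : E `<=` setT -> measurable E -> (\int[mu]_(x in E) K n x = \int[mu]_(x in E) cst 0 x)%E.
    by move=> _ mE; rewrite step3// integral0.
  by move=> /(_ H); apply: filterS => x /= /(_ Logic.I).
have /ae_foralln := ae0.
apply: filterS => -[x y] /= h.
have [n nx] : exists n : nat, `|x| + `|y| < n%:R.
  by exists (Num.truncn (`|x| + `|y|)).+1; exact: truncnS_gt.
have := h n; rewrite /K patchE ifT; first by case.
rewrite inE /Q /I /=; have := normr_ge0 x; have := normr_ge0 y => y0 x0.
have xn : `|x| < n%:R by lra.
have yn : `|y| < n%:R by lra.
move: xn yn; rewrite !ltr_norml !in_itv /= => /andP[? ?] /andP[? ?].
by split; apply/andP; split => //; exact: ltW.
Qed.


Definition prodT a b : plane R -> R := fun x => a x.1 * b x.2.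

Lemma in_box M (x : plane R) : `|x.1| <= M -> `|x.2| <= M -> box M x.
Proof. by move=> h1 h2; split; rewrite /= in_itv /= -ler_norml. Qed.

Lemma Lloc_box k M : Lloc k -> Int mu (fun x => `|k x| * \1_(box M) x).
Proof.
move=> [mk /(_ M) ki].
have := integrable_abse (proj1 (@integrable_mkcond _ _ _ mu (box M) (EFin \o k) (measurable_box M)) ki).
apply: eq_integrable => // x _; rewrite /= patchE indicE.
by case: ifPn => /= _; [rewrite mulr1|rewrite mulr0; exact: abse0].
Qed.

Lemma measurable_prodT a b : test1 a -> test1 b -> measurable_fun setT (prodT a b : PT -> R).
Proof.
move=> /test1_cont ca /test1_cont cb; apply: measurable_funM.
- apply: (measurableT_comp (f := a)); last exact: measurable_fst.
  exact: continuous_measurable_fun.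
- apply: (measurableT_comp (f := b)); last exact: measurable_snd.
  exact: continuous_measurable_fun.
Qed.

Lemma prodT_le a b : test1 a -> test1 b -> exists C M, 0 <= C /\
  forall x : plane R, `|prodT a b x| <= C * \1_(box M) x.
Proof.
move=> ta tb; have [A hA] := test1_bound ta; have [B hB] := test1_bound tb.
have [_ [M aM]] := ta; have [_ [N bN]] := tb.
have A0 : 0 <= A := le_trans (normr_ge0 _) (hA 0).
have B0 : 0 <= B := le_trans (normr_ge0 _) (hB 0).
exists (A * B), (Num.max M N); split; first exact: mulr_ge0.
move=> x; rewrite /prodT indicE; have [xb|xb] := boolP (x \in _).
  by rewrite mulr1 normrM ler_pM.
rewrite mulr0; have [h|h] := leP `|x.1| M; last by rewrite aM// mul0r normr0.
have [h2|h2] := leP `|x.2| N; last by rewrite bN// mulr0 normr0.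
move: xb; rewrite notin_setE => -[]; apply: in_box.
  by rewrite le_max h.
by rewrite le_max h2 orbT.
Qed.

Lemma Int_prodT k a b : Lloc k -> test1 a -> test1 b -> Int mu (fun x => k x * prodT a b x).
Proof.
move=> lk ta tb; have [C [M [C0 h]]] := prodT_le ta tb.
apply: (@Int_le _ _ _ mu _ (fun x => C * (`|k x| * \1_(box M) x))).
- by apply: measurable_funM; [case: lk|exact: measurable_prodT].
- by apply: IntZ; exact: Lloc_box.
- apply/nearW => x; rewrite normrM mulrCA ler_wpM2l//; exact: h.
Qed.

(** Products of bumps converge to the indicator of a half-open rectangle and are dominated by |k| on
    a fixed square. Hence tests in product form already separate locally integrable functions. *)
Lemma null_plane k : Lloc k ->
  (forall a b, test1 a -> test1 b -> \int[mu]_x (k x * prodT a b x) = 0) ->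
  {ae mu, forall x, k x = 0}.
Proof.
move=> lk k0; apply: null_plane_rect => //.
move=> c d c' d'.
(* By [bumpf_supp], every bump of the sequence is supported in the square of half-side M. *)
pose M : R := Num.max (Num.max (`|c| + 1) (`|d| + 1)) (Num.max (`|c'| + 1) (`|d'| + 1)).
pose A : set PT := `]c, d]%classic `*` `]c', d']%classic.
have mA : measurable A.
  exact: (@measurableX _ _ (measurableTypeR R) (measurableTypeR R) _ _ (measurable_itv _) (measurable_itv _)).
have supp (u v : R) n (x : R) : `|x| <= Num.max (`|u| + 1) (`|v| + 1) \/ bumpf u v n x = 0.
  have [/andP[h1 h2]|->] := bumpf_supp u v n x; [left|by right].
  rewrite le_max !ler_norml; have := ler_norm v; have := ler_norm (- u).
  rewrite normrN => hc hd; have [x0|x0] := leP 0 x; apply/orP; [right|left]; apply/andP; split; try lra.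
have [] := @dominated_convergence _ _ _ mu setT measurableT
  (fun n x => (k x * prodT (bumpf c d n) (bumpf c' d' n) x)%:E)
  (fun x => (k x * \1_A x)%:E) (fun x => (`|k x| * \1_(box M) x)%:E) _ _ _ _ _.
- move=> n; apply/measurable_EFinP; apply: measurable_funM; first by case: lk.
  by apply: measurable_prodT; exact: bumpf_test1.
- by apply/measurable_EFinP; apply: measurable_funM; first by case: lk.
- apply/nearW => x _; apply: cvg_EFin; first exact: nearW.
  apply: cvgMr; rewrite /A.
  have -> : \1_(`]c, d]%classic `*` `]c', d']%classic) x = \1_(`]c, d]%classic) x.1 * \1_(`]c', d']%classic) x.2 :> R.
    rewrite !indicE; case: x => x y /=.
    have -> : ((x, y) \in `]c, d]%classic `*` `]c', d']%classic) = (x \in `]c, d]%classic) && (y \in `]c', d']%classic).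
      by apply/idP/andP; rewrite !inE.
    by case: (x \in _); case: (y \in _); rewrite ?mulr1 ?mulr0.
  by apply: cvgM; exact: bumpf_cvg.
- exact: Lloc_box.
- apply/nearW => x n _; rewrite /= lee_fin normrM ler_wpM2l//.
  rewrite /prodT indicE; have [h|->] := supp c d n x.1; last by rewrite mul0r normr0.
  have [h2|->] := supp c' d' n x.2; last by rewrite mulr0 normr0.
  rewrite mem_set; last first.
    by apply: in_box; rewrite le_max ?h ?h2 ?orbT.
  rewrite (ger0_norm (mulr_ge0 (bumpf_ge0 _ _ _ _) (bumpf_ge0 _ _ _ _))).
  by apply: mulr_ile1; rewrite ?bumpf_ge0 ?bumpf_le1.
move=> ki _ cv.
have z n : (\int[mu]_x (k x * prodT (bumpf c d n) (bumpf c' d' n) x)%:E = 0)%E.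
  have := k0 _ _ (bumpf_test1 c d n) (bumpf_test1 c' d' n).
  rewrite /Rintegral => h; rewrite -[LHS]fineK ?h//.
  by apply: integrable_fin_num => //; apply: Int_prodT => //; exact: bumpf_test1.
rewrite -/A integral_mkcond.
have -> : (fun x => (k x)%:E) \_ A = (fun x => (k x * \1_A x)%:E).
  by apply/funext => x; rewrite patchE indicE; case: ifPn => _; rewrite ?mulr1 ?mulr0.
apply/esym; rewrite -(cvg_lim _ cv)//.
by under eq_fun do rewrite z; apply/esym/cvg_lim => //; exact: cvg_cst.
Qed.


Lemma is_derive_prodT1 a b (x : plane R) : derivable a x.1 1 ->
  is_derive x ((1, 0) : plane R) (prodT a b) (derive1 a x.1 * b x.2).
Proof.
move=> da.
have h : h^-1 *: ((prodT a b \o shift x) (h *: ((1, 0) : plane R)) - prodT a b x)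
    @[h --> 0^'] --> derive1 a x.1 * b x.2.
  have -> : (fun h : R => h^-1 *: ((prodT a b \o shift x) (h *: ((1, 0) : plane R)) - prodT a b x)) =
    (fun h : R => (h^-1 *: ((a \o shift x.1) (h *: (1 : R)) - a x.1)) * b x.2).
    apply/funext => h; rewrite /prodT /= /GRing.scale /=.
    by rewrite mulr0 add0r -mulrBl mulrA.
  by apply: cvgMl; rewrite derive1E; exact: da.
split; first by apply/cvg_ex; eexists; exact: h.
by apply/cvg_lim.
Qed.

Lemma is_derive_prodT2 a b (x : plane R) : derivable b x.2 1 ->
  is_derive x ((0, 1) : plane R) (prodT a b) (a x.1 * derive1 b x.2).
Proof.
move=> db.
have h : h^-1 *: ((prodT a b \o shift x) (h *: ((0, 1) : plane R)) - prodT a b x)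
    @[h --> 0^'] --> a x.1 * derive1 b x.2.
  have -> : (fun h : R => h^-1 *: ((prodT a b \o shift x) (h *: ((0, 1) : plane R)) - prodT a b x)) =
    (fun h : R => a x.1 * (h^-1 *: ((b \o shift x.2) (h *: (1 : R)) - b x.2))).
    apply/funext => h; rewrite /prodT /= /GRing.scale /=.
    by rewrite mulr0 add0r -mulrBr mulrCA.
  by apply: cvgMr; rewrite derive1E; exact: db.
split; first by apply/cvg_ex; eexists; exact: h.
by apply/cvg_lim.
Qed.

Lemma d1_prodT a b : Doo a -> d1 (prodT a b) = prodT (derive1 a) b.
Proof.
move=> aD; apply/funext => x.
by have [] := @is_derive_prodT1 a b x (@Doo_derivable _ a x.1 aD).
Qed.

Lemma d2_prodT a b : Doo b -> d2 (prodT a b) = prodT a (derive1 b).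
Proof.
move=> bD; apply/funext => x.
by have [] := @is_derive_prodT2 a b x (@Doo_derivable _ b x.2 bD).
Qed.

Lemma cont_prodT a b : Doo a -> Doo b -> continuous (prodT a b).
Proof.
move=> aD bD x; apply: cvgM.
  by apply: continuous_comp; [exact: cvg_fst|exact: Doo_cont].
by apply: continuous_comp; [exact: cvg_snd|exact: Doo_cont].
Qed.

Lemma Cn_prodT n a b : Doo a -> Doo b -> Cn n (prodT a b).
Proof.
elim: n a b => [|n IH] a b aD bD; first by split => //; exact: cont_prodT.
split; first exact: cont_prodT.
split.
- move=> x; split.
  + by case: (@is_derive_prodT1 a b x (@Doo_derivable _ a x.1 aD)).
  + by case: (@is_derive_prodT2 a b x (@Doo_derivable _ b x.2 bD)).
- by rewrite d1_prodT//; apply: IH => //; exact: Doo_derive.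
- by rewrite d2_prodT//; apply: IH => //; exact: Doo_derive.
Qed.

Lemma test_prodT a b : test1 a -> test1 b -> test_fun (prodT a b).
Proof.
move=> ta tb; have [aD _] := ta; have [bD _] := tb.
split; first by move=> n; exact: Cn_prodT.
have [C [M [_ h]]] := prodT_le ta tb.
exists (box M); first exact: compact_box.
move=> x xb; apply/normr0_eq0/le_anti; rewrite normr_ge0 andbT.
by apply: le_trans (h x) _; rewrite indicE memNset// mulr0.
Qed.

(* Weak derivatives tested only against products of functions of one variable. *)
Definition wk1 f g := forall a b, test1 a -> test1 b ->
  \int[mu]_x (f x * prodT (derive1 a) b x) = - \int[mu]_x (g x * prodT a b x).

Definition wk2 f g := forall a b, test1 a -> test1 b ->
  \int[mu]_x (f x * prodT a (derive1 b) x) = - \int[mu]_x (g x * prodT a b x).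

Lemma weak_deriv_prodT (i j : nat) f g a b : weak_deriv i j f g -> test1 a -> test1 b ->
  \int[mu]_x (f x * prodT (iter i (@derive1 R R) a) (iter j (@derive1 R R) b) x) =
  (-1) ^+ (i + j) * \int[mu]_x (g x * prodT a b x).
Proof.
move=> fg ta tb; rewrite -fg; last exact: test_prodT.
congr Rintegral; apply/funext => x; congr (_ * _).
rewrite /pderiv.
have hb n b' : test1 b' -> test1 (iter n (@derive1 R R) b').
  by elim: n b' => [//|n IH] b' tb'; rewrite iterSr; apply: IH; exact: test1_derive.
have -> : iter j d2 (prodT a b) = prodT a (iter j (@derive1 R R) b).
  elim: j {fg} => [//|j IH] /=; rewrite IH d2_prodT//.
  by case: (hb j b tb).
have -> : iter i d1 (prodT a (iter j (@derive1 R R) b)) = prodT (iter i (@derive1 R R) a) (iter j (@derive1 R R) b).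
  elim: i {fg} => [//|i IH] /=; rewrite IH d1_prodT//.
  by case: (hb i a ta).
by [].
Qed.

Lemma weak_wk1 f g : weak_deriv 1 0 f g -> wk1 f g.
Proof.
by move=> fg a b ta tb; have /= -> := weak_deriv_prodT fg ta tb; rewrite expr1 mulN1r.
Qed.

Lemma weak_wk2 f g : weak_deriv 0 1 f g -> wk2 f g.
Proof.
by move=> fg a b ta tb; have /= -> := weak_deriv_prodT fg ta tb; rewrite expr1 mulN1r.
Qed.

(** Both hypotheses contain the integral of f a'' b: the first-order one tested with a', the
    second-order one with a. Comparing them shows that h is the derivative of g. The next two lemmas
    proceed in the same way. *)
Lemma weak_wk11 f g h : weak_deriv 1 0 f g -> weak_deriv 2 0 f h -> wk1 g h.
Proof.
move=> fg fh a b ta tb.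
have /= e1 := weak_deriv_prodT fh ta tb.
have /= e2 := weak_deriv_prodT fg (test1_derive ta) tb.
by move: e2; rewrite e1 ?addn0 ?add0n ?addn1 sqrrN expr1n mul1r expr1 mulN1r => ->; rewrite opprK.
Qed.

Lemma weak_wk22 f g h : weak_deriv 0 1 f g -> weak_deriv 0 2 f h -> wk2 g h.
Proof.
move=> fg fh a b ta tb.
have /= e1 := weak_deriv_prodT fh ta tb.
have /= e2 := weak_deriv_prodT fg ta (test1_derive tb).
by move: e2; rewrite e1 ?addn0 ?add0n ?addn1 sqrrN expr1n mul1r expr1 mulN1r => ->; rewrite opprK.
Qed.

Lemma weak_wk12 f g h : weak_deriv 1 0 f g -> weak_deriv 1 1 f h -> wk2 g h.
Proof.
move=> fg fh a b ta tb.
have /= e1 := weak_deriv_prodT fh ta tb.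
have /= e2 := weak_deriv_prodT fg ta (test1_derive tb).
by move: e2; rewrite e1 ?addn0 ?add0n ?addn1 sqrrN expr1n mul1r expr1 mulN1r => ->; rewrite opprK.
Qed.

Lemma weak_unique i j f g h : L1loc g -> L1loc h -> weak_deriv i j f g ->
  weak_deriv i j f h -> eqae g h.
Proof.
move=> lg lh fg fh.
have lg' := L1loc_Lloc lg; have lh' := L1loc_Lloc lh.
have := null_plane (Lloc_B lg' lh').
have H a b : test1 a -> test1 b -> \int[mu]_x ((g x - h x) * prodT a b x) = 0.
  move=> ta tb; rewrite (_ : (fun x => _) = (fun x => g x * prodT a b x - h x * prodT a b x)).
    rewrite RiB; [|exact: Int_prodT|exact: Int_prodT].
    have e1 := weak_deriv_prodT fg ta tb; have e2 := weak_deriv_prodT fh ta tb.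
    move: e1; rewrite e2 => /mulfI -> //; first by rewrite subrr.
    by rewrite expf_neq0// oppr_eq0 oner_eq0.
  by apply/funext => x; rewrite mulrBl.
by move=> /(_ H); apply: filterS => x /= /eqP; rewrite subr_eq0 => /eqP.
Qed.

End Plane.

(** * Translations, square integrable functions, Fubini *)

Section Shift.
Context {R : realType}.
Implicit Types (f g k : plane R -> R) (a b : R -> R).
Notation mu := (@area R).
Notation leb := (@lebesgue_measure R).
Notation PT := ((measurableTypeR R * measurableTypeR R)%type).

Definition sh (s : R) (x : plane R) : plane R := (x.1 + s, x.2).

Lemma measurable_addr (s : R) : measurable_fun setT (fun x : R => x + s).
Proof. by apply: measurable_funD => //; exact: measurable_id. Qed.

Lemma lebesgue_shift (s : R) (A : set (measurableTypeR R)) : measurable A ->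
  leb ((fun x => x + s) @^-1` A) = leb A.
Proof.
move=> mA.
have ms : measurable_fun setT (fun x : measurableTypeR R => x + s : measurableTypeR R).
  exact: measurable_addr.
rewrite -[LHS]/(pushforward leb (fun x : measurableTypeR R => x + s : measurableTypeR R) A).
apply/esym/lebesgue_measure_unique => //= _ [[a b]] _ <-.
rewrite /pushforward.
have -> : (fun x => x + s) @^-1` `]a, b]%classic = `]a - s, b - s]%classic.
  by apply/seteqP; split => x /=; rewrite !in_itv /= ltrBlDr lerBrDr.
rewrite !lebesgue_measure_itv /= !lte_fin ltrD2r; case: ifPn => // ab.
by rewrite -!EFinD; congr (_%:E); ring.
Qed.

Lemma ge0_integral_shift1 (s : R) (f : R -> \bar R) : measurable_fun setT f ->
  (forall x, 0 <= f x)%E ->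
  (\int[leb]_x f (x + s)%R = \int[leb]_x f x)%E.
Proof.
move=> mf f0.
have ms : measurable_fun setT (fun x : measurableTypeR R => x + s : measurableTypeR R).
  exact: measurable_addr.
have := @ge0_integral_pushforward _ _ _ _ _ _ ms leb setT f.
rewrite preimage_setT => <- //.
apply: eq_measure_integral => A mA _.
by rewrite /= /pushforward lebesgue_shift.
Qed.

Lemma measurable_sh s : measurable_fun setT (sh s : PT -> PT).
Proof.
apply: measurable_fun_pair => /=; last exact: measurable_snd.
exact: (measurableT_comp (measurable_addr s) (@measurable_fst _ _ (measurableTypeR R) (measurableTypeR R))).
Qed.

Lemma ge0_integral_sh s (f : plane R -> \bar R) : measurable_fun setT (f : PT -> \bar R) ->
  (forall x, 0 <= f x)%E ->
  (\int[mu]_x f (sh s x) = \int[mu]_x f x)%E.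
Proof.
move=> mf f0; rewrite /area.
have mfs : measurable_fun setT (f \o sh s : PT -> \bar R).
  exact: (measurableT_comp mf (measurable_sh s)).
have fs0 (x : PT) : (0 <= (f \o sh s) x)%E by exact: f0.
rewrite (@fubini_tonelli2 _ _ _ _ _ leb leb (f \o sh s) mfs fs0).
rewrite (@fubini_tonelli2 _ _ _ _ _ leb leb f mf f0).
apply: eq_integral => y _; rewrite /fubini_G /sh /=.
apply: (@ge0_integral_shift1 s (fun x => f (x, y))) => //.
exact: (measurableT_comp mf (measurable_pair2 y)).
Qed.

(** * Maps preserving the integral of nonnegative functions *)

Section Preserving.
Variable h : PT -> PT.
Hypothesis mh : measurable_fun setT h.
Hypothesis hP : forall F : plane R -> \bar R, measurable_fun setT (F : PT -> \bar R) ->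
  (forall x, 0 <= F x)%E -> (\int[mu]_x F (h x) = \int[mu]_x F x)%E.

Lemma area_pres (A : set PT) : measurable A -> mu (h @^-1` A) = mu A.
Proof.
move=> mA.
have mB : measurable (h @^-1` A : set PT).
  by rewrite -[X in measurable X]setTI; exact: mh.
have E (B : set PT) : measurable B -> mu B = (\int[mu]_x (\1_B x)%:E)%E.
  by move=> mB'; rewrite integral_indic// setIT.
rewrite !E// -(@hP (fun x => (\1_A x)%:E))//.
by apply/measurable_EFinP.
Qed.

Lemma ae_pres (P : plane R -> Prop) : {ae mu, forall x, P x} -> {ae mu, forall x, P (h x)}.
Proof.
move=> [N [mN N0 PN]]; exists (h @^-1` N); split.
- by rewrite -[X in measurable X]setTI; exact: mh.
- by rewrite area_pres.
- by move=> x /= hx; exact: PN.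
Qed.

Lemma meas_pres f : measurable_fun setT (f : PT -> R) -> measurable_fun setT (f \o h : PT -> R).
Proof. by move=> mf; exact: (measurableT_comp mf mh). Qed.

Lemma Int_pres f : Int mu f -> Int mu (fun x => f (h x)).
Proof.
move=> /integrableP [/measurable_EFinP mf fi]; apply/integrableP; split.
  by apply/measurable_EFinP; exact: (meas_pres mf).
rewrite [X in (X < _)%E](@hP (fun x => `|(f x)%:E|%E))//.
by apply: measurableT_comp => //; exact/measurable_EFinP.
Qed.

Lemma Ri_pres f : Int mu f -> \int[mu]_x f (h x) = \int[mu]_x f x.
Proof.
move=> fi; have mf := Int_meas fi; rewrite /Rintegral; congr fine.
have mfE : measurable_fun setT (EFin \o f : PT -> \bar R) by exact/measurable_EFinP.
have e1 := @hP ((EFin \o f)^\+)%E (measurable_funepos mfE) (@funepos_ge0 _ _ _).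
have e2 := @hP ((EFin \o f)^\-)%E (measurable_funeneg mfE) (@funeneg_ge0 _ _ _).
rewrite (integralE mu setT (fun x => (f (h x))%:E)).
rewrite (integralE mu setT (fun x => (f x)%:E)).
congr (_ - _)%E; first by rewrite -e1; apply: eq_integral => x _; rewrite !funeposE.
by rewrite -e2; apply: eq_integral => x _; rewrite !funenegE.
Qed.
End Preserving.

Lemma meas_sh s f : measurable_fun setT (f : PT -> R) -> measurable_fun setT (f \o sh s : PT -> R).
Proof. exact: (meas_pres (measurable_sh s)). Qed.

Lemma Int_sh s f : Int mu f -> Int mu (fun x => f (sh s x)).
Proof. exact: (Int_pres (measurable_sh s) (@ge0_integral_sh s)). Qed.

Lemma Ri_sh s f : Int mu f -> \int[mu]_x f (sh s x) = \int[mu]_x f x.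
Proof. exact: (Ri_pres (@ge0_integral_sh s)). Qed.

(** Translations are studied in the first coordinate only; conjugation with this exchange transfers
    the results to the second. *)
Definition swp (x : plane R) : plane R := (x.2, x.1).

Lemma measurable_swp : measurable_fun setT (swp : PT -> PT).
Proof. by apply: measurable_fun_pair => /=; [exact: measurable_snd|exact: measurable_fst]. Qed.

Lemma ge0_integral_swp (f : plane R -> \bar R) : measurable_fun setT (f : PT -> \bar R) ->
  (forall x, 0 <= f x)%E ->
  (\int[mu]_x f (swp x) = \int[mu]_x f x)%E.
Proof.
move=> mf f0; rewrite /area.
have mfs : measurable_fun setT (f \o swp : PT -> \bar R).
  exact: (measurableT_comp mf measurable_swp).
have fs0 (x : PT) : (0 <= (f \o swp) x)%E by exact: f0.
rewrite (@fubini_tonelli2 _ _ _ _ _ leb leb (f \o swp) mfs fs0).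
by rewrite (@fubini_tonelli1 _ _ _ _ _ leb leb f mf f0).
Qed.

Lemma ae_swp (P : plane R -> Prop) : {ae mu, forall x, P x} -> {ae mu, forall x, P (swp x)}.
Proof. exact: (ae_pres measurable_swp ge0_integral_swp). Qed.

Lemma Int_swp f : Int mu f -> Int mu (fun x => f (swp x)).
Proof. exact: (Int_pres measurable_swp ge0_integral_swp). Qed.

Lemma Ri_swp f : Int mu f -> \int[mu]_x f (swp x) = \int[mu]_x f x.
Proof. exact: (Ri_pres ge0_integral_swp). Qed.

(** The working form of [L2]; the two are related by [L2_SI] and [SI_L2]. *)
Definition SI f := measurable_fun setT (f : PT -> R) /\ Int mu (fun x => f x ^+ 2).

Lemma amgm (x y : R) : `|x * y| <= 2^-1 * (x ^+ 2 + y ^+ 2).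
Proof.
rewrite normrM -(real_normK (num_real x)) -(real_normK (num_real y)).
by have := sqr_ge0 (`|x| - `|y|); nra.
Qed.

Lemma SI_M f g : SI f -> SI g -> Int mu (fun x => f x * g x).
Proof.
move=> [mf fi] [mg gi].
apply: (@Int_le _ _ _ mu _ (fun x => 2^-1 * (f x ^+ 2 + g x ^+ 2))).
- exact: measurable_funM.
- by apply: IntZ; exact: IntD.
- by apply: aeW => x; exact: amgm.
Qed.

Lemma SI_Z (c : R) f : SI f -> SI (fun x => c * f x).
Proof.
move=> [mf fi]; split; first exact: measurable_funM.
have -> : (fun x => (c * f x) ^+ 2) = (fun x => c ^+ 2 * f x ^+ 2).
  by apply/funext => x; rewrite exprMn.
exact: IntZ.
Qed.

Lemma SI_D f g : SI f -> SI g -> SI (fun x => f x + g x).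
Proof.
move=> sf sg; have [mf fi] := sf; have [mg gi] := sg.
split; first exact: measurable_funD.
have -> : (fun x => (f x + g x) ^+ 2) =
   (fun x => (f x ^+ 2 + 2 * (f x * g x)) + g x ^+ 2).
  by apply/funext => x; ring.
apply: IntD => //; apply: IntD => //; apply: IntZ; exact: SI_M.
Qed.

Lemma SI_sh s f : SI f -> SI (fun x => f (sh s x)).
Proof. by move=> [mf fi]; split; [exact: (meas_sh s mf)|exact: (Int_sh s fi)]. Qed.

Lemma SI_swp f : SI f -> SI (fun x => f (swp x)).
Proof.
by move=> [mf fi]; split; [exact: (meas_pres measurable_swp mf)|exact: (Int_swp fi)].
Qed.

Lemma SI_ae f g : measurable_fun setT (g : PT -> R) -> SI f -> eqae f g -> SI g.
Proof.
move=> mg [mf fi] fg; split => //.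
apply: (@Int_ae _ _ _ mu (fun x => f x ^+ 2)) => //; first exact: measurable_funX.
by apply: filterS fg => x /= ->.
Qed.

Lemma box_fin M : (mu (box M) < +oo)%E.
Proof.
rewrite /area /box [X in (X < _)%E](@product_measure1E _ _ (measurableTypeR R)
  (measurableTypeR R) _ leb leb); [|exact: measurable_itv|exact: measurable_itv].
rewrite [X in (X * _)%E]lebesgue_measure_itv [X in (_ * X)%E]lebesgue_measure_itv /=.
by case: ifPn => _; rewrite ?mul0e ?ltry// -?EFinD -?EFinM ltry.
Qed.

Lemma Int_box M : Int mu (\1_(box M) : PT -> R).
Proof.
apply/integrableP; split.
  by apply/measurable_EFinP; apply: measurable_indic; exact: measurable_box.
under eq_integral do rewrite /= ger0_norm//.
rewrite integral_indic; [|exact: measurableT|exact: measurable_box].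
by rewrite setIT box_fin.
Qed.

Lemma SI_prodT a b : test1 a -> test1 b -> SI (prodT a b).
Proof.
move=> ta tb; split; first exact: measurable_prodT.
have [C [M [C0 h]]] := prodT_le ta tb.
apply: (@Int_le _ _ _ mu _ (fun x => C ^+ 2 * \1_(box M) x)).
- by apply: measurable_funX; exact: measurable_prodT.
- by apply: IntZ; exact: Int_box.
- apply: aeW => x; rewrite normrX.
  have := h x; rewrite indicE; case: (_ \in _); rewrite /= ?mulr1 ?mulr0 => hx.
    by rewrite lerXn2r ?nnegrE.
  have -> : `|prodT a b x| = 0 by apply/le_anti; rewrite hx normr_ge0.
  by rewrite expr0n.
Qed.

Lemma SI_Lloc f : SI f -> Lloc f.
Proof.
move=> [mf fi]; split => // M.
apply/(integrable_mkcond _ (measurable_box M)).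
have : Int mu (fun x => f x * \1_(box M) x).
  apply: (@Int_le _ _ _ mu _ (fun x => 2^-1 * (f x ^+ 2 + \1_(box M) x))).
  - by apply: measurable_funM => //; apply: measurable_indic; exact: measurable_box.
  - by apply: IntZ; apply: IntD => //; exact: Int_box.
  - apply: aeW => x; apply: le_trans (amgm _ _) _.
    by rewrite indicE; case: (_ \in _); rewrite /= ?expr1n ?expr0n.
apply: eq_integrable => // x _ /=; rewrite patchE indicE.
by case: ifPn => /= _; rewrite ?mulr1 ?mulr0.
Qed.

Lemma L2_SI f : L2 f -> SI f.
Proof.
move=> lf; split; last exact: Lfun2_integrable_sqr.
by move: lf; rewrite /L2 inE => /andP[]; rewrite inE.
Qed.

(** * Fubini for real-valued integrals *)

Section Fub.
Context d1 d2 (T1 : measurableType d1) (T2 : measurableType d2).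
Variables (m1 : {sigma_finite_measure set T1 -> \bar R})
          (m2 : {sigma_finite_measure set T2 -> \bar R}).
Variable H : T1 * T2 -> R.
Hypothesis Hi : Int (m1 \x m2)%E H.

(** A real integral is [fine] of an extended one. The two agree where the section is integrable,
    hence almost everywhere, and this lets the extended Fubini theorem pass to real values. *)
Lemma Fub_ae1 : {ae m1, forall x, (\int[m2]_y H (x, y))%:E = \int[m2]_y (H (x, y))%:E}%E.
Proof.
apply: filterS (ae_integrable1 Hi) => x /= h; rewrite /Rintegral fineK//.
exact: integrable_fin_num.
Qed.

Lemma Fub_ae2 : {ae m2, forall y, (\int[m1]_x H (x, y))%:E = \int[m1]_x (H (x, y))%:E}%E.
Proof.
apply: filterS (ae_integrable2 Hi) => x /= h; rewrite /Rintegral fineK//.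
exact: integrable_fin_num.
Qed.

Lemma meas_Fub1 : measurable_fun setT (fun x => \int[m2]_y H (x, y)).
Proof. by apply: (measurableT_comp (fine_measurable _)) => //; exact: (measurable_fubini_F Hi). Qed.

Lemma meas_Fub2 : measurable_fun setT (fun y => \int[m1]_x H (x, y)).
Proof. by apply: (measurableT_comp (fine_measurable _)) => //; exact: (measurable_fubini_G Hi). Qed.

Lemma Int_Fub1 : Int m1 (fun x => \int[m2]_y H (x, y)).
Proof.
apply/integrableP; split; first by apply/measurable_EFinP; exact: meas_Fub1.
have /integrableP[_] := integrable_fubini_F Hi.
apply: le_lt_trans; apply: ae_ge0_le_integral => //.
- by apply: measurableT_comp => //; apply/measurable_EFinP; exact: meas_Fub1.
- by apply: measurableT_comp => //; exact: (measurable_fubini_F Hi).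
- by apply: filterS Fub_ae1 => x /= h _; rewrite /fubini_F -h.
Qed.

Lemma Int_Fub2 : Int m2 (fun y => \int[m1]_x H (x, y)).
Proof.
have mH : measurable_fun setT (EFin \o H) := measurable_int _ Hi.
apply/integrableP; split; first by apply/measurable_EFinP; exact: meas_Fub2.
have := (integrable21ltyP m1 m2 mH).1 Hi.
apply: le_lt_trans; apply: ae_ge0_le_integral => //.
- by apply: measurableT_comp => //; apply/measurable_EFinP; exact: meas_Fub2.
- by move=> y _; exact: integral_ge0.
- apply: (@measurable_fun_fubini_tonelli_G _ _ _ _ _ m1 (abse \o (EFin \o H))) => //.
    exact: measurableT_comp.
  by move=> z; exact: abse_ge0.
- apply: filterS Fub_ae2 => y h _; rewrite -[X in (`|X| <= _)%E]/((\int[m1]_x H (x, y))%:E) h.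
  by apply: le_abse_integral => //; exact: (measurableT_comp mH (measurable_pair2 y)).
Qed.

Lemma Ri_Fub1 : \int[m1]_x \int[m2]_y H (x, y) = \int[(m1 \x m2)%E]_z H z.
Proof.
rewrite {1 3}/Rintegral -(integral12_prod_meas1 Hi); congr fine.
apply: ae_eq_integral => //.
- by apply/measurable_EFinP; exact: meas_Fub1.
- exact: (measurable_fubini_F Hi).
- by apply: filterS Fub_ae1 => x /= -> _.
Qed.

Lemma Ri_Fub2 : \int[m2]_y \int[m1]_x H (x, y) = \int[(m1 \x m2)%E]_z H z.
Proof.
rewrite {1 3}/Rintegral -(integral21_prod_meas1 Hi); congr fine.
apply: ae_eq_integral => //.
- by apply/measurable_EFinP; exact: meas_Fub2.
- exact: (measurable_fubini_G Hi).
- by apply: filterS Fub_ae2 => x /= -> _.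
Qed.

End Fub.

Lemma ae_area_Fub d2 (T2 : measurableType d2) (m2 : {sigma_finite_measure set T2 -> \bar R})
  d1 (T1 : measurableType d1) (m1 : {sigma_finite_measure set T1 -> \bar R}) (H : T1 * T2 -> R) :
  measurable_fun setT H -> (\int[m2]_t \int[m1]_x `|(H (x, t))%:E| < +oo)%E ->
  [/\ {ae m1, forall x, Int m2 (fun t => H (x, t))},
      Int m1 (fun x => \int[m2]_t H (x, t)),
      Int m2 (fun t => \int[m1]_x H (x, t)) &
      \int[m1]_x \int[m2]_t H (x, t) = \int[m2]_t \int[m1]_x H (x, t)].
Proof.
move=> mH Hf.
have Hi : Int (m1 \x m2)%E H by apply/integrable21ltyP => //; exact/measurable_EFinP.
split; first exact: (ae_integrable1 Hi).
- exact: Int_Fub1.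
- exact: Int_Fub2.
- by rewrite Ri_Fub1// Ri_Fub2.
Qed.

(** A copy of [area] that carries a sigma-finite structure, which Fubini on the product of the plane
    with a parameter line requires. *)
Definition area_fun : set PT -> \bar R := (leb \x leb)%E.
HB.instance Definition _ := Measure.on area_fun.

Lemma area_sigma_finite : sigma_finite setT area_fun.
Proof.
exists (fun n => box n%:R).
  apply/esym/seteqP; split => // -[x y] _.
  exists (Num.truncn (`|x| + `|y|)).+1 => //.
  have h := truncnS_gt (`|x| + `|y|).
  by apply: in_box; apply: le_trans (ltW h); rewrite ?lerDl ?lerDr.
by move=> n; split; [exact: measurable_box|exact: box_fin].
Qed.

HB.instance Definition _ :=
  @Measure_isSigmaFinite.Build _ _ _ area_fun area_sigma_finite.

Lemma area_Fub (H : PT * measurableTypeR R -> R) :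
  measurable_fun setT H -> (\int[leb]_t \int[mu]_x `|(H (x, t))%:E| < +oo)%E ->
  [/\ {ae mu, forall x, Int leb (fun t => H (x, t))},
      Int mu (fun x => \int[leb]_t H (x, t)),
      Int leb (fun t => \int[mu]_x H (x, t)) &
      \int[mu]_x \int[leb]_t H (x, t) = \int[leb]_t \int[mu]_x H (x, t)].
Proof. exact: (@ae_area_Fub _ _ leb _ _ area_fun H). Qed.

(** Tonelli for the indicator of A. It trades null sets in x that depend on t for a single null set
    in x, outside of which almost every t is good. *)
Lemma null_sections d2 (T2 : measurableType d2) (m2 : {sigma_finite_measure set T2 -> \bar R})
  d1 (T1 : measurableType d1) (m1 : {sigma_finite_measure set T1 -> \bar R}) (A : set (T1 * T2)) :
  measurable A -> (forall t, m1 [set x | A (x, t)] = 0)%E ->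
  {ae m1, forall x, {ae m2, forall t, ~ A (x, t)}}.
Proof.
move=> mA A0.
pose F x := (\int[m2]_t (\1_A (x, t))%:E)%E.
have m1A : measurable_fun setT (fun z => (\1_A z : R)%:E).
  by apply/measurable_EFinP; exact: measurable_indic.
have A0' z : (0 <= (\1_A z : R)%:E)%E by rewrite lee_fin.
have mF : measurable_fun setT F.
  exact: (@measurable_fun_fubini_tonelli_F _ _ _ _ _ m2 (fun z => (\1_A z)%:E)).
have F0 : (\int[m1]_x `|F x| = 0)%E.
  under eq_integral => x _.
    rewrite gee0_abs; last by apply: integral_ge0 => t _; exact: A0'.
    over.
  rewrite /F (@fubini_tonelli _ _ _ _ _ m1 m2 (fun z => (\1_A z)%:E))//.
  rewrite integral0_eq// => t _.
  have -> : (fun x => (\1_A (x, t))%:E) = (fun x => (\1_[set x | A (x, t)] x)%:E) :> (T1 -> \bar R).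
    by apply/funext => x; rewrite !indicE; congr ((nat_of_bool _)%:R%:E); apply/idP/idP; rewrite !inE.
  have mAt : measurable [set x | A (x, t)].
    by have := measurable_ysection t mA; rewrite /ysection; under eq_set do rewrite inE.
  by rewrite integral_indic// setIT; exact: A0.
have F00 := (ae_eq_integral_abs m1 measurableT mF).1 F0.
apply: filterS F00 => x /= /(_ Logic.I) Fx.
have mAx : measurable (xsection A x) by exact: measurable_xsection.
exists (xsection A x); split => //.
  move: Fx; rewrite /F.
  have -> : (fun t => (\1_A (x, t))%:E) = (fun t => (\1_(xsection A x) t)%:E) :> (T2 -> \bar R).
    by apply/funext => t; rewrite !indicE mem_xsection.
  by rewrite integral_indic// setIT.
by move=> t /= /contrapT h; rewrite /xsection /= inE.
Qed.

Lemma area_null_sections (A : set (PT * measurableTypeR R)) : measurable A ->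
  (forall t, mu [set x | A (x, t)] = 0)%E ->
  {ae mu, forall x, {ae leb, forall t, ~ A (x, t)}}.
Proof. exact: (@null_sections _ _ leb _ _ area_fun A). Qed.

End Shift.

(** * Weak derivatives and translations *)

Section Steklov.
Context {R : realType}.
Implicit Types (f g p q : plane R -> R) (a b : R -> R) (c s : R).
Notation mu := (@area R).
Notation leb := (@lebesgue_measure R).
Notation PT := ((measurableTypeR R * measurableTypeR R)%type).

(** Integrals over [0, s] are written with this weight, so that Fubini and translations act on the
    whole line. *)
Definition ind s : R -> R := \1_(`[0, s]).

Lemma measurable_ind s : measurable_fun setT (ind s : measurableTypeR R -> R).
Proof. by apply: measurable_indic; exact: measurable_itv. Qed.

Lemma ind_ge0 s t : 0 <= ind s t.
Proof. by rewrite /ind indicE. Qed.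

Lemma integral_ind s : 0 <= s -> (\int[leb]_t (ind s t)%:E = s%:E)%E.
Proof.
move=> s0; rewrite integral_indic//.
rewrite setIT [LHS]lebesgue_measure_itv /= lte_fin.
by case: ltgtP s0 => //= [_ _|<- _]; rewrite ?oppr0 ?adde0.
Qed.

Lemma Int_ind s : Int leb (ind s).
Proof. exact: integrable_indic_itv. Qed.

Lemma Ri_ind s : 0 <= s -> \int[leb]_t ind s t = s.
Proof. by move=> s0; rewrite /Rintegral integral_ind. Qed.

Lemma measurable_sh2 c : measurable_fun setT
  (fun z : (PT * measurableTypeR R)%type => sh (c * z.2) z.1 : PT).
Proof.
apply: measurable_fun_pair => /=.
  apply: measurable_funD.
    exact: (measurableT_comp measurable_fst measurable_fst).
  by apply: measurable_funM => //; exact: measurable_snd.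
exact: (measurableT_comp measurable_snd measurable_fst).
Qed.

Definition kr c s p q (z : PT * measurableTypeR R) : R :=
  ind s z.2 * (p (sh (c * z.2) z.1) * q z.1).

(** The integral of p over the horizontal segment from x to x + c s e_1, parametrized by [0, s]. The
    increment formula has c = 1; its adjoint, acting on the test function, has c = -1. *)
Definition Dk c s p (x : plane R) : R := \int[leb]_t (ind s t * p (sh (c * t) x)).

Lemma abs_pair_le p q : SI p -> SI q -> `|\int[mu]_x (p x * q x)| <=
  2^-1 * (\int[mu]_x (p x ^+ 2) + \int[mu]_x (q x ^+ 2)).
Proof.
move=> sp sq; have [_ pi] := sp; have [_ qi] := sq.
rewrite -RiD// -RiZ; last exact: IntD.
apply: le_trans (le_normr_Rintegral _ _) _ => //; first exact: SI_M.
apply: Ri_le; first by apply: Int_abs; exact: SI_M.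
  by apply: IntZ; exact: IntD.
by apply: aeW => x; exact: amgm.
Qed.

Lemma measurable_kr c s p q : SI p -> SI q -> measurable_fun setT (kr c s p q).
Proof.
move=> [mp _] [mq _]; apply: measurable_funM.
  by apply: (measurableT_comp (measurable_ind s)); exact: measurable_snd.
apply: measurable_funM; first exact: (measurableT_comp mp (measurable_sh2 c)).
exact: (measurableT_comp mq measurable_fst).
Qed.

(** The arithmetic-geometric inequality bounds the inner integral by a constant that, by translation
    invariance, does not depend on t; the weight then contributes a factor s. *)
Lemma kr_fin c s p q : 0 <= s -> SI p -> SI q ->
  (\int[leb]_t \int[mu]_x `|(kr c s p q (x, t))%:E| < +oo)%E.
Proof.
move=> s0 sp sq; have [mp pi] := sp; have [mq qi] := sq.
pose C : R := 2^-1 * (\int[mu]_x (p x ^+ 2) + \int[mu]_x (q x ^+ 2)).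
have C0 : 0 <= C by rewrite mulr_ge0// addr_ge0//; apply: Rintegral_ge0 => x _; exact: sqr_ge0.
have b t : (\int[mu]_x `|(kr c s p q (x, t))%:E| <= (C * ind s t)%:E)%E.
  have sps := SI_sh (c * t) sp.
  have i1 : Int mu (fun x => `|p (sh (c * t) x) * q x|) by apply: Int_abs; exact: SI_M.
  have e : (\int[mu]_x `|(kr c s p q (x, t))%:E| = (ind s t)%:E * \int[mu]_x (`|p (sh (c * t) x) * q x|)%:E)%E.
    rewrite -ge0_integralZl//; last 2 first.
    - by apply/measurable_EFinP; exact: Int_meas i1.
    - by rewrite lee_fin ind_ge0.
    apply: eq_integral => x _.
    by rewrite /kr /= normrM (ger0_norm (ind_ge0 _ _)) EFinM.
  rewrite e EFinM muleC lee_wpmul2r ?lee_fin ?ind_ge0//.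
  rewrite -[X in (X <= _)%E]fineK; last exact: integrable_fin_num.
  rewrite lee_fin /C -(Ri_sh (c * t) pi) -RiD//; last exact: (Int_sh (c * t) pi).
  rewrite -RiZ; last by apply: IntD => //; exact: (Int_sh (c * t) pi).
  apply: Ri_le => //.
    by apply: IntZ; apply: IntD => //; exact: (Int_sh (c * t) pi).
  by apply: aeW => x; exact: amgm.
apply: (@le_lt_trans _ _ (\int[leb]_t (C * ind s t)%:E)%E).
  apply: ge0_le_integral => //.
  - by move=> t _; apply: integral_ge0.
  - apply: (@measurable_fun_fubini_tonelli_G _ _ _ _ _ area_fun (fun z => `|(kr c s p q z)%:E|%E)) => //.
    by apply: measurableT_comp => //; apply/measurable_EFinP; exact: measurable_kr.
  - by apply/measurable_EFinP; apply: measurable_funM => //; exact: measurable_ind.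
under eq_integral do rewrite EFinM.
rewrite ge0_integralZl; first by rewrite integral_ind// -EFinM ltry.
- exact: measurableT.
- by apply/measurable_EFinP; exact: measurable_ind.
- by move=> x _; rewrite lee_fin ind_ge0.
- by rewrite lee_fin.
Qed.

Lemma Dk_kr c s p q (x : PT) : Int leb (fun t => kr c s p q (x, t)) ->
  \int[leb]_t kr c s p q (x, t) = Dk c s p x * q x.
Proof.
(* Integrability of the kernel says something about the section of p only where q does not vanish;
   elsewhere both sides are 0. *)
move=> h; have [qx|qx] := eqVneq (q x) 0.
  rewrite qx mulr0 /kr /= qx /Rintegral integral0_eq// => t _.
  by rewrite !mulr0.
have h2 : Int leb (fun t => ind s t * p (sh (c * t) x)).
  have -> : (fun t => ind s t * p (sh (c * t) x)) = (fun t => (q x)^-1 * kr c s p q (x, t)).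
    by apply/funext => t; rewrite /kr /=; field.
  exact: IntZ.
rewrite /Dk -[RHS]RintegralZr//; congr Rintegral; apply/funext => t.
by rewrite /kr /= mulrA.
Qed.

Lemma SI_box M : SI (\1_(box M) : plane R -> R).
Proof.
split; first by apply: measurable_indic; exact: measurable_box.
have -> : (fun x => \1_(box M) x ^+ 2) = \1_(box M) :> (plane R -> R).
  by apply/funext => x; rewrite indicE; case: (_ \in _); rewrite /= ?expr1n ?expr0n.
exact: Int_box.
Qed.

(** Positive and negative parts are treated separately, since the sections of p need not be
    integrable at every point. *)
Lemma measurable_Dk c s p : SI p -> measurable_fun setT (Dk c s p : PT -> R).
Proof.
move=> [mp _]; rewrite /Dk /Rintegral.
apply: (measurableT_comp (fine_measurable _)) => //.
pose H (z : PT * measurableTypeR R) := (ind s z.2 * p (sh (c * z.2) z.1))%:E.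
have mH : measurable_fun setT H.
  apply/measurable_EFinP; apply: measurable_funM.
    by apply: (measurableT_comp (measurable_ind s)); exact: measurable_snd.
  exact: (measurableT_comp mp (measurable_sh2 c)).
rewrite (_ : (fun x => _) = (fun x => \int[leb]_t H^\+ (x, t) - \int[leb]_t H^\- (x, t))%E).
  apply: emeasurable_funB.
    by apply: (@measurable_fun_fubini_tonelli_F _ _ _ _ _ leb (H^\+)%E) => //; exact: measurable_funepos.
  by apply: (@measurable_fun_fubini_tonelli_F _ _ _ _ _ leb (H^\-)%E) => //; exact: measurable_funeneg.
apply/funext => x; rewrite integralE; congr (_ - _)%E.
  by apply: eq_integral => t _; rewrite !funeposE.
by apply: eq_integral => t _; rewrite !funenegE.
Qed.

Lemma Dk_pair c s p q : 0 <= s -> SI p -> SI q ->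
  [/\ Int mu (fun x => Dk c s p x * q x),
  Int leb (fun t => ind s t * \int[mu]_x (p (sh (c * t) x) * q x)) &
  \int[mu]_x (Dk c s p x * q x) =
  \int[leb]_t (ind s t * \int[mu]_x (p (sh (c * t) x) * q x))].
Proof.
move=> s0 sp sq; have mD := @measurable_Dk c s p sp.
have [ai i1 i2 e] := area_Fub (measurable_kr c s sp sq) (kr_fin c s0 sp sq).
have aeD : {ae mu, forall x, \int[leb]_t kr c s p q (x, t) = Dk c s p x * q x}.
  by apply: filterS ai => x; exact: Dk_kr.
have mDq : measurable_fun setT (fun x : PT => Dk c s p x * q x).
  by apply: measurable_funM => //; case: sq.
have eJ : (fun t => \int[mu]_x kr c s p q (x, t)) =
   (fun t => ind s t * \int[mu]_x (p (sh (c * t) x) * q x)).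
  apply/funext => t; rewrite /kr /= RintegralZl//.
  by apply: SI_M => //; exact: SI_sh.
split; first exact: (Int_ae mDq i1 aeD).
  by rewrite -eJ.
by rewrite -(Ri_ae (Int_meas i1) mDq aeD) e eJ.
Qed.

Lemma Lloc_Dk c s p : 0 <= s -> SI p -> Lloc (Dk c s p).
Proof.
move=> s0 sp; split; first exact: measurable_Dk.
move=> M; apply/(integrable_mkcond _ (measurable_box M)).
have [+ _ _] := @Dk_pair c s p (\1_(box M)) s0 sp (SI_box M).
apply: eq_integrable => // x _ /=; rewrite patchE indicE.
by case: ifPn => /= _; rewrite ?mulr1 ?mulr0.
Qed.

Lemma pair_sh c p q : SI p -> SI q ->
  \int[mu]_x (p (sh c x) * q x) = \int[mu]_x (p x * q (sh (- c) x)).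
Proof.
move=> sp sq; rewrite -(@Ri_sh _ (- c) (fun x => p (sh c x) * q x)); last first.
  by apply: SI_M => //; exact: SI_sh.
congr Rintegral; apply/funext => x.
by rewrite /sh /= subrK -surjective_pairing.
Qed.

(** By [null_plane] it is enough to pair both sides with a b. Moving the translation onto a, the
    left-hand side becomes minus the pairing of f with A' b, where A is the window integral of
    [test1_prim]; the weak derivative turns this into the pairing of g with A b. As A b is an
    integral of translates of a b, moving these back onto g gives the right-hand side. *)
Theorem wk1_shift s f g : 0 < s -> SI f -> SI g -> wk1 f g ->
  {ae mu, forall x, f (sh s x) - f x = Dk 1 s g x}.
Proof.
move=> s0 sf sg fg.
have sP := SI_prodT.
pose k x := f (sh s x) - f x - Dk 1 s g x.
have lk : Lloc k.
  apply: Lloc_B; last exact: Lloc_Dk (ltW s0) sg.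
  by apply: Lloc_B; apply: SI_Lloc => //; exact: SI_sh.
suff : {ae mu, forall x, k x = 0}.
  by apply: filterS => x /eqP; rewrite subr_eq0 => /eqP.
apply: null_plane => // a b ta tb.
have sp := sP _ _ _ ta tb.
have [A [tA A' AE]] := test1_prim ta s0.
have [i1 _ e1] := Dk_pair 1 (ltW s0) sg sp.
have i2 : Int mu (fun x => f (sh s x) * prodT a b x) by apply: SI_M => //; exact: SI_sh.
have i3 : Int mu (fun x => f x * prodT a b x) by exact: SI_M.
have -> : (fun x => k x * prodT a b x) =
  (fun x => (f (sh s x) * prodT a b x - f x * prodT a b x) - Dk 1 s g x * prodT a b x).
  by apply/funext => x; rewrite /k !mulrBl.
rewrite RiB//; last exact: IntB.
rewrite RiB// pair_sh// e1.
have as_ x : prodT a b (sh (- s) x) = prodT a b x - prodT (derive1 A) b x.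
  by rewrite /prodT A' /sh /=; ring.
have -> : \int[mu]_x (f x * prodT a b (sh (- s) x)) =
   \int[mu]_x (f x * prodT a b x) + \int[mu]_x (g x * prodT A b x).
  have -> : (fun x => f x * prodT a b (sh (- s) x)) =
    (fun x => f x * prodT a b x - f x * prodT (derive1 A) b x).
    by apply/funext => x; rewrite as_ mulrBr.
  rewrite RiB//; last by apply: SI_M => //; apply: sP => //; exact: test1_derive.
  by rewrite fg// opprK.
have -> : \int[leb]_t (ind s t * \int[mu]_x (g (sh (1 * t) x) * prodT a b x)) =
  \int[leb]_t (ind s t * \int[mu]_x (prodT a b (sh (-1 * t) x) * g x)).
  congr Rintegral; apply/funext => t; rewrite mul1r pair_sh// mulN1r; congr (_ * _).
  by congr Rintegral; apply/funext => x; rewrite mulrC.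
(* The adjoint of [Dk 1 s] is [Dk (-1) s], and it sends a b to A b. *)
have [_ _ <-] := Dk_pair (-1) (ltW s0) sp sg.
have -> : (fun x => Dk (-1) s (prodT a b) x * g x) = (fun x => g x * prodT A b x).
  apply/funext => x; rewrite mulrC; congr (_ * _).
  rewrite /Dk /prodT AE -RintegralZr//; last first.
    apply: continuous_compact_integrable; first exact: segment_compact.
    apply: continuous_subspaceT => t; apply: continuous_comp; last exact: test1_cont.
    by apply: cvgB; [exact: cvg_cst|exact: cvg_id].
  rewrite [RHS]Rintegral_mkcond; congr Rintegral; apply/funext => t.
  rewrite patchE /ind indicE mulN1r /sh /=.
  by case: ifPn => _; rewrite ?mul1r ?mul0r.
by ring.
Qed.

End Steklov.

(** * Integration by parts for weak derivatives *)

Section SobolevOne.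
Context {R : realType}.
Implicit Types (f g h k p q : plane R -> R) (a b : R -> R) (c s : R).
Notation mu := (@area R).
Notation leb := (@lebesgue_measure R).

Lemma sh0 (x : plane R) : sh 0 x = x.
Proof. by case: x => x y; rewrite /sh /= addr0. Qed.

Lemma ind_in s (t : R) : 0 <= t <= s -> ind s t = 1.
Proof. by move=> h; rewrite /ind indicE mem_set. Qed.

Lemma ind_out s (t : R) : ~ (0 <= t <= s) -> ind s t = 0.
Proof. by move=> h; rewrite /ind indicE memNset//= in_itv /=. Qed.

Lemma ind_est s (c C : R) (J : R -> R) : 0 <= s -> Int leb (fun t => ind s t * J t) ->
  (forall t, 0 <= t <= s -> `|J t - c| <= C) ->
  `|\int[leb]_t (ind s t * J t) - s * c| <= s * C.
Proof.
move=> s0 Ji JC.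
have ic : Int leb (fun t => c * ind s t) by apply: IntZ; exact: Int_ind.
have -> : s * c = \int[leb]_t (c * ind s t) by rewrite RiZ ?Ri_ind// 1?mulrC//; exact: Int_ind.
rewrite -RiB//; apply: le_trans (le_normr_Rintegral _ _) _ => //; first exact: IntB.
have -> : s * C = \int[leb]_t (C * ind s t) by rewrite RiZ ?Ri_ind// 1?mulrC//; exact: Int_ind.
apply: Ri_le; first by apply: Int_abs; exact: IntB.
  by apply: IntZ; exact: Int_ind.
apply: aeW => t; have [h|h] := pselect (0 <= t <= s).
  by rewrite ind_in// mul1r !mulr1 JC.
by rewrite ind_out// !mulr0 mul0r subrr normr0.
Qed.

(** A bound for the pairing of p and q that is unchanged when either of them is translated. *)
Definition qn p q : R := 2^-1 * (\int[mu]_x (p x ^+ 2) + \int[mu]_x (q x ^+ 2)).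

Lemma Dk_est s p q c : 0 <= s -> SI p -> SI q ->
  `|\int[mu]_x (Dk 1 s p x * q (sh c x))| <= s * qn p q.
Proof.
move=> s0 sp sq; have sqc := SI_sh c sq.
have [_ i1 ->] := Dk_pair 1 s0 sp sqc.
have := @ind_est s 0 (qn p q) _ s0 i1; rewrite mulr0 subr0; apply.
move=> t _; rewrite subr0; have spt := SI_sh (1 * t) sp.
apply: le_trans (abs_pair_le spt sqc) _.
have [_ pi] := sp; have [_ qi] := sq.
by rewrite (Ri_sh (1 * t) pi) (Ri_sh c qi).
Qed.

(** By the increment formula, a translation by s changes a pairing by O(s). The case s = 0 is apart
    because [wk1_shift] asks for s > 0. *)
Lemma pair_diff s c f g q : 0 <= s -> SI f -> SI g -> wk1 f g -> SI q ->
  `|\int[mu]_x (f (sh s x) * q (sh c x)) - \int[mu]_x (f x * q (sh c x))| <= s * qn g q.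
Proof.
move=> s0 sf sg fg sq; have sqc := SI_sh c sq; have sfs := SI_sh s sf.
move: s0; rewrite le_eqVlt => /predU1P[<-|s0].
  rewrite mul0r; under eq_Rintegral do rewrite sh0.
  by rewrite subrr normr0.
rewrite -RiB; [|exact: SI_M|exact: SI_M].
have [i1 _ _] := Dk_pair 1 (ltW s0) sg sqc.
rewrite (@Ri_ae _ _ _ mu _ (fun x => Dk 1 s g x * q (sh c x))).
- exact: Dk_est (ltW s0) sg sq.
- by apply: Int_meas; apply: IntB; exact: SI_M.
- exact: Int_meas i1.
- by apply: filterS (wk1_shift s0 sf sg fg) => x /= <-; rewrite mulrBl.
Qed.

(* Integrating the product rule for the increment of f h over a shift s gives
   s (int g h + int f k) = O(s^2). *)
Theorem wk1_ibp f g h k : SI f -> SI g -> SI h -> SI k -> wk1 f g -> wk1 h k ->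
  \int[mu]_x (g x * h x) = - \int[mu]_x (f x * k x).
Proof.
move=> sf sg sh_ sk fg hk.
pose C := qn g k.
have Csym : qn k g = C by rewrite /C /qn addrC.
have C0 : 0 <= C by rewrite mulr_ge0// addr_ge0//; apply: Rintegral_ge0 => x _; exact: sqr_ge0.
pose X := \int[mu]_x (g x * h x) + \int[mu]_x (f x * k x).
(* X does not depend on s, so a bound that is linear in s for every s > 0 forces X = 0. *)
suff XC s : 0 < s -> `|X| <= 2 * C * s.
  have X0 : X = 0.
    apply/normr0_eq0/le_anti; rewrite normr_ge0 andbT.
    apply/ler_addgt0Pl => e e0; rewrite addr0.
    have p0 : 0 < 2 * C + 1 by lra.
    apply: le_trans (XC (e / (2 * C + 1)) (divr_gt0 e0 p0)) _.
    by rewrite mulrCA ger_pMr// ler_pdivrMr// mul1r; lra.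
  by apply/eqP; rewrite -addr_eq0; apply/eqP.
move=> s0; have s0' := ltW s0.
have shs := SI_sh s sh_; have sfs := SI_sh s sf.
have [iA iA' eA] := Dk_pair 1 s0' sg shs.
have [iB iB' eB] := Dk_pair 1 s0' sk sf.
(* The discrete product rule: the sum is the integral of the increment of f h, zero by translation
   invariance. *)
have sum0 : \int[mu]_x (Dk 1 s g x * h (sh s x)) + \int[mu]_x (Dk 1 s k x * f x) = 0.
  rewrite -RiD//.
  have ifh : Int mu (fun x => f x * h x) by exact: SI_M.
  rewrite (@Ri_ae _ _ _ mu _ (fun x => f (sh s x) * h (sh s x) - f x * h x)).
  - rewrite RiB//; last exact: (Int_sh s ifh).
    by rewrite (Ri_sh s ifh) subrr.
  - exact: (Int_meas (IntD iA iB)).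
  - exact: (Int_meas (IntB (Int_sh s ifh) ifh)).
  - apply: filterS2 (wk1_shift s0 sf sg fg) (wk1_shift s0 sh_ sk hk) => x /= <- <-.
    by ring.
(* After a translation by -t the integrand at t pairs h shifted by s - t with g, which differs from
   the pairing of h with g by at most (s - t) C. *)
have estA : `|\int[mu]_x (Dk 1 s g x * h (sh s x)) - s * \int[mu]_x (g x * h x)| <= s * (s * C).
  rewrite eA; apply: ind_est => // t /andP[t0 ts].
  rewrite mul1r.
  have -> : \int[mu]_x (g (sh t x) * h (sh s x)) = \int[mu]_x (h (sh (s - t) x) * g (sh 0 x)).
    rewrite -(@Ri_sh _ t (fun x => h (sh (s - t) x) * g (sh 0 x))); last first.
      by apply: SI_M; exact: SI_sh.
    congr Rintegral; apply/funext => x; rewrite mulrC sh0; congr (h _ * _).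
    by rewrite /sh /=; congr pair; ring.
  have -> : \int[mu]_x (g x * h x) = \int[mu]_x (h x * g (sh 0 x)).
    by congr Rintegral; apply/funext => x; rewrite mulrC sh0.
  have st : 0 <= s - t by rewrite subr_ge0.
  apply: le_trans (pair_diff 0 st sh_ sk hk sg) _.
  by rewrite Csym ler_wpM2r// gerBl.
have estB : `|\int[mu]_x (Dk 1 s k x * f x) - s * \int[mu]_x (f x * k x)| <= s * (s * C).
  rewrite eB; apply: ind_est => // t /andP[t0 ts].
  rewrite mul1r -normrN opprB.
  have -> : \int[mu]_x (k (sh t x) * f x) = \int[mu]_x (f x * k (sh t x)).
    by congr Rintegral; apply/funext => x; rewrite mulrC.
  have -> : \int[mu]_x (f x * k x) = \int[mu]_x (f (sh t x) * k (sh t x)).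
    by rewrite (Ri_sh t (SI_M sf sk)).
  apply: le_trans (pair_diff t t0 sf sg fg sk) _.
  by rewrite ler_wpM2r.
have : s * `|X| <= s * (2 * C * s).
  rewrite -{1}(gtr0_norm s0) -normrM.
  have -> : s * X = - ((\int[mu]_x (Dk 1 s g x * h (sh s x)) - s * \int[mu]_x (g x * h x)) +
    (\int[mu]_x (Dk 1 s k x * f x) - s * \int[mu]_x (f x * k x))).
    by rewrite addrACA sum0 add0r -opprD opprK -mulrDr.
  rewrite normrN; apply: le_trans (ler_normD _ _) _.
  by apply: le_trans (lerD estA estB) _; rewrite le_eqVlt; apply/orP; left; apply/eqP; ring.
by rewrite ler_pM2l.
Qed.

End SobolevOne.

(** * Boundedness of H^2 functions *)

Section SobolevBounded.
Context {R : realType}.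
Implicit Types (f g h k p q : plane R -> R) (a b : R -> R) (c s : R).
Notation mu := (@area R).
Notation leb := (@lebesgue_measure R).
Notation PT := ((measurableTypeR R * measurableTypeR R)%type).
Local Open Scope ereal_scope.

#[global] Instance ae_leb_filter : Filter (almost_everywhere leb).
Proof. exact: (ae_filter_ringOfSetsType leb). Qed.

Lemma measurable_sh_pair : measurable_fun setT
  (fun z : (PT * measurableTypeR R)%type => sh z.2 z.1 : PT).
Proof.
have := @measurable_sh2 R 1; congr measurable_fun.
by apply/funext => z; rewrite mul1r.
Qed.

Lemma measurable_sh_t (x : PT) : measurable_fun setT (fun t : measurableTypeR R => sh t x : PT).
Proof. exact: (measurableT_comp measurable_sh_pair (measurable_pair1 x)). Qed.

(** The mean of U over the horizontal unit segment starting at x. Extended real values make it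
    meaningful for every nonnegative measurable U. *)
Definition avg (U : plane R -> \bar R) (x : plane R) : \bar R :=
  \int[leb]_t ((ind 1 t)%:E * U (sh t x)).

Lemma avg_ge0 U x : (forall y, 0 <= U y) -> 0 <= avg U x.
Proof. by move=> U0; apply: integral_ge0 => t _; rewrite mule_ge0// lee_fin ind_ge0. Qed.

Lemma measurable_ker (U : plane R -> \bar R) : measurable_fun setT (U : PT -> \bar R) ->
  measurable_fun setT (fun z : PT * measurableTypeR R => (ind 1 z.2)%:E * U (sh z.2 z.1)).
Proof.
move=> mU; apply: emeasurable_funM.
  apply/measurable_EFinP.
  by apply: (measurableT_comp (measurable_ind 1)); exact: measurable_snd.
exact: (measurableT_comp mU measurable_sh_pair).
Qed.

Lemma measurable_ker_t (U : plane R -> \bar R) (x : PT) : measurable_fun setT (U : PT -> \bar R) ->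
  measurable_fun setT (fun t : measurableTypeR R => (ind 1 t)%:E * U (sh t x)).
Proof.
move=> mU.
exact: (measurableT_comp (measurable_ker mU) (measurable_pair1 x)).
Qed.

Lemma measurable_avg (U : plane R -> \bar R) : measurable_fun setT (U : PT -> \bar R) ->
  (forall y, 0 <= U y) -> measurable_fun setT (avg U : PT -> \bar R).
Proof.
move=> mU U0.
apply: (@measurable_fun_fubini_tonelli_F _ _ _ _ _ leb
  (fun z : PT * measurableTypeR R => (ind 1 z.2)%:E * U (sh z.2 z.1))).
  exact: measurable_ker.
by move=> z; rewrite mule_ge0// lee_fin ind_ge0.
Qed.

(** Every translate of a null set is null, so the set of pairs (x, t) with x + t e_1 in it has null
    sections in x. *)
Lemma ae_segment (P : plane R -> Prop) : {ae mu, forall x, P x} ->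
  {ae mu, forall x, {ae leb, forall t, P (sh t x)}}.
Proof.
move=> [N [mN N0 PN]].
have mA : measurable ((fun z : PT * measurableTypeR R => sh z.2 z.1 : PT) @^-1` N).
  by rewrite -[X in measurable X]setTI; exact: measurable_sh_pair.
have := area_null_sections mA.
have H t : mu [set x | ((fun z : PT * measurableTypeR R => sh z.2 z.1 : PT) @^-1` N) (x, t)] = 0.
  by rewrite -[RHS]N0 -[RHS](area_pres (measurable_sh t) (@ge0_integral_sh _ t) mN).
move=> /(_ H); apply: filterS => x; apply: filterS => t /= h.
by apply: contrapT => h2; apply: h; exact: PN.
Qed.

Lemma le_avg (U W : plane R -> \bar R) : measurable_fun setT (U : PT -> \bar R) ->
  measurable_fun setT (W : PT -> \bar R) ->
  (forall y, 0 <= U y) -> (forall y, 0 <= W y) ->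
  {ae mu, forall x, U x <= W x} -> {ae mu, forall x, avg U x <= avg W x}.
Proof.
move=> mU mW U0 W0 /ae_segment; apply: filterS => x h.
apply: ae_ge0_le_integral => //.
- by move=> t _; rewrite mule_ge0// lee_fin ind_ge0.
- exact: measurable_ker_t.
- by move=> t _; rewrite mule_ge0// lee_fin ind_ge0.
- exact: measurable_ker_t.
- by apply: filterS h => t /= h _; rewrite lee_wpmul2l// lee_fin ind_ge0.
Qed.

Definition abE f (x : plane R) : \bar R := `|f x|%:E.

Lemma abE_ge0 f x : 0 <= abE f x.
Proof. by rewrite lee_fin. Qed.

Lemma measurable_abE f : measurable_fun setT (f : PT -> R) ->
  measurable_fun setT (abE f : PT -> \bar R).
Proof. by move=> mf; apply/measurable_EFinP; exact: measurableT_comp. Qed.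

Lemma Dk_le_avg t g (x : plane R) : SI g -> (0 <= t <= 1)%R ->
  `|Dk 1 t g x|%:E <= avg (abE g) x.
Proof.
move=> [mg _] /andP[t0 t1]; rewrite /Dk /Rintegral -abse_EFin.
(* [fine] sends the infinite values to 0, so the bound also holds where the integral of g is
   infinite. *)
have fine_le (y : \bar R) : `|(fine y)%:E| <= `|y|.
  by case: y => [r| |]; rewrite ?lexx//= leey.
apply: le_trans (fine_le _) _.
have mk : measurable_fun setT (fun r : measurableTypeR R => (ind t r * g (sh (1 * r) x))%:E).
  apply/measurable_EFinP; apply: measurable_funM; first exact: measurable_ind.
  have -> : (fun r => g (sh (1 * r) x)) = (fun r => g (sh r x)).
    by apply/funext => r; rewrite mul1r.
  exact: (measurableT_comp mg (measurable_sh_t x)).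
apply: le_trans (le_abse_integral _ _ mk) _ => //.
apply: ge0_le_integral => //.
- exact: measurableT_comp.
- by apply: measurable_ker_t; exact: measurable_abE.
- move=> r _; rewrite mul1r abse_EFin normrM EFinM (ger0_norm (ind_ge0 _ _)).
  rewrite lee_wpmul2r ?lee_fin//.
  have [h|h] := pselect (0 <= r <= t)%R.
    rewrite !ind_in//; move: h => /andP[-> h] /=; exact: le_trans h t1.
  by rewrite ind_out// ind_ge0.
Qed.

(** For each t in [0, 1], the increment formula bounds |f(x)| by |f(x + t e_1)| plus the mean of
    |g|, for almost every x; this is then averaged over t. The weights [ind 1] make the inequality
    trivial for t outside [0, 1]. *)
Theorem wk1_le_avg f g : SI f -> SI g -> wk1 f g ->
  {ae mu, forall x, `|f x|%:E <= avg (abE f) x + avg (abE g) x}.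
Proof.
move=> sf sg fg; have [mf _] := sf; have [mg _] := sg.
have mF := measurable_abE mf; have mG := measurable_abE mg.
pose LH (z : PT * measurableTypeR R) := (ind 1 z.2)%:E * abE f z.1.
pose RH (z : PT * measurableTypeR R) := (ind 1 z.2)%:E * abE f (sh z.2 z.1) + (ind 1 z.2)%:E * avg (abE g) z.1.
have mind : measurable_fun setT (fun z : PT * measurableTypeR R => (ind (1:R) z.2)%:E).
  apply/measurable_EFinP.
  by apply: (measurableT_comp (measurable_ind 1)); exact: measurable_snd.
have mL : measurable_fun setT LH.
  by apply: emeasurable_funM => //; exact: (measurableT_comp mF measurable_fst).
have mavg := measurable_avg mG (abE_ge0 g).
have mR : measurable_fun setT RH.
  apply: emeasurable_funD; first exact: measurable_ker.
  by apply: emeasurable_funM => //; exact: (measurableT_comp mavg measurable_fst).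
(* The pairs (x, t) at which the inequality fails: its sections at fixed t are null, hence almost
   every x sees almost no bad t. *)
have mA : measurable [set z | RH z < LH z].
  by rewrite -[X in measurable X]setTI; exact: measurable_lte.
have H t : mu [set x | [set z | RH z < LH z] (x, t)] = 0.
  apply: measure_negligible.
    have := measurable_ysection t mA; rewrite /ysection.
    by under eq_set do rewrite inE.
  have [tin|tout] := pselect (0 <= t <= 1)%R; last first.
    exists set0; split; [exact: measurable0|exact: measure0|].
    by move=> x /=; rewrite /RH /LH /= ind_out// !mul0e adde0 ltxx.
  (* At t = 0 the inequality is immediate, while the increment formula needs t > 0. *)
  have [t0|t0] := eqVneq t 0%R.
    exists set0; split; [exact: measurable0|exact: measure0|].
    move=> x /=; rewrite /RH /LH /= ind_in// !mul1e t0 sh0.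
    by apply/negP; rewrite -leNgt leeDl// avg_ge0// => y; exact: abE_ge0.
  have t0' : (0 < t)%R by move: tin => /andP[h _]; rewrite lt_neqAle eq_sym t0.
  have [N [mN N0 hN]] := wk1_shift t0' sf sg fg.
  exists N; split => // x /=; rewrite /RH /LH /= ind_in// !mul1e => hlt.
  apply: hN => /= e; move: hlt; apply/negP; rewrite -leNgt.
  have -> : abE f x = `|f (sh t x) - Dk 1 t g x|%:E by rewrite /abE -e; congr (`|_|%:E); ring.
  apply: le_trans (leeD (lexx _) (Dk_le_avg x sg tin)).
  by rewrite /abE -EFinD lee_fin ler_normB.
have := area_null_sections mA H; apply: filterS => x h.
have -> : `|f x|%:E = \int[leb]_t ((ind 1 t)%:E * `|f x|%:E).
  rewrite ge0_integralZr//; first by rewrite integral_ind// mul1e.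
  - by apply/measurable_EFinP; exact: measurable_ind.
  - by move=> t _; rewrite lee_fin ind_ge0.
have e2 : avg (abE g) x = \int[leb]_t ((ind 1 t)%:E * avg (abE g) x).
  rewrite ge0_integralZr//; first by rewrite integral_ind// mul1e.
  - by apply/measurable_EFinP; exact: measurable_ind.
  - by move=> t _; rewrite lee_fin ind_ge0.
  - by apply: avg_ge0; exact: abE_ge0.
have mI1 : measurable_fun setT (fun t : measurableTypeR R => (ind (1:R) t)%:E).
  by apply/measurable_EFinP; exact: measurable_ind.
rewrite [X in _ + X]e2 -ge0_integralD//.
- apply: ae_ge0_le_integral => //.
  + by move=> t _; rewrite mule_ge0// lee_fin ?ind_ge0.
  + exact: emeasurable_funM.
  + by move=> t _; rewrite adde_ge0// mule_ge0// ?avg_ge0 ?lee_fin ?ind_ge0//; exact: abE_ge0.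
  + apply: emeasurable_funD; first exact: measurable_ker_t.
    exact: emeasurable_funM.
  + by apply: filterS h => t /= h _; rewrite leNgt; apply/negP.
- by move=> t _; rewrite mule_ge0// lee_fin ?ind_ge0.
- exact: measurable_ker_t.
- by move=> t _; rewrite mule_ge0// ?avg_ge0 ?lee_fin ?ind_ge0//; exact: abE_ge0.
- exact: emeasurable_funM.
Qed.


(** The mean over the vertical unit segment starting at x. *)
Definition avg2 (U : plane R -> \bar R) (x : plane R) : \bar R :=
  avg (U \o (@swp R)) (swp x).

Lemma swpK : involutive (@swp R). Proof. by case. Qed.

Lemma wk2_swp f g : SI f -> SI g -> wk2 f g -> wk1 (f \o (@swp R)) (g \o (@swp R)).
Proof.
move=> sf sg fg a b ta tb.
have key k a' b' : SI k -> test1 a' -> test1 b' ->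
  (\int[mu]_x ((k \o (@swp R)) x * prodT a' b' x) = \int[mu]_x (k x * prodT b' a' x))%R.
  move=> sk ta' tb'.
  rewrite -(@Ri_swp _ (fun x => (k x * prodT b' a' x)%R)); last first.
    by apply: SI_M => //; exact: SI_prodT.
  by congr Rintegral; apply/funext => x; congr (_ * _)%R; rewrite /prodT /= mulrC.
by rewrite !key//; [exact: fg|exact: test1_derive].
Qed.

Theorem wk2_le_avg f g : SI f -> SI g -> wk2 f g ->
  {ae mu, forall x, `|f x|%:E <= avg2 (abE f) x + avg2 (abE g) x}.
Proof.
move=> sf sg fg; have := wk1_le_avg (SI_swp sf) (SI_swp sg) (wk2_swp sf sg fg).
by move=> /ae_swp; apply: filterS => x; rewrite /= swpK; exact.
Qed.

Lemma avg2_ge0 U x : (forall y, 0 <= U y) -> 0 <= avg2 U x.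
Proof. by move=> U0; apply: avg_ge0 => y; exact: U0. Qed.

Lemma measurable_avg2 (U : plane R -> \bar R) : measurable_fun setT (U : PT -> \bar R) ->
  (forall y, 0 <= U y) -> measurable_fun setT (avg2 U : PT -> \bar R).
Proof.
move=> mU U0.
have m1 : measurable_fun setT (avg (U \o (@swp R)) : PT -> \bar R).
  apply: measurable_avg; first exact: (measurableT_comp mU measurable_swp).
  by move=> y; exact: U0.
exact: (measurableT_comp m1 measurable_swp).
Qed.

Lemma avgD (U W : plane R -> \bar R) x : measurable_fun setT (U : PT -> \bar R) ->
  measurable_fun setT (W : PT -> \bar R) ->
  (forall y, 0 <= U y) -> (forall y, 0 <= W y) ->
  avg (fun x => U x + W x) x = avg U x + avg W x.
Proof.
move=> mU mW U0 W0; rewrite /avg -ge0_integralD//.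
- by apply: eq_integral => t _; rewrite ge0_muleDr.
- by move=> t _; rewrite mule_ge0// lee_fin ind_ge0.
- exact: measurable_ker_t.
- by move=> t _; rewrite mule_ge0// lee_fin ind_ge0.
- exact: measurable_ker_t.
Qed.

(** The left-hand side is the mean of |k| over a unit square, and |k| <= (1 + k^2) / 2. The bound is
    uniform in x since the integral of k^2 is extended to the whole plane. *)
Lemma avg_avg2_le k x : SI k ->
  avg (avg2 (abE k)) x <= (2^-1 + 2^-1 * \int[mu]_y (k y ^+ 2))%:E.
Proof.
move=> [mk ki].
have mi : measurable_fun setT (fun t : measurableTypeR R => (ind (1:R) t)%:E).
  by apply/measurable_EFinP; exact: measurable_ind.
have mk2 : measurable_fun setT (fun z : PT => (k z ^+ 2)%:E).
  by apply/measurable_EFinP; exact: measurable_funX.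
have k20 (z : PT) : 0 <= (k z ^+ 2)%:E by rewrite lee_fin sqr_ge0.
(* The integral of k^2 over a full vertical line; [bound] is applied on that line, then to G along
   the horizontal direction. *)
pose G (u : R) : \bar R := \int[leb]_r (k (u, r) ^+ 2)%:E.
have mG : measurable_fun setT (G : measurableTypeR R -> \bar R).
  exact: (@measurable_fun_fubini_tonelli_F _ _ _ _ _ leb (fun z : PT => (k z ^+ 2)%:E)).
have G0 u : 0 <= G u by apply: integral_ge0 => r _.
have Z (F : R -> \bar R) : measurable_fun setT (F : measurableTypeR R -> \bar R) ->
    (forall t, 0 <= F t) -> \int[leb]_t ((2^-1)%:E * F t) = (2^-1)%:E * \int[leb]_t F t.
  by move=> mF F0; apply: ge0_integralZl => //; rewrite lee_fin.
have bound (u : R -> \bar R) (v : R -> \bar R) : measurable_fun setT (u : measurableTypeR R -> \bar R) ->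
    measurable_fun setT (v : measurableTypeR R -> \bar R) ->
    (forall t, 0 <= u t) -> (forall t, 0 <= v t) ->
    (forall t, (0 <= t <= 1)%R -> u t <= (2^-1)%:E + (2^-1)%:E * v t) ->
    \int[leb]_t ((ind 1 t)%:E * u t) <= (2^-1)%:E + (2^-1)%:E * \int[leb]_t v t.
  move=> mu_ mv u0 v0 uv.
  have -> : (2^-1)%:E + (2^-1)%:E * \int[leb]_t v t = \int[leb]_t ((2^-1)%:E * (ind 1 t)%:E + (2^-1)%:E * v t).
    rewrite ge0_integralD//; last 4 first.
    - by move=> t _; rewrite mule_ge0// lee_fin ?ind_ge0.
    - exact: emeasurable_funM.
    - by move=> t _; rewrite mule_ge0// lee_fin.
    - exact: emeasurable_funM.
    rewrite Z//; last by move=> t; rewrite lee_fin ind_ge0.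
    by rewrite integral_ind// mule1 Z.
  apply: ge0_le_integral => //.
  - by move=> t _; rewrite mule_ge0// lee_fin ind_ge0.
  - exact: emeasurable_funM.
  - by apply: emeasurable_funD; exact: emeasurable_funM.
  - move=> t _; have [h|h] := pselect (0 <= t <= 1)%R.
      by rewrite ind_in// mul1e mule1; exact: uv.
    by rewrite ind_out// mul0e mule0 add0e mule_ge0// lee_fin.
have inner (y : plane R) : avg2 (abE k) y <= (2^-1)%:E + (2^-1)%:E * G y.1.
  rewrite /avg2 /avg.
  have -> : G y.1 = \int[leb]_r (k (y.1, r + y.2)%R ^+ 2)%:E.
    rewrite (@ge0_integral_shift1 R y.2 (fun r => (k (y.1, r) ^+ 2)%:E))//.
    exact: (measurableT_comp mk2 (measurable_pair1 y.1)).
  apply: bound.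
  - apply/measurable_EFinP; apply: measurableT_comp => //.
    apply: (measurableT_comp mk); apply: (measurableT_comp measurable_swp).
    exact: measurable_sh_t.
  - have := (measurableT_comp mk2 (measurableT_comp (measurable_pair1 y.1) (measurable_addr y.2))).
    exact.
  - by move=> t; rewrite /= /abE lee_fin.
  - by move=> t; rewrite lee_fin sqr_ge0.
  - move=> t _; rewrite /= /abE /swp /sh /= -EFinM -EFinD lee_fin (addrC y.2 t).
    have := sqr_ge0 (`|k (y.1, (t + y.2)%R)| - 1)%R.
    rewrite -(real_normK (num_real (k (y.1, (t + y.2)%R)))).
    move: `|_|%R => u; nra.
rewrite {1}/avg.
apply: (@le_trans _ _ ((2^-1)%:E + (2^-1)%:E * \int[leb]_t G (t + x.1)%R)).
  apply: bound.
  - have mab : measurable_fun setT (avg2 (abE k) : PT -> \bar R).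
      by apply: measurable_avg2; [exact: measurable_abE|exact: abE_ge0].
    exact: (measurableT_comp mab (measurable_sh_t x)).
  - exact: (measurableT_comp mG (measurable_addr x.1)).
  - by move=> t; apply: avg2_ge0; exact: abE_ge0.
  - by [].
  - by move=> t _; have := inner (sh t x); rewrite /sh /= addrC.
rewrite (@ge0_integral_shift1 R x.1 G)//.
rewrite EFinD EFinM leeD2l// lee_wpmul2l ?lee_fin//.
rewrite -[X in X <= _](@fubini_tonelli1 _ _ _ _ _ leb leb (fun z : PT => (k z ^+ 2)%:E))//.
rewrite /Rintegral fineK//.
exact: integrable_fin_num ki.
Qed.

(** Horizontally, |f| is bounded by means of |f| and |d_1 f|; vertically, each of these by means
    over unit squares, of f and d_2 f for the first and of d_1 f and d_1 d_2 f for the second. All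
    four are controlled by L^2 norms. *)
Theorem sobolev_bounded f g1 g2 g12 : SI f -> SI g1 -> SI g2 -> SI g12 ->
  wk1 f g1 -> wk2 f g2 -> wk2 g1 g12 ->
  exists C : R, {ae mu, forall x, (`|f x| <= C)%R}.
Proof.
move=> sf s1 s2 s12 w1 w2 w12.
have [mf _] := sf; have [m1 _] := s1; have [m2 _] := s2; have [m12 _] := s12.
pose c k : R := (2^-1 + 2^-1 * \int[mu]_y (k y ^+ 2))%R.
exists (c f + c g2 + (c g1 + c g12))%R.
have key u v : SI u -> SI v -> wk2 u v -> {ae mu, forall x, avg (abE u) x <= (c u + c v)%:E}.
  move=> su sv uv; have [mu_ _] := su; have [mv _] := sv.
  have mau := measurable_avg2 (measurable_abE mu_) (abE_ge0 u).
  have mav := measurable_avg2 (measurable_abE mv) (abE_ge0 v).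
  have au0 y := avg2_ge0 y (abE_ge0 u).
  have av0 y := avg2_ge0 y (abE_ge0 v).
  have h : {ae mu, forall x, avg (abE u) x <= avg (fun x => avg2 (abE u) x + avg2 (abE v) x) x}.
    apply: le_avg.
    - exact: measurable_abE.
    - exact: emeasurable_funD.
    - exact: abE_ge0.
    - by move=> y; rewrite adde_ge0.
    - exact: wk2_le_avg.
  apply: filterS h => x h; apply: le_trans h _.
  by rewrite avgD// EFinD leeD//; exact: avg_avg2_le.
have h1 := key _ _ sf s2 w2; have h2 := key _ _ s1 s12 w12.
have h3 := wk1_le_avg sf s1 w1.
apply: filterS3 h1 h2 h3 => x h1 h2 h3.
rewrite -lee_fin; apply: le_trans h3 _.
by rewrite [leRHS]EFinD leeD.
Qed.

End SobolevBounded.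

(** * Sobolev spaces of the plane *)

Section WeakDerivatives.
Context {R : realType}.
Implicit Types (f g h k p q eta : plane R -> R) (c s : R).
Notation mu := (@area R).
Notation PT := ((measurableTypeR R * measurableTypeR R)%type).

(** Links the topology of the plane to its product sigma-algebra: an open set is the countable union
    of the rational open rectangles that it contains. *)
Lemma open_measurable_plane (U : set (plane R)) : open U -> measurable (U : set PT).
Proof.
move=> oU.
pose rect (z : (rat * rat) * (rat * rat)) : set PT :=
  `]ratr z.1.1, ratr z.1.2[%classic `*` `]ratr z.2.1, ratr z.2.2[%classic.
pose F z : set PT := if `[< rect z `<=` U >] then rect z else set0.
have -> : U = \bigcup_z F z.
  apply/seteqP; split => [x Ux|x [z _]]; last first.
    by rewrite /F; case: asboolP => // zU; exact: zU.
  have := oU; rewrite openE => /(_ _ Ux) /nbhs_ballP[e /= e0 eU].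
  have [a /itvP ha] := @rat_in_itvoo R (x.1 - e) x.1 ltac:(by rewrite ltrBlDr ltrDl).
  have [b /itvP hb] := @rat_in_itvoo R x.1 (x.1 + e) ltac:(by rewrite ltrDl).
  have [c /itvP hc] := @rat_in_itvoo R (x.2 - e) x.2 ltac:(by rewrite ltrBlDr ltrDl).
  have [d /itvP hd] := @rat_in_itvoo R x.2 (x.2 + e) ltac:(by rewrite ltrDl).
  exists ((a, b), (c, d)) => //; rewrite /F; case: asboolP => [_|[]].
    by split; rewrite /= in_itv /= ?ha ?hb ?hc ?hd.
  move=> y [] /=; rewrite !in_itv /= => /andP[y1 y2] /andP[y3 y4]; apply: eU; split => /=.
    rewrite /ball /= ltr_distlC; apply/andP; split.
      by apply: lt_trans y1; rewrite ha.
    by apply: lt_trans y2 _; rewrite hb.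
  rewrite /ball /= ltr_distlC; apply/andP; split.
    by apply: lt_trans y3; rewrite hc.
  by apply: lt_trans y4 _; rewrite hd.
apply: countable_bigcupT_measurable; first exact: countableP.
move=> z; rewrite /F; case: asboolP => _; last exact: measurable0.
exact: (@measurableX _ _ (measurableTypeR R) (measurableTypeR R) _ _ (measurable_itv _) (measurable_itv _)).
Qed.

Lemma cont_measurable_plane f : continuous f -> measurable_fun setT (f : PT -> R).
Proof.
move=> /continuousP cf; apply: (measurability _ (RGenOpens.measurableE R)).
move=> _ [_ [a [b ->] <-]]; rewrite setTI; apply: open_measurable_plane.
exact/cf/interval_open.
Qed.

Lemma compact_measurable_plane (K : set (plane R)) : compact K -> measurable (K : set PT).
Proof.
move=> /compact_closed cK; rewrite -(setCK K); apply: measurableC.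
by apply: open_measurable_plane; apply: closed_openC; apply: cK; exact: norm_hausdorff.
Qed.

Lemma compact_sub_box (K : set (plane R)) : compact K -> exists M, K `<=` box M.
Proof.
move=> /compact_bounded [M [_ /(_ (M + 1))]] h; exists (M + 1) => x Kx.
have := h; rewrite ltrDl => /(_ ltr01 x Kx); rewrite /= prod_normE => hx.
by apply: in_box; apply: le_trans hx; rewrite le_max lexx ?orbT.
Qed.

Lemma SI_L1loc f : SI f -> L1loc f.
Proof.
move=> sf; split; first by case: sf.
move=> K cK; have [M KM] := compact_sub_box cK.
apply: (@integrableS _ _ _ mu (box M)) => //.
- exact: measurable_box.
- exact: compact_measurable_plane.
- by case: (SI_Lloc sf).
Qed.

Lemma SI_bounded_support f (M C : R) : measurable_fun setT (f : PT -> R) ->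
  (forall x, `|f x| <= C * \1_(box M) x) -> SI f.
Proof.
move=> mf h; split => //.
apply: (@Int_le _ _ _ mu _ (fun x => C ^+ 2 * \1_(box M) x)).
- exact: measurable_funX.
- by apply: IntZ; exact: Int_box.
- apply: aeW => x; rewrite normrX.
  have := h x; rewrite indicE; case: (_ \in _); rewrite /= ?mulr1 ?mulr0 => hx.
    by rewrite lerXn2r ?nnegrE//; apply: le_trans hx; exact: normr_ge0.
  have -> : `|f x| = 0 by apply/le_anti; rewrite hx normr_ge0.
  by rewrite expr0n.
Qed.

Lemma Cn_continuous n f : Cn n f -> continuous f.
Proof. by case: n => [[]|n []]. Qed.

Lemma test_SI eta : test_fun eta -> SI eta.
Proof.
move=> [sm [K cK eK]].
have ce := Cn_continuous (sm 0%N).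
have [M KM] := compact_sub_box cK.
have /compact_bounded [C [_ /(_ (C + 1))]] := continuous_compact (continuous_subspaceT ce) (@compact_box R M).
rewrite ltrDl => /(_ ltr01) hC.
apply: (@SI_bounded_support _ M (C + 1)); first exact: cont_measurable_plane.
move=> x; rewrite indicE; case: (boolP (x \in _)) => [/set_mem xM|/negP xM].
  by rewrite mulr1; apply: hC; exists x.
rewrite mulr0 eK ?normr0// => Kx; apply: xM; rewrite inE; exact: KM.
Qed.

Lemma test_dv (v : plane R) eta (K : set (plane R)) : compact K -> (forall x, ~ K x -> eta x = 0) ->
  forall x, ~ K x -> 'D_v eta x = 0.
Proof.
move=> cK eK x Kx.
rewrite (@near_eq_derive _ _ _ _ (cst 0)); first exact: derive_cst.
have oK : open (~` K) by apply: closed_openC; apply: compact_closed cK; exact: norm_hausdorff.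
by have := open_nbhs_nbhs (conj oK Kx); apply: filterS => y /eK ->.
Qed.

Lemma test_d1 eta : test_fun eta -> test_fun (d1 eta).
Proof.
move=> [sm [K cK eK]]; split; first by move=> n; have [_ []] := sm n.+1.
by exists K => // x Kx; apply: (@test_dv _ eta K).
Qed.

Lemma test_d2 eta : test_fun eta -> test_fun (d2 eta).
Proof.
move=> [sm [K cK eK]]; split; first by move=> n; have [_ []] := sm n.+1.
by exists K => // x Kx; apply: (@test_dv _ eta K).
Qed.

Lemma test_pderiv i j eta : test_fun eta -> test_fun (pderiv i j eta).
Proof.
move=> te; rewrite /pderiv; elim: i => [|i IH] /=; last exact: test_d1.
by elim: j => [//|j IH] /=; exact: test_d2.
Qed.

Lemma weak_deriv_lin i j (c c' : R) f g f' g' : SI f -> SI g -> SI f' -> SI g' ->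
  weak_deriv i j f f' -> weak_deriv i j g g' ->
  weak_deriv i j (fun x => c * f x + c' * g x) (fun x => c * f' x + c' * g' x).
Proof.
move=> sf sg sf' sg' wf wg eta te.
have sp := test_SI (test_pderiv i j te); have se := test_SI te.
have lin (u v w : plane R -> R) : SI u -> SI v -> SI w ->
   \int[mu]_x ((c * u x + c' * v x) * w x) = c * \int[mu]_x (u x * w x) + c' * \int[mu]_x (v x * w x).
  move=> su sv sw; rewrite -!RiZ; [|exact: SI_M|exact: SI_M].
  rewrite -RiD; [|by apply: IntZ; exact: SI_M|by apply: IntZ; exact: SI_M].
  by congr Rintegral; apply/funext => x; ring.
by rewrite !lin// wf// wg//; ring.
Qed.

(** One square integrable weak derivative makes the choice behind [wD] meaningful, and uniqueness
    almost everywhere transfers square integrability to the chosen version. *)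
Lemma wD_spec i j f g : SI g -> weak_deriv i j f g ->
  [/\ weak_deriv i j f (wD i j f), eqae g (wD i j f) & SI (wD i j f)].
Proof.
move=> sg fg; have lg := SI_L1loc sg.
have [l w] : L1loc (wD i j f) /\ weak_deriv i j f (wD i j f).
  rewrite /wD; apply: (@xgetPex _ (cst 0) [set g | L1loc g /\ weak_deriv i j f g]).
  by exists g.
have e := weak_unique lg l fg w.
split => //; apply: SI_ae e => //; by case: l.
Qed.

Lemma Hs_wD n i j f : Hs n f -> (i + j <= n)%N ->
  SI (wD i j f) /\ weak_deriv i j f (wD i j f).
Proof.
move=> [_ h] ij; have [g /L2_SI sg fg] := h _ _ ij.
by have [] := wD_spec sg fg.
Qed.

Lemma wD_lin i j (c c' : R) f g n : Hs n f -> Hs n g -> (i + j <= n)%N ->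
  [/\ eqae (fun x => c * wD i j f x + c' * wD i j g x) (wD i j (fun x => c * f x + c' * g x)),
   SI (wD i j (fun x => c * f x + c' * g x)) &
   weak_deriv i j (fun x => c * f x + c' * g x) (wD i j (fun x => c * f x + c' * g x))].
Proof.
move=> hf hg ij; have [sf' wf] := Hs_wD hf ij; have [sg' wg] := Hs_wD hg ij.
have sf := L2_SI hf.1; have sg := L2_SI hg.1.
have w := weak_deriv_lin c c' sf sg sf' sg' wf wg.
by have [] := wD_spec (SI_D (SI_Z c sf') (SI_Z c' sg')) w.
Qed.

Lemma Lnorm2_SI f : SI f ->
  ('N[mu]_2%:E[EFin \o f] = ((\int[mu]_x (f x ^+ 2)) `^ 2^-1)%:E)%E.
Proof.
move=> [mf fi]; rewrite unlock /=.
have -> : (fun x => (`|(f x)%:E| `^ 2)%E) = (fun x => (f x ^+ 2)%:E).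
  apply/funext => x; rewrite abse_EFin poweR_EFin.
  by rewrite powR_mulrn// real_normK// num_real.
rewrite /Rintegral -poweR_EFin fineK//; exact: integrable_fin_num fi.
Qed.

Lemma SI_L2 f : SI f -> L2 f.
Proof.
move=> sf; rewrite /L2 inE; apply/andP; split; rewrite inE /=; first by case: sf.
by rewrite /finite_norm Lnorm2_SI// ltry.
Qed.

Lemma int_sqr_ge0 f : 0 <= \int[mu]_x (f x ^+ 2).
Proof. by apply: Rintegral_ge0 => x _; exact: sqr_ge0. Qed.

Lemma L2n_sqr f : SI f -> L2n f ^+ 2 = \int[mu]_x (f x ^+ 2).
Proof.
move=> sf; rewrite /L2n Lnorm2_SI//= -powR_mulrn ?powR_ge0// -powRrM.
by rewrite mulVf// powRr1// int_sqr_ge0.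
Qed.

Lemma Hs_lin (c c' : R) f g n : Hs n f -> Hs n g -> Hs n (fun x => c * f x + c' * g x).
Proof.
move=> hf hg; have sf := L2_SI hf.1; have sg := L2_SI hg.1.
split; first by apply: SI_L2; apply: SI_D; exact: SI_Z.
move=> i j ij; have [_ s w] := wD_lin c c' hf hg ij.
by exists (wD i j (fun x => c * f x + c' * g x)) => //; exact: SI_L2.
Qed.

Lemma Hs_le n (l : nat) f : (l <= n)%N -> Hs n f -> Hs l f.
Proof. by move=> ln [hf h]; split => // i j ij; apply: h; exact: leq_trans ln. Qed.

Lemma Hs_bounded f : Hs 2 f -> exists C, {ae mu, forall x, `|f x| <= C}.
Proof.
move=> hf; have sf := L2_SI hf.1.
have [s1 w1] := @Hs_wD 2 1 0 f hf isT.
have [s2 w2] := @Hs_wD 2 0 1 f hf isT.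
have [s12 w12] := @Hs_wD 2 1 1 f hf isT.
apply: (sobolev_bounded sf s1 s2 s12 (weak_wk1 w1) (weak_wk2 w2)).
exact: weak_wk12 w1 w12.
Qed.

Lemma wk2_ibp f g h k : SI f -> SI g -> SI h -> SI k -> wk2 f g -> wk2 h k ->
  \int[mu]_x (g x * h x) = - \int[mu]_x (f x * k x).
Proof.
move=> sf sg sh_ sk fg hk.
rewrite -(Ri_swp (SI_M sg sh_)) -(Ri_swp (SI_M sf sk)).
exact: (wk1_ibp (SI_swp sf) (SI_swp sg) (SI_swp sh_) (SI_swp sk)
  (wk2_swp sf sg fg) (wk2_swp sh_ sk hk)).
Qed.

(** The pure second derivatives of f are weak derivatives of its first ones, so integration by parts
    applies in each direction. *)
Lemma green f g : Hs 2 f -> Hs 2 g ->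
  \int[mu]_x ((wD 2 0 f x + wD 0 2 f x) * g x) =
  - \int[mu]_x (wD 1 0 f x * wD 1 0 g x + wD 0 1 f x * wD 0 1 g x).
Proof.
move=> hf hg; have sg := L2_SI hg.1.
have [f1 w1] := @Hs_wD 2 1 0 f hf isT.
have [f2 w2] := @Hs_wD 2 0 1 f hf isT.
have [f11 w11] := @Hs_wD 2 2 0 f hf isT.
have [f22 w22] := @Hs_wD 2 0 2 f hf isT.
have [g1 v1] := @Hs_wD 2 1 0 g hg isT.
have [g2 v2] := @Hs_wD 2 0 1 g hg isT.
have -> : (fun x => (wD 2 0 f x + wD 0 2 f x) * g x) =
  (fun x => wD 2 0 f x * g x + wD 0 2 f x * g x) by apply/funext => x; rewrite mulrDl.
rewrite !RiD; [|exact: SI_M..].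
have w1' := weak_wk11 w1 w11; have v1' := weak_wk1 v1.
have w2' := weak_wk22 w2 w22; have v2' := weak_wk2 v2.
by rewrite opprD; congr (_ + _); [exact: wk1_ibp|exact: wk2_ibp].
Qed.

End WeakDerivatives.

(** * Expansion of the nonlinear energy *)

Section Taylor.
Context {R : realType}.

(** The mean value theorem on the segment between r and r + d, for either sign of d. Each use gains
    one order in d, without the factor 1/(n+1) of the integral form. *)
Lemma MVT_bound (F dF : R -> R) (L : R) (n : nat) (r d : R) :
  (forall s, is_derive s (1 : R) F (dF s)) -> F r = 0 ->
  (forall s, `|s - r| <= `|d| -> `|dF s| <= L * `|s - r| ^+ n) ->
  0 <= L -> `|F (r + d)| <= L * `|d| ^+ n.+1.
Proof.
move=> dFP F0 hL L0.
have cF s : {for s, continuous F} by apply: derivable1_cont; case: (dFP s).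
have key u v : u <= v -> exists2 z, u <= z <= v & F v - F u = dF z * (v - u).
  rewrite le_eqVlt => /predU1P[->|uv].
    by exists v; rewrite ?lexx// !subrr mulr0.
  have [z] := @MVT R F dF u v uv (fun x _ => dFP x) (continuous_subspaceT cF).
  by rewrite in_itv /= => /andP[z1 z2] e; exists z => //; rewrite !ltW.
have [z zr e] : exists2 z, `|z - r| <= `|d| & F (r + d) = dF z * d.
  have [d0|d0] := leP 0 d.
    have [|z /andP[z1 z2] e] := key r (r + d); first by rewrite lerDl.
    exists z; last by move: e; rewrite F0 subr0 => ->; congr (_ * _); ring.
    by rewrite (ger0_norm d0) ger0_norm ?subr_ge0//; lra.
  have [|z /andP[z1 z2] e] := key (r + d) r; first by lra.
  exists z; last by move: e; rewrite F0 sub0r => /(congr1 -%R); rewrite opprK => ->; ring.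
  by rewrite (ltr0_norm d0) ler0_norm ?subr_le0//; lra.
rewrite e normrM exprSr mulrA ler_wpM2r//.
apply: le_trans (hL _ zr) _; rewrite ler_wpM2l//.
by rewrite lerXn2r ?nnegrE.
Qed.

Variables (beta B : R -> R).
Hypothesis sb : smooth1 beta.
Hypothesis hB : is_primitive0 beta B.

Let b1 := derive1 beta.
Let b2 := derive1 b1.

Let sb0 x : derivable beta x 1.
Proof. by have := @sb 0%N x; rewrite derive1n0. Qed.
Let sb1 x : derivable b1 x 1.
Proof. by have := @sb 1%N x; rewrite derive1n1. Qed.
Let sb2 x : derivable b2 x 1.
Proof. by have := @sb 2%N x; rewrite derive1nS derive1n1. Qed.

Lemma is_derive_beta (s : R) : is_derive s (1 : R) beta (b1 s).
Proof. by rewrite /b1 derive1E; apply: derivableP; exact: sb0. Qed.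

Lemma is_derive_beta1 (s : R) : is_derive s (1 : R) b1 (b2 s).
Proof. by rewrite /b2 derive1E; apply: derivableP; exact: sb1. Qed.

Lemma cont_beta : continuous beta.
Proof. by move=> x; apply: derivable1_cont; exact: sb0. Qed.

Lemma cont_beta1 : continuous b1.
Proof. by move=> x; apply: derivable1_cont; exact: sb1. Qed.

Lemma cont_beta2 : continuous b2.
Proof. by move=> x; apply: derivable1_cont; exact: sb2. Qed.

Lemma cont_B : continuous B.
Proof. by move=> x; apply: derivable1_cont; case: hB => _ /(_ x) []. Qed.

Lemma cont_bounded (F : R -> R) (M : R) : continuous F ->
  exists2 C, 0 <= C & forall s, `|s| <= M -> `|F s| <= C.
Proof.
move=> cF; have [M0|M0] := leP 0 M; last first.
  exists 0 => // s sM; have := le_lt_trans sM M0.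
  by rewrite normr_lt0.
have c : {within `[- M, M], continuous (Num.norm \o F)}.
  by apply: continuous_subspaceT => x; apply: continuous_comp; [exact: cF|exact: norm_continuous].
have [|z zi hz] := EVT_max _ c; first by rewrite lerNl (le_trans _ M0)// oppr_le0.
by exists `|F z| => // s sM; apply: hz; rewrite in_itv/= -ler_norml.
Qed.

(** Three uses of [MVT_bound], starting from a bound L of [b2] on [-2M, 2M], which contains the
    whole segment between r and r + d. *)
Lemma taylor3 (M : R) : exists2 L, 0 <= L & forall r d : R, `|r| <= M -> `|d| <= M ->
  `|B (r + d) - B r - beta r * d - 2^-1 * b1 r * d ^+ 2| <= L * `|d| ^+ 3.
Proof.
have [L L0 hL] := cont_bounded (M + M) cont_beta2.
exists L => // r d rM dM.
have seg s : `|s - r| <= `|d| -> `|s| <= M + M.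
  move=> h; rewrite -(subrK r s); apply: le_trans (ler_normD _ _) _.
  by rewrite lerD//; exact: le_trans dM.
have h1 s : `|s - r| <= `|d| -> `|b1 s - b1 r| <= L * `|s - r| ^+ 1.
  move=> sr; have rs : r + (s - r) = s by rewrite addrC subrK.
  have := @MVT_bound (fun x => b1 x - b1 r) b2 L 0 r (s - r).
  rewrite rs; apply => //.
  - move=> x; have := is_deriveB (is_derive_beta1 x) (is_derive_cst (b1 r) x (1 : R)).
    by rewrite subr0.
  - by rewrite subrr.
  - by move=> x xs; rewrite expr0 mulr1; apply: hL; apply: seg; exact: le_trans sr.
have h2 s : `|s - r| <= `|d| -> `|beta s - beta r - b1 r * (s - r)| <= L * `|s - r| ^+ 2.
  move=> sr; have rs : r + (s - r) = s by rewrite addrC subrK.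
  have := @MVT_bound (fun x => beta x - beta r - b1 r * (x - r)) (fun x => b1 x - b1 r) L 1 r (s - r).
  rewrite rs; apply => //.
  - move=> x.
    have d1 := is_deriveB (is_derive_beta x) (is_derive_cst (beta r) x (1 : R)).
    have d2 := is_deriveB (is_derive_id x (1 : R)) (is_derive_cst r x (1 : R)).
    have := is_deriveB d1 (is_deriveZ (b1 r) d2).
    by rewrite !subr0 /GRing.scale /= mulr1.
  - by rewrite !subrr mulr0 subr0.
  - by move=> x xs; apply: h1; exact: le_trans sr.
have := @MVT_bound (fun x => B x - B r - beta r * (x - r) - 2^-1 * b1 r * (x - r) ^+ 2)
  (fun x => beta x - beta r - b1 r * (x - r)) L 2 r d.
have rd : r + d - r = d by rewrite addrC addKr.
rewrite rd; apply => //.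
- move=> x; have [_ dB] := hB.
  have d1 := is_deriveB (dB x) (is_derive_cst (B r) x (1 : R)).
  have d2 := is_deriveB (is_derive_id x (1 : R)) (is_derive_cst r x (1 : R)).
  have d3 := is_deriveB d1 (is_deriveZ (beta r) d2).
  have d4 := is_deriveZ (2^-1 * b1 r) (is_deriveX 2 d2).
  move: (is_deriveB d3 d4); set D := (X in is_derive _ _ _ X -> _).
  have -> : D = beta x - beta r - b1 r * (x - r).
    have e : (id - cst r) x = x - r by [].
    by rewrite /D /GRing.scale /= e; field.
  exact.
- by rewrite !subrr mulr0 expr0n /= mulr0 !subr0.
Qed.

(* Along u = c (phi + t f) with c^2 = 1/(1 + kap t^2), with q0 = |phi|^2,
   p = phi . f, q1 = |f|^2. *)
Lemma taylor_curve (M kap : R) : 0 <= M -> 0 <= kap -> exists2 C, 0 <= C &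
  forall t q0 q1 p c2 : R, 0 <= t <= 1 -> 0 <= q0 <= M -> 0 <= q1 <= M ->
  p ^+ 2 <= q0 * q1 -> c2 * (1 + kap * t ^+ 2) = 1 ->
  B (c2 * (q0 + 2 * t * p + t ^+ 2 * q1)) <=
    B q0 + beta q0 * (c2 * (2 * t * p + t ^+ 2 * q1 - kap * t ^+ 2 * q0))
    + 2 * c2 * t ^+ 2 * (b1 q0 * p ^+ 2) + C * t ^+ 3 * (q0 + q1).
Proof.
move=> M0 k0.
(* With S = q0 + q1, the increment of |u|^2 is at most t K1 S: S comes from 2 p, and (1 + kap) S
   from q1 - kap q0. *)
pose K1 := 2 + kap.
have [L L0 hL] := taylor3 (M + K1 * (M + M)).
have [L1 L10 hL1] := cont_bounded M cont_beta1.
(* The three terms of [braE], estimated by |p| <= S / 2 and |e| <= (1 + kap) S. *)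
pose K2 := 2^-1 * kap + (1 + kap) + 2^-1 * (1 + kap) ^+ 2.
exists (L * K1 ^+ 3 * (M + M) ^+ 2 + L1 * K2 * (M + M)).
  have K20 : 0 <= K2 by rewrite !addr_ge0// ?mulr_ge0// ?exprn_ge0// addr_ge0.
  by rewrite addr_ge0// !mulr_ge0// ?exprn_ge0// ?addr_ge0.
move=> t q0 q1 p c2 /andP[t0 t1] /andP[q00 q0M] /andP[q10 q1M] hp hc.
pose S := q0 + q1.
have S0 : 0 <= S by rewrite addr_ge0.
have SM : S <= M + M by rewrite lerD.
have kt0 : 0 <= kap * t ^+ 2 by rewrite mulr_ge0// sqr_ge0.
have c20 : 0 < c2.
  have : 0 < c2 * (1 + kap * t ^+ 2) by rewrite hc.
  by rewrite pmulr_lgt0// ltr_wpDr.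
have c21 : c2 <= 1 by rewrite -hc ler_peMr ?(ltW c20)// lerDl.
have p2 : `|p| <= 2^-1 * S.
  rewrite -(@ler_pXn2r _ 2)// ?nnegrE ?mulr_ge0// real_normK ?num_real//.
  apply: le_trans hp _; rewrite -subr_ge0.
  have -> : (2^-1 * S) ^+ 2 - q0 * q1 = (2^-1 * (q0 - q1)) ^+ 2 by rewrite /S; field.
  exact: sqr_ge0.
pose e := q1 - kap * q0.
have e1 : `|e| <= (1 + kap) * S.
  apply: le_trans (ler_normB _ _) _; rewrite !ger0_norm ?mulr_ge0//.
  rewrite /S -subr_ge0.
  have -> : (1 + kap) * (q0 + q1) - (q1 + kap * q0) = q0 + kap * q1 by ring.
  by rewrite addr_ge0// mulr_ge0.
pose w := 2 * p + t * e.
have w1 : `|w| <= K1 * S.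
  apply: le_trans (ler_normD _ _) _.
  have -> : K1 * S = S + (1 + kap) * S by rewrite /K1; ring.
  rewrite !normrM (ger0_norm t0) ger0_norm//; apply: lerD.
    by rewrite -ler_pdivlMl.
  by apply: le_trans e1; rewrite ler_piMl.
(* The increment |u|^2 - |phi|^2, in which q0 has been rewritten as c2 (1 + kap t^2) q0 to make a
   factor t appear. *)
pose d := c2 * (t * w).
have dE : c2 * (q0 + 2 * t * p + t ^+ 2 * q1) = q0 + d.
  have -> : q0 + d = q0 * (c2 * (1 + kap * t ^+ 2)) + d by rewrite hc mulr1.
  by rewrite /d /w /e; ring.
have d1 : `|d| <= t * (K1 * S).
  rewrite /d normrM gtr0_norm//.
  apply: (@le_trans _ _ `|t * w|); first by rewrite ler_piMl.
  by rewrite normrM (ger0_norm t0) ler_wpM2l.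
have K10 : 0 <= K1 by rewrite addr_ge0.
have KS0 : 0 <= K1 * S by rewrite mulr_ge0.
have dM : `|d| <= M + K1 * (M + M).
  apply: le_trans d1 _; apply: (@le_trans _ _ (K1 * S)); first by rewrite ler_piMl.
  by apply: (@le_trans _ _ (K1 * (M + M))); rewrite ?ler_wpM2l// lerDr.
have q0M' : `|q0| <= M + K1 * (M + M).
  by rewrite ger0_norm// (le_trans q0M)// lerDl mulr_ge0// addr_ge0.
have := hL q0 d q0M' dM; rewrite -dE => /ler_normlW h.
have -> : c2 * (2 * t * p + t ^+ 2 * q1 - kap * t ^+ 2 * q0) = d by rewrite /d /w /e; ring.
(* Two of the three factors S are absorbed in the bound M + M; the remaining one keeps the remainder
   integrable. *)
have d3 : L * `|d| ^+ 3 <= L * K1 ^+ 3 * (M + M) ^+ 2 * (t ^+ 3 * S).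
  have -> : L * K1 ^+ 3 * (M + M) ^+ 2 * (t ^+ 3 * S) = L * ((t * K1) ^+ 3 * ((M + M) ^+ 2 * S)) by ring.
  rewrite ler_wpM2l//; apply: (@le_trans _ _ ((t * (K1 * S)) ^+ 3)).
    by rewrite lerXn2r ?nnegrE ?mulr_ge0.
  have -> : (t * (K1 * S)) ^+ 3 = (t * K1) ^+ 3 * (S ^+ 2 * S) by ring.
  rewrite ler_wpM2l ?exprn_ge0 ?mulr_ge0// ler_wpM2r// lerXn2r ?nnegrE ?addr_ge0//.
(* Up to the factor c2 t^2 b1(q0), the gap between the quadratic Taylor term and its leading part in
   p^2. It is of order t because w = 2 p + O(t) and c2 = 1 + O(t^2). *)
pose bra := 2^-1 * c2 * w ^+ 2 - 2 * p ^+ 2.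
have braE : bra = t * (c2 * (- (2 * kap * t * p ^+ 2) + 2 * (p * e) + 2^-1 * (t * e ^+ 2))).
  have : c2 - 1 = - (kap * t ^+ 2 * c2).
    by rewrite -[X in _ - X]hc; ring.
  have -> : bra = 2 * p ^+ 2 * (c2 - 1) + 2^-1 * c2 * (4 * p * t * e + t ^+ 2 * e ^+ 2).
    by rewrite /bra /w; field.
  by move=> ->; field.
have p22 : p ^+ 2 <= (2^-1 * S) ^+ 2.
  by rewrite -(real_normK (num_real p)) lerXn2r ?nnegrE ?mulr_ge0.
have e22 : e ^+ 2 <= ((1 + kap) * S) ^+ 2.
  by rewrite -(real_normK (num_real e)) lerXn2r ?nnegrE ?mulr_ge0// addr_ge0.
have bra1 : `|bra| <= t * (S ^+ 2 * K2).
  rewrite braE normrM (ger0_norm t0) ler_wpM2l// normrM gtr0_norm//.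
  apply: (@le_trans _ _ `|- (2 * kap * t * p ^+ 2) + 2 * (p * e) + 2^-1 * (t * e ^+ 2)|).
    by rewrite ler_piMl.
  apply: le_trans (ler_normD _ _) _.
  apply: (@le_trans _ _ (2 * kap * (2^-1 * S) ^+ 2 + 2 * ((2^-1 * S) * ((1 + kap) * S)) + 2^-1 * ((1 + kap) * S) ^+ 2)).
    apply: lerD; last first.
      have te0 : 0 <= t * e ^+ 2 by rewrite mulr_ge0// sqr_ge0.
      have te2 : 0 <= 2^-1 * (t * e ^+ 2) by rewrite mulr_ge0.
      rewrite (ger0_norm te2) ler_wpM2l//.
      by apply: le_trans e22; rewrite ler_piMl// sqr_ge0.
    apply: le_trans (ler_normD _ _) _; apply: lerD.
      have tp2 : 0 <= 2 * kap * t * p ^+ 2 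
        by move: (p ^+ 2) (sqr_ge0 p) => p0 p00; rewrite !mulr_ge0.
      rewrite normrN (ger0_norm tp2).
      apply: (@le_trans _ _ (2 * kap * p ^+ 2)).
        by rewrite -!mulrA ler_wpM2l// ler_wpM2l// ler_piMl// sqr_ge0.
      by rewrite ler_wpM2l// mulr_ge0.
    by rewrite !normrM ger0_norm// ler_wpM2l// ler_pM.
  by rewrite le_eqVlt; apply/orP; left; apply/eqP; rewrite /K2; field.
have bq : 2^-1 * b1 q0 * d ^+ 2 - 2 * c2 * t ^+ 2 * (b1 q0 * p ^+ 2) <=
    L1 * K2 * (M + M) * (t ^+ 3 * S).
  have -> : 2^-1 * b1 q0 * d ^+ 2 - 2 * c2 * t ^+ 2 * (b1 q0 * p ^+ 2) =
    (c2 * t ^+ 2) * (b1 q0 * bra) by rewrite /bra /d; field.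
  have K20 : 0 <= K2 by rewrite !addr_ge0// ?mulr_ge0// ?exprn_ge0// addr_ge0.
  apply: (@le_trans _ _ (t ^+ 2 * (L1 * (t * (S ^+ 2 * K2))))).
    apply: le_trans (ler_norm _) _.
    rewrite normrM ger0_norm ?mulr_ge0 ?sqr_ge0 ?(ltW c20)//.
    apply: ler_pM => //.
    - by rewrite mulr_ge0 ?sqr_ge0// ltW.
    - by rewrite ler_piMl// sqr_ge0.
    - rewrite normrM; apply: ler_pM => //; apply: hL1; by rewrite ger0_norm.
  have -> : t ^+ 2 * (L1 * (t * (S ^+ 2 * K2))) = L1 * K2 * (t ^+ 3 * S) * S by ring.
  have -> : L1 * K2 * (M + M) * (t ^+ 3 * S) = L1 * K2 * (t ^+ 3 * S) * (M + M) by ring.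
  by rewrite ler_wpM2l// !mulr_ge0// exprn_ge0.
rewrite -/S; move: h d3 bq.
move: (B (c2 * _)) (B q0) (beta q0 * d) (2^-1 * b1 q0 * d ^+ 2) (2 * c2 * t ^+ 2 * (b1 q0 * p ^+ 2)) (L * `|d| ^+ 3) => A1 A2 A3 A4 A5 A6.
have -> : (L * K1 ^+ 3 * (M + M) ^+ 2 + L1 * K2 * (M + M)) * t ^+ 3 * S =
  L * K1 ^+ 3 * (M + M) ^+ 2 * (t ^+ 3 * S) + L1 * K2 * (M + M) * (t ^+ 3 * S) by ring.
move: (L * K1 ^+ 3 * (M + M) ^+ 2 * (t ^+ 3 * S)) (L1 * K2 * (M + M) * (t ^+ 3 * S)) => A7 A8.
clear; lra.
Qed.

End Taylor.

(** * The linearized operator as a quadratic form *)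

Section InnerProduct.
Context {R : realType}.
Implicit Types (f g h k W : plane R -> R) (c : R).
Notation mu := (@area R).
Notation PT := ((measurableTypeR R * measurableTypeR R)%type).

Definition ip f g : R := \int[mu]_x (f x * g x).

Lemma ipC f g : ip f g = ip g f.
Proof. by congr Rintegral; apply/funext => x; rewrite mulrC. Qed.

Lemma ipDl f g h : SI f -> SI g -> SI h -> ip (fun x => f x + g x) h = ip f h + ip g h.
Proof.
move=> sf sg sh; rewrite /ip -RiD; [|exact: SI_M..].
by congr Rintegral; apply/funext => x; rewrite mulrDl.
Qed.

Lemma ipZl c f h : SI f -> SI h -> ip (fun x => c * f x) h = c * ip f h.
Proof.
move=> sf sh; rewrite /ip -RiZ; last exact: SI_M.
by congr Rintegral; apply/funext => x; rewrite mulrA.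
Qed.

Lemma ip_ael f g h : SI f -> SI g -> SI h -> eqae f g -> ip f h = ip g h.
Proof.
move=> sf sg sh fg; apply: Ri_ae.
- exact: Int_meas (SI_M sf sh).
- exact: Int_meas (SI_M sg sh).
- by apply: filterS fg => x /= ->.
Qed.

Lemma ip_ge0 f : 0 <= ip f f.
Proof. by apply: Rintegral_ge0 => x _; rewrite -expr2 sqr_ge0. Qed.

Lemma ip_eq0 f : SI f -> ip f f = 0 -> eqae f 0.
Proof.
move=> sf f0; have fi := SI_M sf sf.
have m : measurable_fun setT (EFin \o (fun x => f x * f x) : PT -> \bar R).
  by apply/measurable_EFinP; exact: Int_meas fi.
have : (\int[mu]_(x in setT) `|(EFin \o (fun x => f x * f x)%R) x| = 0)%E.
  rewrite -[RHS]/(0%:E) -f0 /ip /Rintegral fineK; last exact: integrable_fin_num fi.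
  by apply: eq_integral => x _; rewrite /= ger0_norm// -expr2 sqr_ge0.
move/(ae_eq_integral_abs mu measurableT m); apply: filterS => x /(_ I) /= [].
by move/eqP; rewrite mulf_eq0 orbb => /eqP.
Qed.

Definition ae_bounded h := measurable_fun setT (h : PT -> R) /\
  exists2 C, 0 <= C & {ae mu, forall x, `|h x| <= C}.

Lemma ae_bounded_cst c : ae_bounded (fun=> c).
Proof. by split => //; exists `|c| => //; apply: aeW. Qed.

Lemma ae_bounded_D f g : ae_bounded f -> ae_bounded g -> ae_bounded (fun x => f x + g x).
Proof.
move=> [mf [C C0 hC]] [mg [D D0 hD]]; split; first exact: measurable_funD.
exists (C + D); first exact: addr_ge0.
by apply: filterS2 hC hD => x h1 h2; apply: le_trans (ler_normD _ _) _; rewrite lerD.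
Qed.

Lemma ae_bounded_M f g : ae_bounded f -> ae_bounded g -> ae_bounded (fun x => f x * g x).
Proof.
move=> [mf [C C0 hC]] [mg [D D0 hD]]; split; first exact: measurable_funM.
exists (C * D); first exact: mulr_ge0.
by apply: filterS2 hC hD => x h1 h2; rewrite normrM ler_pM.
Qed.

Lemma ae_bounded_comp (F : R -> R) h : continuous F -> ae_bounded h -> ae_bounded (fun x => F (h x)).
Proof.
move=> cF [mh [C C0 hC]]; split.
  by apply: measurableT_comp mh; exact: continuous_measurable_fun.
have [D D0 hD] := cont_bounded C cF; exists D => //.
by apply: filterS hC => x; exact: hD.
Qed.

Lemma ae_bounded_Hs f : Hs 2 f -> ae_bounded f.
Proof.
move=> hf; split; first by case: (L2_SI hf.1).
have [C hC] := Hs_bounded hf; exists (Num.max 0 C); first by rewrite le_max lexx.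
by apply: filterS hC => x h; rewrite le_max h orbT.
Qed.

Lemma Int_ae_bounded h F : ae_bounded h -> Int mu F -> Int mu (fun x => h x * F x).
Proof.
move=> [mh [C C0 hC]] Fi.
apply: (@Int_le _ _ _ mu _ (fun x => C * `|F x|)).
- by apply: measurable_funM => //; exact: Int_meas Fi.
- by apply: IntZ; exact: Int_abs.
- by apply: filterS hC => x h1; rewrite normrM ler_wpM2r.
Qed.

Lemma SI_ae_bounded h f : ae_bounded h -> SI f -> SI (fun x => h x * f x).
Proof.
move=> bh [mf fi]; have [mh _] := bh; split; first exact: measurable_funM.
have -> : (fun x => (h x * f x) ^+ 2) = (fun x => (h x * h x) * f x ^+ 2).
  by apply/funext => x; ring.
by apply: Int_ae_bounded => //; exact: ae_bounded_M.
Qed.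

Definition dirichlet f g : R :=
  ip (wD 1 0 f) (wD 1 0 g) + ip (wD 0 1 f) (wD 0 1 g).

Lemma dirichletC f g : dirichlet f g = dirichlet g f.
Proof. exact: (f_equal2 +%R (ipC _ _) (ipC _ _)). Qed.

Lemma dirichlet_green f F G k : Hs 2 f -> Hs 2 k -> SI F -> SI G ->
  eqae (fun x => - (wD 2 0 f x + wD 0 2 f x) + F x) G ->
  dirichlet f k + ip F k = ip G k.
Proof.
move=> hf hk sF sG e.
have sk := L2_SI hk.1.
have [f11 w11] := @Hs_wD _ 2 2 0 f hf isT.
have [f22 w22] := @Hs_wD _ 2 0 2 f hf isT.
have [f1 w1] := @Hs_wD _ 2 1 0 f hf isT.
have [f2 w2] := @Hs_wD _ 2 0 1 f hf isT.
have [k1 v1] := @Hs_wD _ 2 1 0 k hk isT.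
have [k2 v2] := @Hs_wD _ 2 0 1 k hk isT.
have sl := SI_D f11 f22.
have sn := SI_Z (-1) sl.
have e' : eqae (fun x => -1 * (wD 2 0 f x + wD 0 2 f x) + F x) G.
  by apply: filterS e => x <-; rewrite mulN1r.
rewrite -(ip_ael (SI_D sn sF) sG sk e') ipDl// ipZl// {2}/ip green// mulN1r opprK.
by congr (_ + _); rewrite RiD//; exact: SI_M.
Qed.

End InnerProduct.

(** * The Hessian in weak form, on the wave and on the eigenvector *)

Section SecondVariation.
Context {R : realType}.
Notation mu := (@area R).
Implicit Types h k : plane R -> R.
Variables (W b phi0 phi1 : plane R -> R).
Hypotheses (bW : ae_bounded W) (bb : ae_bounded b) (h0 : Hs 2 phi0) (h1 : Hs 2 phi1).

Let s0 : SI phi0 := L2_SI h0.1.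
Let s1 : SI phi1 := L2_SI h1.1.

(** The form of - Delta + W, where W will be w + V + beta(|phi|^2): the part of the Hessian that
    acts on each component separately. By the stationary equation it annihilates both components of
    phi. *)
Definition qf h k : R := dirichlet h k + ip (fun x => W x * h x) k.

Lemma qfC h k : qf h k = qf k h.
Proof.
rewrite /qf dirichletC; congr (_ + _); congr Rintegral; apply/funext => x; ring.
Qed.

Hypothesis stat0 :
  eqae (fun x => - (wD 2 0 phi0 x + wD 0 2 phi0 x) + W x * phi0 x) 0.
Hypothesis stat1 :
  eqae (fun x => - (wD 2 0 phi1 x + wD 0 2 phi1 x) + W x * phi1 x) 0.

Lemma SI_zero : SI (0 : plane R -> R).
Proof. by have := SI_Z 0 s0; congr SI; apply/funext => x; rewrite mul0r. Qed.

Lemma ip0l h : ip (0 : plane R -> R) h = 0.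
Proof. by rewrite /ip; under eq_Rintegral do rewrite mul0r; rewrite Rintegral_cst// mul0r. Qed.

Lemma qf_stat0 k : Hs 2 k -> qf phi0 k = 0.
Proof.
by move=> hk; rewrite /qf (dirichlet_green h0 hk (SI_ae_bounded bW s0) SI_zero stat0) ip0l.
Qed.

Lemma qf_stat1 k : Hs 2 k -> qf phi1 k = 0.
Proof.
by move=> hk; rewrite /qf (dirichlet_green h1 hk (SI_ae_bounded bW s1) SI_zero stat1) ip0l.
Qed.

(** With b = 2 beta'(|phi|^2), multiplication by the components of phi turns this into the part of
    the Hessian that mixes the components. *)
Definition coupling h k : plane R -> R :=
  fun x => b x * (phi0 x * h x + phi1 x * k x).

Lemma SI_coupling h k phi : SI h -> SI k -> ae_bounded phi -> SI (fun x => phi x * coupling h k x).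
Proof.
move=> sh sk bp; apply: SI_ae_bounded => //; apply: SI_ae_bounded => //.
by apply: SI_D; apply: SI_ae_bounded => //; exact: ae_bounded_Hs.
Qed.

Lemma qf_eq h p G k : Hs 2 h -> Hs 2 k -> SI p -> SI G ->
  eqae (fun x => - (wD 2 0 h x + wD 0 2 h x) + (W x * h x + p x)) G ->
  qf h k + ip p k = ip G k.
Proof.
move=> hh hk sp sG e; have sh := L2_SI hh.1.
rewrite -(dirichlet_green hh hk (SI_D (SI_ae_bounded bW sh) sp) sG e) /qf ipDl ?addrA//.
- exact: SI_ae_bounded.
- exact: L2_SI hk.1.
Qed.

Variables (f0 f1 g0 g1 : plane R -> R) (lam : R).
Hypotheses (hf0 : Hs 2 f0) (hf1 : Hs 2 f1) (hg0 : Hs 2 g0) (hg1 : Hs 2 g1).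

Let sf0 : SI f0 := L2_SI hf0.1.
Let sf1 : SI f1 := L2_SI hf1.1.
Let sg0 : SI g0 := L2_SI hg0.1.
Let sg1 : SI g1 := L2_SI hg1.1.

(* The components of H g = lam J^-1 f, for the Hessian H = - J L. *)
Lemma mode_orthogonal : lam != 0 ->
  eqae (fun x => - (wD 2 0 g0 x + wD 0 2 g0 x) + (W x * g0 x + phi0 x * coupling g0 g1 x))
       (fun x => - lam * f1 x) ->
  eqae (fun x => - (wD 2 0 g1 x + wD 0 2 g1 x) + (W x * g1 x + phi1 x * coupling g0 g1 x))
       (fun x => lam * f0 x) ->
  ip phi0 f0 + ip phi1 f1 = 0.
Proof.
move=> l0 e0 e1.
have b0 := ae_bounded_Hs h0; have b1 := ae_bounded_Hs h1.
have E0 := qf_eq hg0 h1 (SI_coupling sg0 sg1 b0) (SI_Z (- lam) sf1) e0.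
have E1 := qf_eq hg1 h0 (SI_coupling sg0 sg1 b1) (SI_Z lam sf0) e1.
(* J phi = (phi1, - phi0) is pointwise orthogonal to phi, so the coupling terms cancel between the
   two equations. *)
have E2 : ip (fun x => phi0 x * coupling g0 g1 x) phi1 = ip (fun x => phi1 x * coupling g0 g1 x) phi0.
  by congr Rintegral; apply/funext => x; ring.
move: E0 E1; rewrite E2 (qfC g0) (qfC g1) qf_stat0// qf_stat1// !add0r => -> .
rewrite !ipZl// !(ipC _ phi0) !(ipC _ phi1) => /eqP; rewrite -subr_eq0 => /eqP E.
apply: (mulfI l0); rewrite mulr0.
by have := congr1 -%R E; rewrite oppr0 => <-; ring.
Qed.

(** The hypotheses are the components of H f = - lam J^-1 g. Paired with f, they give <H f, f> on
    the left, and on the right a symplectic product that [Omega_conj] evaluates. *)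
Lemma mode_energy :
  eqae (fun x => - (wD 2 0 f0 x + wD 0 2 f0 x) + (W x * f0 x + phi0 x * coupling f0 f1 x))
       (fun x => lam * g1 x) ->
  eqae (fun x => - (wD 2 0 f1 x + wD 0 2 f1 x) + (W x * f1 x + phi1 x * coupling f0 f1 x))
       (fun x => - lam * g0 x) ->
  qf f0 f0 + qf f1 f1 + \int[mu]_x (b x * (phi0 x * f0 x + phi1 x * f1 x) ^+ 2) =
  lam * (ip g1 f0 - ip g0 f1).
Proof.
move=> e0 e1.
have b0 := ae_bounded_Hs h0; have b1 := ae_bounded_Hs h1.
have sc0 := SI_coupling sf0 sf1 b0; have sc1 := SI_coupling sf0 sf1 b1.
have E0 := qf_eq hf0 hf0 sc0 (SI_Z lam sg1) e0.
have E1 := qf_eq hf1 hf1 sc1 (SI_Z (- lam) sg0) e1.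
have -> : \int[mu]_x (b x * (phi0 x * f0 x + phi1 x * f1 x) ^+ 2) =
  ip (fun x => phi0 x * coupling f0 f1 x) f0 + ip (fun x => phi1 x * coupling f0 f1 x) f1.
  rewrite /ip -RiD; [|exact: SI_M..].
  by congr Rintegral; apply/funext => x; rewrite /coupling; ring.
rewrite addrACA E0 E1 !ipZl//; ring.
Qed.

End SecondVariation.

(** * Expansion of the energy *)

Section EnergyExpansion.
Context {R : realType}.
Notation mu := (@area R).
Variables (V : plane R -> R) (beta B : R -> R).
Hypotheses (bV : ae_bounded V) (sb : smooth1 beta) (hB : is_primitive0 beta B).

Definition energy_density (v0 v1 : plane R -> R) : plane R -> R := fun x =>
  (wD 1 0 v0 x ^+ 2 + wD 0 1 v0 x ^+ 2) + (wD 1 0 v1 x ^+ 2 + wD 0 1 v1 x ^+ 2)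
  + V x * (v0 x ^+ 2 + v1 x ^+ 2) + B (v0 x ^+ 2 + v1 x ^+ 2).

(** Since B vanishes at 0, this bounds B(|v|^2) by a multiple of |v|^2 when v is bounded, hence
    makes it integrable. *)
Lemma B_lipschitz (M : R) : exists2 L, 0 <= L & forall s, `|s| <= M -> `|B s| <= L * `|s|.
Proof.
have [L L0 hL] := cont_bounded M (cont_beta sb).
exists L => // s sM; have [B0 dB] := hB.
have := @MVT_bound _ B beta L 0 0 s dB B0; rewrite add0r expr1; apply => // r.
by rewrite subr0 expr0 mulr1 => rs; apply: hL; exact: le_trans sM.
Qed.

Lemma Int_normsq (v0 v1 : plane R -> R) : Hs 2 v0 -> Hs 2 v1 ->
  Int mu (fun x => v0 x ^+ 2 + v1 x ^+ 2).
Proof.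
move=> k0 k1; have [_ i0] := L2_SI k0.1; have [_ i1] := L2_SI k1.1.
exact: IntD.
Qed.

Lemma ae_bounded_normsq (v0 v1 : plane R -> R) : Hs 2 v0 -> Hs 2 v1 ->
  ae_bounded (fun x => v0 x ^+ 2 + v1 x ^+ 2).
Proof.
by move=> k0 k1; apply: ae_bounded_D; apply: ae_bounded_M; exact: ae_bounded_Hs.
Qed.

Lemma Int_energy_density (v0 v1 : plane R -> R) : Hs 2 v0 -> Hs 2 v1 -> Int mu (energy_density v0 v1).
Proof.
move=> k0 k1.
have [_ i1] := (@Hs_wD _ 2 1 0 v0 k0 isT).1.
have [_ i2] := (@Hs_wD _ 2 0 1 v0 k0 isT).1.
have [_ i3] := (@Hs_wD _ 2 1 0 v1 k1 isT).1.
have [_ i4] := (@Hs_wD _ 2 0 1 v1 k1 isT).1.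
have iq := Int_normsq k0 k1.
have [mq [M M0 hM]] := ae_bounded_normsq k0 k1.
have [L L0 hL] := B_lipschitz M.
apply: IntD; first by apply: IntD; [apply: IntD; apply: IntD|apply: Int_ae_bounded].
apply: (@Int_le _ _ _ mu _ (fun x => L * `|v0 x ^+ 2 + v1 x ^+ 2|)).
- apply: (measurableT_comp _ mq); apply: continuous_measurable_fun; exact: cont_B hB.
- by apply: IntZ; exact: Int_abs.
- by apply: filterS hM => x h; exact: hL.
Qed.

Variables (W : plane R -> R) (w : R) (phi0 phi1 f0 f1 : plane R -> R).
Hypotheses (h0 : Hs 2 phi0) (h1 : Hs 2 phi1) (hf0 : Hs 2 f0) (hf1 : Hs 2 f1).
Hypothesis WE : forall x, W x = w + V x + beta (phi0 x ^+ 2 + phi1 x ^+ 2).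

Let q0 x := phi0 x ^+ 2 + phi1 x ^+ 2.
Let q1 x := f0 x ^+ 2 + f1 x ^+ 2.
Let p x := phi0 x * f0 x + phi1 x * f1 x.
Let b x := 2 * derive1 beta (q0 x).

Definition qd (h k : plane R -> R) : plane R -> R := fun x =>
  wD 1 0 h x * wD 1 0 k x + wD 0 1 h x * wD 0 1 k x + W x * h x * k x.

Lemma ae_bounded_weight : ae_bounded W.
Proof.
have -> : W = (fun x => w + V x + beta (phi0 x ^+ 2 + phi1 x ^+ 2)).
  by apply/funext => x; exact: WE.
apply: ae_bounded_D; first by apply: ae_bounded_D => //; exact: ae_bounded_cst.
by apply: ae_bounded_comp; [exact: cont_beta|exact: ae_bounded_normsq].
Qed.

Lemma Int_qd (h k : plane R -> R) : Hs 2 h -> Hs 2 k -> Int mu (qd h k).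
Proof.
move=> hh hk; have sh := L2_SI hh.1; have sk := L2_SI hk.1.
have [i1 _] := (@Hs_wD _ 2 1 0 h hh isT); have [i2 _] := (@Hs_wD _ 2 0 1 h hh isT).
have [i3 _] := (@Hs_wD _ 2 1 0 k hk isT); have [i4 _] := (@Hs_wD _ 2 0 1 k hk isT).
apply: IntD; first by apply: IntD; exact: SI_M.
by apply: SI_M => //; apply: SI_ae_bounded => //; exact: ae_bounded_weight.
Qed.

Lemma qd_qf (h k : plane R -> R) : Hs 2 h -> Hs 2 k -> \int[mu]_x qd h k x = qf W h k.
Proof.
move=> hh hk; have sh := L2_SI hh.1; have sk := L2_SI hk.1.
have [i1 _] := (@Hs_wD _ 2 1 0 h hh isT); have [i2 _] := (@Hs_wD _ 2 0 1 h hh isT).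
have [i3 _] := (@Hs_wD _ 2 1 0 k hk isT); have [i4 _] := (@Hs_wD _ 2 0 1 k hk isT).
rewrite /qd RiD.
- by rewrite RiD//; exact: SI_M.
- by apply: IntD; exact: SI_M.
- by apply: SI_M => //; apply: SI_ae_bounded => //; exact: ae_bounded_weight.
Qed.

Definition perturb (c t : R) (h k : plane R -> R) : plane R -> R :=
  fun x => c * h x + (c * t) * k x.

(** Here a and d are the gradients of phi and f, x and y their values, u and v the gradient and the
    values of c (phi + t f). The potential enters through W' = w + V' + bq, which produces the
    densities of E + w Q; the term with factor - w is the change of mass, subtracted again. *)
Lemma energy_density_algebra (t c kap W' V' bq b1 Bq Bu C a1 a2 a3 a4 d1 d2 d3 d4
    u1 u2 u3 u4 x0 x1 y0 y1 v0 v1 : R) :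
  c ^+ 2 * (1 + kap * t ^+ 2) = 1 -> W' = w + V' + bq ->
  u1 = c * a1 + c * t * d1 -> u2 = c * a2 + c * t * d2 ->
  u3 = c * a3 + c * t * d3 -> u4 = c * a4 + c * t * d4 ->
  v0 = c * x0 + c * t * y0 -> v1 = c * x1 + c * t * y1 ->
  Bu <= Bq + bq * (c ^+ 2 * (2 * t * (x0 * y0 + x1 * y1) + t ^+ 2 * (y0 ^+ 2 + y1 ^+ 2)
      - kap * t ^+ 2 * (x0 ^+ 2 + x1 ^+ 2)))
    + 2 * c ^+ 2 * t ^+ 2 * (b1 * (x0 * y0 + x1 * y1) ^+ 2)
    + C * t ^+ 3 * (x0 ^+ 2 + x1 ^+ 2 + (y0 ^+ 2 + y1 ^+ 2)) ->
  (u1 ^+ 2 + u2 ^+ 2) + (u3 ^+ 2 + u4 ^+ 2) + V' * (v0 ^+ 2 + v1 ^+ 2) + Bu <=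
  (a1 ^+ 2 + a2 ^+ 2) + (a3 ^+ 2 + a4 ^+ 2) + V' * (x0 ^+ 2 + x1 ^+ 2) + Bq
  + 2 * c ^+ 2 * t * (a1 * d1 + a2 * d2 + W' * x0 * y0 + (a3 * d3 + a4 * d4 + W' * x1 * y1))
  + c ^+ 2 * t ^+ 2 * (d1 * d1 + d2 * d2 + W' * y0 * y0 + (d3 * d3 + d4 * d4 + W' * y1 * y1)
      + 2 * b1 * (x0 * y0 + x1 * y1) ^+ 2)
  + - kap * c ^+ 2 * t ^+ 2 * (a1 * a1 + a2 * a2 + W' * x0 * x0 + (a3 * a3 + a4 * a4 + W' * x1 * x1))
  + - w * c ^+ 2 * (2 * t * (x0 * y0 + x1 * y1) + t ^+ 2 * (y0 ^+ 2 + y1 ^+ 2)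
      + - kap * t ^+ 2 * (x0 ^+ 2 + x1 ^+ 2))
  + C * t ^+ 3 * (x0 ^+ 2 + x1 ^+ 2 + (y0 ^+ 2 + y1 ^+ 2)).
Proof.
move=> hc -> -> -> -> -> -> ->; rewrite -subr_ge0 => h; rewrite -subr_ge0.
apply: (le_trans h); rewrite -subr_ge0.
(* The normalization of c, multiplied by the quadratic part of the density of phi, accounts for the
   difference of the two sides. *)
have e0 : (a1 ^+ 2 + a2 ^+ 2 + (a3 ^+ 2 + a4 ^+ 2) + V' * (x0 ^+ 2 + x1 ^+ 2)) *
  (1 - c ^+ 2 * (1 + kap * t ^+ 2)) = 0 by rewrite hc subrr mulr0.
rewrite -[leLHS]e0 le_eqVlt; apply/orP; left; apply/eqP; ring.
Qed.

(** The bound holds only almost everywhere: the chosen weak derivatives of c (phi + t f) agree with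
    the combination of those of phi and f up to a null set. The constant is fixed before t and c. *)
Lemma energy_density_le (kap : R) : 0 <= kap -> exists2 C, 0 <= C &
  forall t c : R, 0 <= t <= 1 -> c ^+ 2 * (1 + kap * t ^+ 2) = 1 ->
  {ae mu, forall x, energy_density (perturb c t phi0 f0) (perturb c t phi1 f1) x <=
    energy_density phi0 phi1 x
    + 2 * c ^+ 2 * t * (qd phi0 f0 x + qd phi1 f1 x)
    + c ^+ 2 * t ^+ 2 * (qd f0 f0 x + qd f1 f1 x + b x * p x ^+ 2)
    + - kap * c ^+ 2 * t ^+ 2 * (qd phi0 phi0 x + qd phi1 phi1 x)
    + - w * c ^+ 2 * (2 * t * p x + t ^+ 2 * q1 x + - kap * t ^+ 2 * q0 x)
    + C * t ^+ 3 * (q0 x + q1 x)}.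
Proof.
move=> k0.
have [_ [M0 M00 hM0]] := ae_bounded_normsq h0 h1.
have [_ [M1 M10 hM1]] := ae_bounded_normsq hf0 hf1.
have [C C0 hC] := taylor_curve sb hB (addr_ge0 M00 M10) k0.
exists C => // t c t01 hc.
have [e1 _ _] := wD_lin c (c * t) h0 hf0 (isT : (1 + 0 <= 2)%N).
have [e2 _ _] := wD_lin c (c * t) h0 hf0 (isT : (0 + 1 <= 2)%N).
have [e3 _ _] := wD_lin c (c * t) h1 hf1 (isT : (1 + 0 <= 2)%N).
have [e4 _ _] := wD_lin c (c * t) h1 hf1 (isT : (0 + 1 <= 2)%N).
apply: filter_app hM0; apply: filter_app hM1; apply: filter_app e1.
apply: filter_app e2; apply: filter_app e3; apply: filter_app e4.
apply: aeW => x E4 E3 E2 E1 x1 x0.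
apply: (energy_density_algebra hc (WE x) (esym E1) (esym E2) (esym E3) (esym E4) (erefl _) (erefl _)).
have -> : (c * phi0 x + c * t * f0 x) ^+ 2 + (c * phi1 x + c * t * f1 x) ^+ 2 =
  c ^+ 2 * (q0 x + 2 * t * p x + t ^+ 2 * q1 x) by rewrite /q0 /p /q1; ring.
have q00 : 0 <= q0 x by rewrite addr_ge0// sqr_ge0.
have q10 : 0 <= q1 x by rewrite addr_ge0// sqr_ge0.
apply: hC => //.
- by rewrite q00 (le_trans (ler_norm _))// (le_trans x0)// lerDl.
- by rewrite q10 (le_trans (ler_norm _))// (le_trans x1)// lerDr.
- rewrite -subr_ge0 /p /q0 /q1.
  have -> : forall a0 a1 b0 b1 : R, (a0 ^+ 2 + a1 ^+ 2) * (b0 ^+ 2 + b1 ^+ 2) - (a0 * b0 + a1 * b1) ^+ 2 =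
    (a0 * b1 - a1 * b0) ^+ 2 by move=> *; ring.
  exact: sqr_ge0.
Qed.

(** Only the Hessian term and the remainder survive in the application: the terms with phi in [qf]
    vanish because phi is critical, and the bracket with factor - w vanishes because the mass is
    kept. *)
Lemma energy_expansion (kap : R) : 0 <= kap -> exists2 C, 0 <= C &
  forall t c : R, 0 <= t <= 1 -> c ^+ 2 * (1 + kap * t ^+ 2) = 1 ->
  \int[mu]_x energy_density (perturb c t phi0 f0) (perturb c t phi1 f1) x <=
    \int[mu]_x energy_density phi0 phi1 x
    + 2 * c ^+ 2 * t * (qf W phi0 f0 + qf W phi1 f1)
    + c ^+ 2 * t ^+ 2 * (qf W f0 f0 + qf W f1 f1 + \int[mu]_x (b x * p x ^+ 2))
    + - kap * c ^+ 2 * t ^+ 2 * (qf W phi0 phi0 + qf W phi1 phi1)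
    + - w * c ^+ 2 * (2 * t * (ip phi0 f0 + ip phi1 f1) + t ^+ 2 * (ip f0 f0 + ip f1 f1)
        + - kap * t ^+ 2 * (ip phi0 phi0 + ip phi1 phi1))
    + C * t ^+ 3 * (ip phi0 phi0 + ip phi1 phi1 + (ip f0 f0 + ip f1 f1)).
Proof.
move=> k0; have [C C0 hC] := energy_density_le k0; exists C => // t c t01 hc.
have s0 := L2_SI h0.1; have s1 := L2_SI h1.1.
have sf0 := L2_SI hf0.1; have sf1 := L2_SI hf1.1.
have ipI (h k h' k' : plane R -> R) : SI h -> SI k -> SI h' -> SI k' ->
    Int mu (fun x => h x * k x + h' x * k' x) /\
    \int[mu]_x (h x * k x + h' x * k' x) = ip h k + ip h' k'.
  move=> sh sk sh' sk'; split; first by apply: IntD; exact: SI_M.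
  by rewrite RiD//; exact: SI_M.
have [pI pE] := ipI _ _ _ _ s0 sf0 s1 sf1.
have [q0I q0E] := ipI _ _ _ _ s0 s0 s1 s1.
have [q1I q1E] := ipI _ _ _ _ sf0 sf0 sf1 sf1.
have qdI (h k h' k' : plane R -> R) : Hs 2 h -> Hs 2 k -> Hs 2 h' -> Hs 2 k' ->
    Int mu (fun x => qd h k x + qd h' k' x) /\
    \int[mu]_x (qd h k x + qd h' k' x) = qf W h k + qf W h' k'.
  move=> hh hk hh' hk'; split; first by apply: IntD; exact: Int_qd.
  by rewrite -!qd_qf// RiD//; exact: Int_qd.
have [d1I d1E] := qdI _ _ _ _ h0 hf0 h1 hf1.
have [d0I d0E] := qdI _ _ _ _ h0 h0 h1 h1.
have [d2I d2E] := qdI _ _ _ _ hf0 hf0 hf1 hf1.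
have bp : Int mu (fun x => b x * p x ^+ 2).
  have -> : (fun x => b x * p x ^+ 2) = (fun x => (b x * p x) * p x).
    by apply/funext => x; ring.
  have sp : SI p.
    by apply: SI_D; apply: SI_ae_bounded => //; exact: ae_bounded_Hs.
  apply: SI_M => //; apply: SI_ae_bounded => //.
  apply: ae_bounded_M; first exact: ae_bounded_cst.
  by apply: ae_bounded_comp; [exact: cont_beta1|exact: ae_bounded_normsq].
have q0I' : Int mu q0 by move: q0I; congr Int; apply/funext => x; rewrite -!expr2.
have q1I' : Int mu q1 by move: q1I; congr Int; apply/funext => x; rewrite -!expr2.
have q0E' : \int[mu]_x q0 x = ip phi0 phi0 + ip phi1 phi1.
  by rewrite -q0E; congr Rintegral; apply/funext => x; rewrite -!expr2.
have q1E' : \int[mu]_x q1 x = ip f0 f0 + ip f1 f1.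
  by rewrite -q1E; congr Rintegral; apply/funext => x; rewrite -!expr2.
have I0 := Int_energy_density h0 h1.
have I1 := IntD I0 (IntZ (2 * c ^+ 2 * t) d1I).
have I2' := IntD d2I bp.
have I2 := IntD I1 (IntZ (c ^+ 2 * t ^+ 2) I2').
have I3 := IntD I2 (IntZ (- kap * c ^+ 2 * t ^+ 2) d0I).
have I4a := IntD (IntZ (2 * t) pI) (IntZ (t ^+ 2) q1I').
have I4' := IntD I4a (IntZ (- kap * t ^+ 2) q0I').
have I4 := IntD I3 (IntZ (- w * c ^+ 2) I4').
have I5' := IntD q0I' q1I'.
have I5 := IntD I4 (IntZ (C * t ^+ 3) I5').
have hu := Int_energy_density (Hs_lin c (c * t) h0 hf0) (Hs_lin c (c * t) h1 hf1).
have := Ri_le hu I5 (hC t c t01 hc).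
rewrite (RiD I4 (IntZ (C * t ^+ 3) I5')) (RiZ _ I5') (RiD q0I' q1I').
rewrite (RiD I3 (IntZ (- w * c ^+ 2) I4')) (RiZ _ I4').
rewrite (RiD I4a (IntZ (- kap * t ^+ 2) q0I')) (RiZ _ q0I').
rewrite (RiD (IntZ (2 * t) pI) (IntZ (t ^+ 2) q1I')) (RiZ _ pI) (RiZ _ q1I').
rewrite (RiD I2 (IntZ (- kap * c ^+ 2 * t ^+ 2) d0I)) (RiZ _ d0I).
rewrite (RiD I1 (IntZ (c ^+ 2 * t ^+ 2) I2')) (RiZ _ I2') (RiD d2I bp).
rewrite (RiD I0 (IntZ (2 * c ^+ 2 * t) d1I)) (RiZ _ d1I).
by rewrite d1E d2E d0E pE q0E' q1E'.
Qed.

End EnergyExpansion.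

(** * Reduction to components *)

Section Components.
Local Open Scope complex_scope.
Context {R : realType}.
Implicit Types (v phi : field R) (X : cfield R).

Lemma sum_ord2 (U : nmodType) (F : 'I_2 -> U) : \sum_i F i = F 0 + F 1.
Proof.
rewrite !big_ord_recl big_ord0 addr0; congr (_ + F _); exact: val_inj.
Qed.

Lemma normsqE (a : 'cV[R]_2) : normsq a = a 0 0 ^+ 2 + a 1 0 ^+ 2.
Proof. by rewrite /normsq /dot sum_ord2 !expr2. Qed.

Lemma ord2P (P : 'I_2 -> Prop) : P 0 -> P 1 -> forall i, P i.
Proof.
move=> p0 p1 [[|[|//]] h].
- by rewrite (_ : Ordinal h = 0)//; exact: val_inj.
- by rewrite (_ : Ordinal h = 1)//; exact: val_inj.
Qed.

Variables (V : plane R -> R) (beta : R -> R) (w : R) (phi : field R).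

Definition weight : plane R -> R :=
  fun x => w + V x + beta (vcomp phi 0 x ^+ 2 + vcomp phi 1 x ^+ 2).

(** The i-th component of H v, where L = J H, split into the diagonal part and the coupling. *)
Definition hess v (i : 'I_2) : plane R -> R := fun x =>
  - (wD 2 0 (vcomp v i) x + wD 0 2 (vcomp v i) x) +
  (weight x * vcomp v i x + vcomp phi i x *
    coupling (fun y => 2 * derive1 beta (vcomp phi 0 y ^+ 2 + vcomp phi 1 y ^+ 2))
      (vcomp phi 0) (vcomp phi 1) (vcomp v 0) (vcomp v 1) x).

Lemma hessE v x i : (- lap v x + zeroth V beta w phi v x) i 0 = hess v i x.
Proof.
rewrite /hess /zeroth /lap !mxE normsqE /dot sum_ord2 /coupling /weight /vcomp.
by congr (_ + _); ring.
Qed.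

Lemma Lreal0 v x : Lreal V beta w phi v x 0 0 = hess v 1 x.
Proof. by rewrite /Lreal mxE sum_ord2 !hessE !mxE/= mul0r add0r mul1r. Qed.

Lemma Lreal1 v x : Lreal V beta w phi v x 1 0 = - hess v 0 x.
Proof. by rewrite /Lreal mxE sum_ord2 !hessE !mxE/= mul0r addr0 mulN1r. Qed.

(** With X = f + i g, the real and imaginary parts of L X = i l X read J H f = - l g and J H g = l
    f; J then exchanges the components, with a sign. *)
Lemma ker_components X (l : R) : ker (Lop V beta w phi) (0 +i* l) X ->
  [/\ eqae (hess (reF X) 0) (fun x => l * vcomp (imF X) 1 x),
      eqae (hess (reF X) 1) (fun x => - l * vcomp (imF X) 0 x),
      eqae (hess (imF X) 0) (fun x => - l * vcomp (reF X) 1 x) &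
      eqae (hess (imF X) 1) (fun x => l * vcomp (reF X) 0 x)].
Proof.
move=> [_ h].
have E x i : (Lop V beta w phi X - (0 +i* l) *: X) x = (0 : cfield R) x ->
    Lreal V beta w phi (reF X) x i 0 = - l * vcomp (imF X) i x /\
    Lreal V beta w phi (imF X) x i 0 = l * vcomp (reF X) i x.
  move=> /(congr1 (fun M : 'cV[R[i]]_2 => M i 0)).
  rewrite !mxE /vcomp /reF /imF !mxE; case: (X x i 0) => a b /= [e1 e2].
  by split; [move: e1|move: e2]; rewrite ?mul0r ?add0r ?sub0r ?opprK; lra.
split; apply: filterS h => x h.
- by have [] := E x 1 h; rewrite Lreal1 mulNr => /oppr_inj.
- by have [] := E x 0 h; rewrite Lreal0.
- by have [_] := E x 1 h; rewrite Lreal1 mulNr => <-; rewrite opprK.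
- by have [_] := E x 0 h; rewrite Lreal0.
Qed.

Lemma stationary_components : stationary V beta w phi ->
  forall i, eqae (fun x => - (wD 2 0 (vcomp phi i) x + wD 0 2 (vcomp phi i) x)
                           + weight x * vcomp phi i x) 0.
Proof.
have alg (a b v bt p : R) : a + b - v * p - w * p - bt * p = 0 ->
    - (a + b) + (w + v + bt) * p = 0.
  by move=> e; apply: oppr_inj; rewrite oppr0 -e; ring.
move=> h i; apply: filterS h => x /(congr1 (fun M : 'cV[R]_2 => M i 0)).
rewrite normsqE /weight /lap /vcomp !mxE.
exact: alg.
Qed.

Lemma Jmx_inv : invmx (Jmx R[i]) = - Jmx R[i].
Proof.
have JJ : Jmx R[i] *m (- Jmx R[i]) = 1%:M.
  apply/matrixP => i j; rewrite mxE sum_ord2 !mxE.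
  by move: i j; apply: ord2P; apply: ord2P;
    rewrite /= ?mul0r ?oppr0 ?mulr0 ?addr0 ?add0r ?mul1r ?mulN1r ?opprK.
have [uJ _] := mulmx1_unit JJ.
by rewrite -[LHS]mulmx1 -JJ mulmxA mulVmx// mul1mx.
Qed.

(** For X = f + i g, antisymmetry gives Omega(X, conj X) = - 2 i Omega(f, g), and Omega(f, g) is the
    integral of f_0 g_1 - f_1 g_0. *)
Lemma Omega_conj X (s : R) : cinH 2 X -> Omega X (conjF X) = 0 +i* s ->
  ip (vcomp (imF X) 1) (vcomp (reF X) 0) - ip (vcomp (imF X) 0) (vcomp (reF X) 1)
  = - (2^-1 * s).
Proof.
move=> [hf hg]; rewrite /Omega /bracket /cint => -[_].
have sf i := L2_SI (hf i).1; have sg i := L2_SI (hg i).1.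
have -> : (fun x => complex.Im (\sum_i (invmx (Jmx R[i]) *m X x) i 0 * conjF X x i 0)) =
  (fun x => 2 * (vcomp (imF X) 0 x * vcomp (reF X) 1 x) +
    - 2 * (vcomp (imF X) 1 x * vcomp (reF X) 0 x)).
  apply/funext => x; rewrite Jmx_inv sum_ord2 !mxE !sum_ord2 /conjF /vcomp /reF /imF !mxE /=.
  case: (X x 0 0) (X x 1 0) => [a b] [c d] /=; ring.
have i1 := SI_M (sg 0) (sf 1); have i2 := SI_M (sg 1) (sf 0).
rewrite (RiD (IntZ 2 i1) (IntZ (- 2) i2)) (RiZ _ i1) (RiZ _ i2) -/(ip _ _) -/(ip _ _).
by move=> <-; field.
Qed.

End Components.

(** * Choice of the parameters of the perturbation *)

Section Choice.
Context {R : realType}.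

(** In the application X t^3 is the remainder of the energy, c^2 t^2 l its decrease, with l half the
    frequency of the mode, and t^2 S bounds the square of the H^1 distance. *)
Lemma small_parameter (kap X S l eps : R) : 0 <= kap -> 0 <= X -> 0 <= S -> 0 < l -> 0 < eps ->
  exists t c : R, [/\ 0 < t <= 1, 0 < c <= 1, c ^+ 2 * (1 + kap * t ^+ 2) = 1,
    X * t ^+ 3 < c ^+ 2 * t ^+ 2 * l & ((1 - c) ^+ 2 <= (kap * t) ^+ 2) /\ t ^+ 2 * S < eps ^+ 2].
Proof.
move=> k0 X0 S0 l0 e0.
(* t = 1 / (1 + Y) gives t Y < 1, so t times each summand is below 1. In the first summand 1 + kap
   bounds c^-2; in the second, 1 + S avoids a square root of S. *)
pose Y := X * (1 + kap) / l + (1 + S) / eps.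
have S10 : 0 < (1 + S) / eps by rewrite divr_gt0// ltr_pwDl.
have Y1 : 0 <= X * (1 + kap) / l by rewrite divr_ge0 ?mulr_ge0 ?addr_ge0// ltW.
have Y0 : 0 < Y by rewrite ltr_wpDl.
have Y10 : 0 < 1 + Y by rewrite addr_gt0.
pose t := (1 + Y)^-1.
have t0 : 0 < t by rewrite invr_gt0.
have t1 : t <= 1 by rewrite invf_le1// lerDl ltW.
have tY : t * Y < 1 by rewrite mulrC ltr_pdivrMr// mul1r ltrDr.
pose D := 1 + kap * t ^+ 2.
have kt0 : 0 <= kap * t ^+ 2 by rewrite mulr_ge0// sqr_ge0.
have D0 : 0 < D by rewrite ltr_wpDr.
have D1 : 1 <= D by rewrite lerDl.
pose c := Num.sqrt D^-1.
have c2 : c ^+ 2 = D^-1 by rewrite sqr_sqrtr// invr_ge0 ltW.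
have c0 : 0 < c by rewrite sqrtr_gt0 invr_gt0.
have cD : c ^+ 2 * D = 1 by rewrite c2 mulVf// gt_eqF.
have c1 : c <= 1.
  by rewrite -(@ler_pXn2r _ 2)// ?nnegrE ?(ltW c0)// expr1n c2 invf_le1.
have cc : c ^+ 2 <= c by rewrite expr2 ler_piMl// ltW.
have t21 : t ^+ 2 <= t by rewrite expr2 ler_piMl// ltW.
exists t, c; split => //; rewrite ?t0 ?c0//.
  have -> : X * t ^+ 3 = t ^+ 2 * (X * t) by ring.
  have -> : c ^+ 2 * t ^+ 2 * l = t ^+ 2 * (c ^+ 2 * l) by ring.
  rewrite ltr_pM2l ?exprn_gt0//.
  apply: (@le_lt_trans _ _ (c ^+ 2 * (t * (X * (1 + kap))))).
    have -> : X * t = c ^+ 2 * D * (X * t) by rewrite cD mul1r.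
    rewrite -mulrA ler_pM2l ?exprn_gt0//.
    have -> : t * (X * (1 + kap)) = (1 + kap) * (X * t) by ring.
    by rewrite ler_wpM2r ?mulr_ge0 ?(ltW t0)// lerD2l ler_piMr// (le_trans t21).
  rewrite ltr_pM2l ?exprn_gt0// -[ltRHS]mul1r -ltr_pdivrMr// -mulrA.
  by apply: le_lt_trans tY; rewrite ler_pM2l// lerDl ltW.
split.
  rewrite lerXn2r ?nnegrE ?mulr_ge0 ?(ltW t0) ?subr_ge0//.
  apply: (@le_trans _ _ (1 - c ^+ 2)); first by rewrite lerD2l lerN2.
  have -> : 1 - c ^+ 2 = c ^+ 2 * (kap * t ^+ 2) by rewrite -{1}cD /D; ring.
  apply: (@le_trans _ _ (kap * t ^+ 2)); first by rewrite ler_piMl// (le_trans cc).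
  by rewrite ler_wpM2l.
have h : t * (1 + S) < eps.
  rewrite -[ltRHS]mul1r -(ltr_pdivrMr _ _ e0) -mulrA; apply: le_lt_trans tY.
  by rewrite ler_pM2l// lerDr.
apply: (@le_lt_trans _ _ ((t * (1 + S)) ^+ 2)); last first.
  have h0 : 0 <= t * (1 + S) by rewrite mulr_ge0 ?addr_ge0 ?(ltW t0).
  by rewrite ltr_pXn2r// nnegrE ltW.
rewrite exprMn ler_pM2l ?exprn_gt0//; nra.
Qed.

End Choice.

(** * Norms and energy in terms of inner products of components *)

Section Norms.
Context {R : realType}.
Notation mu := (@area R).
Implicit Types (u v : field R).

Lemma ae_bounded_decay (V : plane R -> R) : V_decay V -> ae_bounded V.
Proof.
move=> [sV _ /(_ 0%N 0%N) [C [c [C0 c0 h]]]].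
have [cV _] := sV 0%N; split; first exact: cont_measurable_plane.
exists C; first exact: ltW.
apply: aeW => x; apply: le_trans (h x) _; rewrite ler_piMr ?(ltW C0)// expR_le1//.
by rewrite mulNr oppr_le0 mulr_ge0 ?(ltW c0)// sqrtr_ge0.
Qed.

Definition H1sq (h : plane R -> R) : R := ip h h + dirichlet h h.

Lemma H1sq_ge0 (h : plane R -> R) : 0 <= H1sq h.
Proof. by rewrite !addr_ge0 ?ip_ge0. Qed.

Lemma L2n_ip (h : plane R -> R) : SI h -> L2n h ^+ 2 = ip h h.
Proof.
by move=> sh; rewrite L2n_sqr//; congr Rintegral; apply/funext => x; rewrite expr2.
Qed.

Lemma H1normE v : (forall i, Hs 1 (vcomp v i)) ->
  H1norm v = Num.sqrt (H1sq (vcomp v 0) + H1sq (vcomp v 1)).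
Proof.
move=> hv; rewrite /H1norm; congr Num.sqrt; rewrite sum_ord2.
have E i : L2n (vcomp v i) ^+ 2 + L2n (wD 1 0 (vcomp v i)) ^+ 2
   + L2n (wD 0 1 (vcomp v i)) ^+ 2 = H1sq (vcomp v i).
  have [s1 _] := @Hs_wD _ 1 1 0 _ (hv i) isT.
  have [s2 _] := @Hs_wD _ 1 0 1 _ (hv i) isT.
  rewrite -addrA.
  exact: (f_equal2 +%R (L2n_ip (L2_SI (hv i).1)) (f_equal2 +%R (L2n_ip s1) (L2n_ip s2))).
exact: (f_equal2 +%R (E 0) (E 1)).
Qed.

Lemma L2normE v : inL2 v ->
  L2norm v = Num.sqrt (ip (vcomp v 0) (vcomp v 0) + ip (vcomp v 1) (vcomp v 1)).
Proof.
move=> hv; rewrite /L2norm sum_ord2 !L2n_ip//; exact: L2_SI (hv _).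
Qed.

Lemma ip_lin (a b : R) (h k : plane R -> R) : SI h -> SI k ->
  ip (fun x => a * h x + b * k x) (fun x => a * h x + b * k x) =
  a ^+ 2 * ip h h + 2 * (a * b) * ip h k + b ^+ 2 * ip k k.
Proof.
move=> sh sk; have s := SI_D (SI_Z a sh) (SI_Z b sk).
rewrite ipDl ?ipZl//; [|exact: SI_Z..].
rewrite !(ipC _ (fun x => _ + _)) !ipDl ?ipZl//; try exact: SI_Z.
rewrite (ipC k h); ring.
Qed.

(** The parallelogram identity: the gap between the two sides is the square norm of a h - b k. *)
Lemma ip_lin_le (a b : R) (h k : plane R -> R) : SI h -> SI k ->
  ip (fun x => a * h x + b * k x) (fun x => a * h x + b * k x) <=
  2 * (a ^+ 2 * ip h h + b ^+ 2 * ip k k).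
Proof.
move=> sh sk; have := ip_ge0 (fun x => a * h x + - b * k x).
by rewrite !ip_lin// -subr_ge0 => H; rewrite -subr_ge0; apply: le_trans H _; lra.
Qed.

Lemma H1sq_lin_le (a b : R) (h k : plane R -> R) : Hs 2 h -> Hs 2 k ->
  H1sq (fun x => a * h x + b * k x) <= 2 * (a ^+ 2 * H1sq h + b ^+ 2 * H1sq k).
Proof.
move=> hh hk.
have D i j : (i + j <= 2)%N -> ip (wD i j (fun x => a * h x + b * k x)) (wD i j (fun x => a * h x + b * k x))
    <= 2 * (a ^+ 2 * ip (wD i j h) (wD i j h) + b ^+ 2 * ip (wD i j k) (wD i j k)).
  move=> ij; have [e s _] := wD_lin a b hh hk ij.
  have [sh _] := Hs_wD hh ij; have [sk _] := Hs_wD hk ij.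
  have sl := SI_D (SI_Z a sh) (SI_Z b sk).
  by rewrite -(ip_ael sl s s e) ipC -(ip_ael sl s sl e) ip_lin_le.
have I0 := ip_lin_le a b (L2_SI hh.1) (L2_SI hk.1).
have alg (x y z x1 y1 z1 x2 y2 z2 : R) : x <= 2 * (a ^+ 2 * x1 + b ^+ 2 * x2) ->
    y <= 2 * (a ^+ 2 * y1 + b ^+ 2 * y2) -> z <= 2 * (a ^+ 2 * z1 + b ^+ 2 * z2) ->
    x + (y + z) <= 2 * (a ^+ 2 * (x1 + (y1 + z1)) + b ^+ 2 * (x2 + (y2 + z2))).
  by move=> *; lra.
exact: alg I0 (D 1%N 0%N isT) (D 0%N 1%N isT).
Qed.

Lemma energyE (V : plane R -> R) (B : R -> R) u :
  energy V B u = 2^-1 * \int[mu]_x energy_density V B (vcomp u 0) (vcomp u 1) x.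
Proof.
congr (_ * _); congr Rintegral; apply/funext => x.
by rewrite sum_ord2 normsqE.
Qed.

End Norms.

(** * Lowering the energy along a mode of positive Krein sign *)

Section Trapping.
Local Open Scope complex_scope.
Context {R : realType}.
Notation mu := (@area R).
Variables (V : plane R -> R) (beta B : R -> R) (w l : R) (phi : field R) (X : cfield R).
Hypotheses (bV : ae_bounded V) (sb : smooth1 beta) (hB : is_primitive0 beta B).
Hypotheses (hphi : inH 2 phi) (hX : cinH 2 X) (l0 : 0 < l).
Hypothesis stat : stationary V beta w phi.
Hypothesis kerX : ker (Lop V beta w phi) (0 +i* l) X.
Hypothesis krein : Omega X (conjF X) = 0 +i* 1.
Hypothesis mass0 : ip (vcomp phi 0) (vcomp phi 0) + ip (vcomp phi 1) (vcomp phi 1) != 0.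

Lemma not_trapped (eps : R) : 0 < eps -> exists u : field R,
    [/\ inH 1 u, H1norm (phi - u) < eps, L2norm u = L2norm phi &
        energy V B u < energy V B phi].
Proof.
move=> e0.
have [hf hg] := hX.
pose F := vcomp (reF X); pose G := vcomp (imF X); pose P := vcomp phi.
have h0 : Hs 2 (P 0) := hphi 0; have h1 : Hs 2 (P 1) := hphi 1.
have s0 := L2_SI h0.1; have s1 := L2_SI h1.1.
have sF0 := L2_SI (hf 0).1; have sF1 := L2_SI (hf 1).1.
pose W := weight V beta w phi.
have WE x : W x = w + V x + beta (P 0 x ^+ 2 + P 1 x ^+ 2) by [].
have bW : ae_bounded W := ae_bounded_weight bV sb h0 h1 WE.
pose b x : R := 2 * derive1 beta (P 0 x ^+ 2 + P 1 x ^+ 2).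
have bb : ae_bounded b.
  apply: ae_bounded_M; first exact: ae_bounded_cst.
  by apply: ae_bounded_comp; [exact: cont_beta1|exact: ae_bounded_normsq].
have st i := stationary_components stat i.
have [k1 k2 k3 k4] := ker_components kerX.
have orth := mode_orthogonal bW bb h0 h1 (st 0) (st 1) (hf 0) (hf 1) (hg 0) (hg 1) (lt0r_neq0 l0) k3 k4.
have en := mode_energy bW bb h0 h1 (hf 0) (hf 1) (hg 0) (hg 1) k1 k2.
have kr := Omega_conj hX krein.
have z0 k := @qf_stat0 _ W (P 0) bW h0 (st 0) k.
have z1 k := @qf_stat1 _ W (P 0) (P 1) bW h0 h1 (st 1) k.
pose K := ip (P 0) (P 0) + ip (P 1) (P 1).
pose m := ip (F 0) (F 0) + ip (F 1) (F 1).
have K0 : 0 < K by rewrite lt0r mass0/= addr_ge0 ?ip_ge0.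
have m0 : 0 <= m by rewrite addr_ge0 ?ip_ge0.
(* The ratio |f|^2 / |phi|^2, which makes c (phi + t f) keep the mass of phi. *)
pose kap := m / K.
have kap0 : 0 <= kap by rewrite (divr_ge0 m0 (ltW K0)).
have [C C0 hC] := energy_expansion bV sb hB h0 h1 (hf 0) (hf 1) WE kap0.
pose NP := H1sq (P 0) + H1sq (P 1); pose NF := H1sq (F 0) + H1sq (F 1).
have NP0 : 0 <= NP by rewrite addr_ge0 ?H1sq_ge0.
have NF0 : 0 <= NF by rewrite addr_ge0 ?H1sq_ge0.
have X0 : 0 <= C * (K + m) := mulr_ge0 C0 (addr_ge0 (ltW K0) m0).
have S0 : 0 <= 2 * (kap ^+ 2 * NP + NF).
  exact: (mulr_ge0 (ler0n _ _) (addr_ge0 (mulr_ge0 (sqr_ge0 _) NP0) NF0)).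
have L0 : 0 < 2^-1 * l by rewrite mulr_gt0.
(* The second argument is the constant of the energy remainder; the third bounds |phi - u|^2 / t^2
   in H^1, through |1 - c| <= kap t and c t <= t; the fourth is - <H f, f>. *)
have [t [c [/andP[t0 t1] /andP[c0 c1] hc et [ec eS]]]] :=
  @small_parameter _ kap (C * (K + m)) (2 * (kap ^+ 2 * NP + NF)) (2^-1 * l) eps kap0 X0 S0 L0 e0.
pose u : field R := fun x => c *: phi x + (c * t) *: reF X x.
have uE i : vcomp u i = perturb c t (P i) (F i).
  by apply/funext => x; rewrite /P /F /perturb /vcomp /u /reF !mxE.
have hu i : Hs 2 (vcomp u i) by rewrite uE; exact: Hs_lin.
have dE i : vcomp (phi - u) i = (fun x => (1 - c) * P i x + (- (c * t)) * F i x).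
  by apply/funext => x; rewrite /P /F /vcomp /u /reF !mxE; ring.
have hd i : Hs 2 (vcomp (phi - u) i) by rewrite dE; exact: Hs_lin.
exists u; split.
- by move=> i; exact: Hs_le (hu i).
- rewrite H1normE; last by move=> i; exact: Hs_le (hd i).
  have E i : H1sq (vcomp (phi - u) i) <= 2 * ((1 - c) ^+ 2 * H1sq (P i) + (c * t) ^+ 2 * H1sq (F i)).
    by rewrite dE -(sqrrN (c * t)); exact: H1sq_lin_le (hphi i) (hf i).
  suff : Num.sqrt (H1sq (vcomp (phi - u) 0) + H1sq (vcomp (phi - u) 1)) ^+ 2 < eps ^+ 2.
    by rewrite ltr_pXn2r// nnegrE ?sqrtr_ge0 ?(ltW e0).
  rewrite (sqr_sqrtr (addr_ge0 (H1sq_ge0 _) (H1sq_ge0 _))); apply: le_lt_trans eS.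
  have alg (x0 x1 a0 a1 b0 b1 : R) : x0 <= 2 * ((1 - c) ^+ 2 * a0 + (c * t) ^+ 2 * b0) ->
      x1 <= 2 * ((1 - c) ^+ 2 * a1 + (c * t) ^+ 2 * b1) -> 0 <= a0 + a1 -> 0 <= b0 + b1 ->
      x0 + x1 <= t ^+ 2 * (2 * (kap ^+ 2 * (a0 + a1) + (b0 + b1))).
    move=> e1 e2 a01 b01; apply: le_trans (lerD e1 e2) _.
    have -> : 2 * ((1 - c) ^+ 2 * a0 + (c * t) ^+ 2 * b0) + 2 * ((1 - c) ^+ 2 * a1 + (c * t) ^+ 2 * b1) =
      2 * ((1 - c) ^+ 2 * (a0 + a1) + (c * t) ^+ 2 * (b0 + b1)) by ring.
    have -> : t ^+ 2 * (2 * (kap ^+ 2 * (a0 + a1) + (b0 + b1))) =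
      2 * ((kap * t) ^+ 2 * (a0 + a1) + t ^+ 2 * (b0 + b1)) by ring.
    have ct : c * t <= t by rewrite ler_piMl ?(ltW t0).
    have ct2 : (c * t) ^+ 2 <= t ^+ 2 by rewrite lerXn2r// nnegrE ?mulr_ge0 ?(ltW c0) ?(ltW t0).
    by rewrite ler_pM2l//; apply: lerD; apply: ler_wpM2r.
  exact: alg (E 0) (E 1) NP0 NF0.
- rewrite !L2normE; [|by move=> i; case: (hphi i)|by move=> i; case: (hu i)].
  congr Num.sqrt; rewrite !uE.
  (* Orthogonality removes the cross terms, and what is left is c^2 (K + t^2 m) = c^2 (1 + kap t^2)
     K = K. *)
  have mE : m = kap * K by rewrite /kap divfK// gt_eqF.
  have alg (x0 x1 a0 a1 p0 p1 b0 b1 : R) : x0 = c ^+ 2 * a0 + 2 * (c * (c * t)) * p0 + (c * t) ^+ 2 * b0 ->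
      x1 = c ^+ 2 * a1 + 2 * (c * (c * t)) * p1 + (c * t) ^+ 2 * b1 -> p0 + p1 = 0 ->
      b0 + b1 = kap * (a0 + a1) -> x0 + x1 = a0 + a1.
    move=> -> -> p01 b01.
    transitivity (c ^+ 2 * ((a0 + a1) + t ^+ 2 * (b0 + b1)) + 2 * c ^+ 2 * t * (p0 + p1)); first by ring.
    rewrite p01 b01; transitivity (c ^+ 2 * (1 + kap * t ^+ 2) * (a0 + a1)); first by ring.
    by rewrite hc mul1r.
  exact: (alg _ _ _ _ _ _ _ _ (ip_lin c (c * t) s0 sF0) (ip_lin c (c * t) s1 sF1) orth mE).
- rewrite !energyE ltr_pM2l// !uE.
  have := hC t c _ hc; rewrite (ltW t0) t1 => /(_ isT) h; apply: le_lt_trans h _.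
  (* The value of <H f, f>, by [mode_energy] and the Krein normalization. *)
  have qE : qf W (F 0) (F 0) + qf W (F 1) (F 1) +
     \int[mu]_x (b x * (P 0 x * F 0 x + P 1 x * F 1 x) ^+ 2) = - (2^-1 * l).
    by rewrite en kr; ring.
  have mE : m = kap * K by rewrite /kap divfK// gt_eqF.
  rewrite orth qE !z0// !z1// -/K -/m.
  (* The change of mass along the curve, zero by the choice of [kap]. *)
  have -> : - w * c ^+ 2 * (2 * t * 0 + t ^+ 2 * m + - kap * t ^+ 2 * K) = 0.
    by rewrite mE; ring.
  move: et; move: (\int[mu]_x _) => J et.
  have -> : C * t ^+ 3 * (K + m) = C * (K + m) * t ^+ 3 by ring.
  rewrite !addr0 !mulr0 !addr0 mulrN; move: et.
  move: (C * (K + m) * t ^+ 3) (c ^+ 2 * t ^+ 2 * _) => a d; rewrite -addrA gtrDl (addrC (- d)) subr_lt0; exact.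
Qed.

End Trapping.

(** * Nontriviality of the wave *)

Section MassPositive.
Local Open Scope complex_scope.
Context {R : realType}.

(* Otherwise J phi = 0 would span the kernel, and 0 would not be an eigenvalue. *)
Lemma mass_neq0 (V : plane R -> R) (beta : R -> R) (w : R) (phi dphi : field R)
    (n : nat) (lam : 'I_n -> R) : inL2 phi ->
  kernel_hyp V beta w phi dphi -> point_spectrum V beta w phi lam ->
  ip (vcomp phi 0) (vcomp phi 0) + ip (vcomp phi 1) (vcomp phi 1) != 0.
Proof.
move=> hphi [[_ span] _] [_ _ _ /(_ 0) [_ ev] _]; apply/eqP => K0.
have [X kX] := ev (or_introl erefl); apply.
have s i := L2_SI (hphi i).
have K00 : ip (vcomp phi 0) (vcomp phi 0) = 0.
  by apply/eqP; move/eqP: K0; rewrite paddr_eq0 ?ip_ge0// => /andP[].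
have K10 : ip (vcomp phi 1) (vcomp phi 1) = 0.
  by apply/eqP; move/eqP: K0; rewrite paddr_eq0 ?ip_ge0// => /andP[].
have [c hc] := span _ kX.
have e0 := ip_eq0 (s 0) K00; have e1 := ip_eq0 (s 1) K10.
apply: filter_app hc; apply: filter_app e0; apply: filter_app e1.
apply: aeW => x x1 x0 ->; rewrite big_ord1.
have p0 : phi x = 0.
  apply/matrixP => i j; rewrite ord1 mxE; move: i; apply: ord2P; [exact: x0|exact: x1].
have J0 : Jmx R *m phi x = 0 by rewrite p0 mulmx0.
have r0 : realF (fun y => Jmx R *m phi y) x = 0.
  by apply/matrixP => i j; rewrite /realF /cplx mxE J0 !mxE.
rewrite -[LHS]/(c ord0 *: realF (fun y => Jmx R *m phi y) x) r0.
exact: scaler0.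
Qed.

End MassPositive.

(** * Standing waves with a mode of positive Krein sign are not trapped by the energy *)

Theorem proposition1p8 (R : realType) (V : plane R -> R) (beta B : R -> R)
  (m : nat) (O : set R) (phi dphi d2phi : R -> field R)
  (n : R -> nat) (lam : forall w : R, 'I_(n w) -> R)
  (hB : is_primitive0 beta B)
  (h1 : beta_smooth beta)
  (h2 : beta_growth beta)
  (h3 : V_decay V)
  (h4 : standing_waves V beta m O phi dphi d2phi)
  (h5 : mass_nondegenerate O phi)
  (h6 : forall w, O w -> spectral_stability V beta w (phi w))
  (h7 : forall w, O w -> kernel_hyp V beta w (phi w) (dphi w))
  (h8 : forall w, O w -> semisimple V beta w (phi w))
  (h9 : forall w, O w -> no_embedded V beta w (phi w))
  (h10 : forall w, O w -> no_resonance V beta w (phi w))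
  (h11 : forall w, O w -> point_spectrum V beta w (phi w) (lam w))
  (h14 : forall w, O w -> krein_positive V beta w (phi w) (lam w)) :
  forall w, O w -> forall eps : R, 0 < eps ->
  exists u : field R,
    [/\ inH 1 u, H1norm (phi w - u) < eps, L2norm u = L2norm (phi w) &
        energy V B u < energy V B (phi w)].
Proof.
move=> w Ow eps e0.
have [_ _ reg /(_ w Ow) [stat _]] := h4.
have [/(_ w Ow) [hS _ _ _] _] := reg 2%N.
have hphi : inH 2 (phi w) by move=> i; case: (hS i).
have [xi [s [[xiS xik _ _ xio] [j sj]]]] := h14 w Ow.
have [_ lam0 _ _ _] := h11 w Ow.
have hX : cinH 2 (xi j) by have [a b] := xiS j 2%N; split => i; [case: (a i)|case: (b i)].
have krein := xio j j; rewrite eqxx mulr1n sj in krein.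
have mass0 := mass_neq0 (fun i => (hphi i).1) (h7 w Ow) (h11 w Ow).
exact: (not_trapped (ae_bounded_decay h3) h1.2 hB hphi hX (lam0 j) stat (xik j) krein mass0 e0).
Qed.
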